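(* Let $\mathbf{Y}$ be the $n\times p$ data matrix whose rows are $n$ independent samples from $\mathrm{N}(0,\boldsymbol{\Sigma})$ given the covariance matrix $\boldsymbol{\Sigma}$, let $\mathbf{S}=\mathbf{Y}'\mathbf{Y}$, and let $(\boldsymbol{\Sigma},\mathbf{Z})$ have the hierarchical spike and slab prior defined in the context with $\mathbf{A}=\boldsymbol{\Sigma}$. Let $\mathbf{V}=(v_{z_{ij}}^2)$ be the $p\times p$ symmetric matrix with zeros on the diagonal and $(v_{z_{ij}}^2)_{i<j}$ in the upper diagonal entries. Focusing on the last column and row, partition $$\boldsymbol{\Sigma}=\begin{pmatrix}\boldsymbol{\Sigma}_{11}&\boldsymbol{\sigma}_{12}\\ \boldsymbol{\sigma}_{12}'&\sigma_{22}\end{pmatrix},\qquad \mathbf{S}=\begin{pmatrix}\mathbf{S}_{11}&\mathbf{s}_{12}\\ \mathbf{s}_{12}'&s_{22}\end{pmatrix},\qquad \mathbf{V}=\begin{pmatrix}\mathbf{V}_{11}&\mathbf{v}_{12}\\ \mathbf{v}_{12}'&0\end{pmatrix},$$ where the upper-left blocks are $(p-1)\times(p-1)$. Consider the change of variables $(\boldsymbol{\sigma}_{12},\sigma_{22})\mapsto(\mathbf{u},v)$ with $\mathbf{u}=\boldsymbol{\sigma}_{12}$ and $v=\sigma_{22}-\boldsymbol{\sigma}_{12}'\boldsymbol{\Sigma}_{11}^{-1}\boldsymbol{\sigma}_{12}$. Then the full conditional distributions are $$(\mathbf{u}\mid\mathbf{Y},\mathbf{Z},\boldsymbol{\Sigma}_{11},v)\sim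 \mathrm{N}\Big[\{\mathbf{B}+\mathrm{diag}(\mathbf{v}_{12}^{-1})\}^{-1}\mathbf{w},\ \{\mathbf{B}+\mathrm{diag}(\mathbf{v}_{12}^{-1})\}^{-1}\Big],$$ $$(v\mid\mathbf{Y},\mathbf{Z},\boldsymbol{\Sigma}_{11},\mathbf{u})\sim \mathrm{GIG}\big(1-n/2,\ \lambda,\ \mathbf{u}'\boldsymbol{\Sigma}_{11}^{-1}\mathbf{S}_{11}\boldsymbol{\Sigma}_{11}^{-1}\mathbf{u}-2\mathbf{s}_{12}'\boldsymbol{\Sigma}_{11}^{-1}\mathbf{u}+s_{22}\big),$$ where $\mathbf{B}=\boldsymbol{\Sigma}_{11}^{-1}\mathbf{S}_{11}\boldsymbol{\Sigma}_{11}^{-1}v^{-1}+\lambda\boldsymbol{\Sigma}_{11}^{-1}$ and $\mathbf{w}=\boldsymbol{\Sigma}_{11}^{-1}\mathbf{s}_{12}v^{-1}$.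
   Context: Let $M^+$ denote the cone of $p\times p$ symmetric positive definite real matrices. Parameters: $v_0>0$, $v_1>0$, $\lambda>0$, $\pi\in(0,1)$, collected as $\theta=\{v_0,v_1,\pi,\lambda\}$. The binary latent variables are $\mathbf{Z}=(z_{ij})_{i<j}\in\{0,1\}^{p(p-1)/2}$, and $v_{z_{ij}}=v_0$ if $z_{ij}=0$, $v_{z_{ij}}=v_1$ if $z_{ij}=1$. The hierarchical prior for a random matrix $\mathbf{A}=(a_{ij})\in M^+$ and $\mathbf{Z}$ is $$p(\mathbf{A}\mid\mathbf{Z},\theta)=\{C(\mathbf{Z},v_0,v_1,\lambda)\}^{-1}\prod_{i<j}\mathrm{N}(a_{ij}\mid 0,v_{z_{ij}}^2)\prod_i \mathrm{Exp}(a_{ii}\mid \lambda/2)\,1_{\{\mathbf{A}\in M^+\}},$$ $$p(\mathbf{Z}\mid\theta)=\{C(\theta)\}^{-1}C(\mathbf{Z},v_0,v_1,\lambda)\prod_{i<j}\pi^{z_{ij}}(1-\pi)^{1-z_{ij}},$$ where $\mathrm{N}(a\mid 0,v^2)$ is the normal density with mean $0$ and variance $v^2$ at $a$, $\mathrm{Exp}(a\mid r)=r e^{-ra}1_{a>0}$, and $C(\mathbf{Z},v_0,v_1,\lambda)$, $C(\theta)$ are normalizing constants. Densities of $\mathbf{A}$ are with respect to Lebesgue measure on the entries $(a_{ij})_{i\le j}$. The data $\mathbf{Y}$ depend on $(\mathbf{A},\mathbf{Z})$ only through $\mathbf{A}$. $\mathrm{N}[\boldsymbol{\mu},\mathbf{C}]$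 is the multivariate normal distribution with mean $\boldsymbol{\mu}$ and covariance $\mathbf{C}$. The vector $\mathbf{v}_{12}^{-1}$ is the entrywise reciprocal of $\mathbf{v}_{12}$ (whose entries are the variances $v_{z_{ip}}^2$, $i=1,\dots,p-1$), and $\mathrm{diag}(\cdot)$ is the diagonal matrix with the given diagonal. $\mathrm{GIG}(q,a,b)$ is the generalized inverse Gaussian distribution, with probability density on $x>0$ $$p(x)=\frac{(a/b)^{q/2}}{2K_q(\sqrt{ab})}\,x^{q-1}e^{-(ax+b/x)/2},$$ where $K_q$ is the modified Bessel function of the second kind. *)

(* Defs.v *)
(* MathComp-Analysis over an abstract R : realType *)
From HB Require Import structures.
From mathcomp Require Import all_boot all_order all_algebra.
From mathcomp Require Import all_classical all_reals all_analysis.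
From mathcomp Require Import measurable_realfun.
Set Implicit Arguments.
Unset Strict Implicit.
Unset Printing Implicit Defensive.
Import Order.TTheory GRing.Theory Num.Theory.
Import numFieldNormedType.Exports.
Local Open Scope classical_set_scope.
Local Open Scope ring_scope.

(* sigma-algebra on aT generated by a family of maps f i : aT -> T *)
Definition coord_sigma d (T : measurableType d) (I aT : Type)
    (f : I -> aT -> T) : set (set aT) :=
  <<s \bigcup_(i in [set: I]) preimage_set_system setT (f i) measurable >>.

Lemma coord_sigma_fun d (T : measurableType d) (I aT : Type)
    (f : I -> aT -> T) i A : measurable A -> coord_sigma f (f i @^-1` A).
Proof.
by move=> mA; apply: sub_sigma_algebra; exists i => //; exists A; rewrite ?setTI.
Qed.

Lemma coord_sigma_measurable_fun d d' (T : measurableType d)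
    (aT : measurableType d') I (f : I -> aT -> T)
    d0 (T0 : measurableType d0) (g : T0 -> aT) :
  (@measurable _ aT `<=` coord_sigma f) ->
  (forall i, measurable_fun setT (f i \o g)) -> measurable_fun setT g.
Proof.
move=> sub mf _ A mA; rewrite setTI; have {mA}/sub := mA.
move=> /(_ (image_set_system setT g measurable)); rewrite /image_set_system /=.
rewrite setTI; apply; split.
  exact/sigma_algebra_image/sigma_algebra_measurable.
move=> _ [i _ [B mB <-]] /=.
by rewrite !setTI -[_ @^-1` _]setTI; exact: mf.
Qed.

Definition measure_ffun_display : measure_display -> measure_display.
Proof. exact. Qed.

Section measurable_ffun.
Context {d} {T : measurableType d} {I : finType}.

HB.instance Definition _ := isPointed.Build {ffun I -> T} [ffun=> point].

Definition ffun_coor (i : I) (f : {ffun I -> T}) : T := f i.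

Let ffun0 : coord_sigma ffun_coor set0. Proof. exact: sigma_algebra0. Qed.
Let ffunC A : coord_sigma ffun_coor A -> coord_sigma ffun_coor (~` A).
Proof. exact: sigma_algebraC. Qed.
Let ffunU (F : _^nat) :
  (forall i, coord_sigma ffun_coor (F i)) -> coord_sigma ffun_coor (\bigcup_i (F i)).
Proof. exact: sigma_algebra_bigcup. Qed.

HB.instance Definition _ := @isMeasurable.Build (measure_ffun_display d)
  {ffun I -> T} (coord_sigma ffun_coor) ffun0 ffunC ffunU.

Lemma measurable_ffun_app (i : I) :
  measurable_fun [set: {ffun I -> T}] (fun f : {ffun I -> T} => f i).
Proof. by move=> _ A mA; rewrite setTI; exact: (@coord_sigma_fun _ _ _ _ ffun_coor). Qed.

Lemma measurable_ffunP d0 (T0 : measurableType d0) (g : T0 -> {ffun I -> T}) :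
  (forall i, measurable_fun setT (fun x => g x i)) -> measurable_fun setT g.
Proof. exact: (@coord_sigma_measurable_fun _ _ _ _ _ ffun_coor). Qed.

End measurable_ffun.

Definition measure_mx_display : measure_display -> measure_display.
Proof. exact. Qed.

(* the Borel sigma-algebra of 'M[R]_(m, n), generated by the entries *)
Section measurable_mx.
Context {R : realType} {m n : nat}.

Definition mx_coor (ij : 'I_m * 'I_n) (A : 'M[R]_(m, n)) : R := A ij.1 ij.2.

Let mx0 : coord_sigma mx_coor set0. Proof. exact: sigma_algebra0. Qed.
Let mxC A : coord_sigma mx_coor A -> coord_sigma mx_coor (~` A).
Proof. exact: sigma_algebraC. Qed.
Let mxU (F : _^nat) :
  (forall i, coord_sigma mx_coor (F i)) -> coord_sigma mx_coor (\bigcup_i (F i)).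
Proof. exact: sigma_algebra_bigcup. Qed.

HB.instance Definition _ := @isMeasurable.Build (measure_mx_display default_measure_display)
  'M[R]_(m, n) (coord_sigma mx_coor) mx0 mxC mxU.

Lemma measurable_mx_coef (i : 'I_m) (j : 'I_n) :
  measurable_fun [set: 'M[R]_(m, n)] (fun A : 'M[R]_(m, n) => A i j).
Proof.
by move=> _ A mA; rewrite setTI; exact: (@coord_sigma_fun _ _ _ _ mx_coor (i, j)).
Qed.

Lemma measurable_mxP d0 (T0 : measurableType d0) (g : T0 -> 'M[R]_(m, n)) :
  (forall i j, measurable_fun setT (fun x => g x i j)) -> measurable_fun setT g.
Proof.
by move=> mg; apply: (@coord_sigma_measurable_fun _ _ _ _ _ mx_coor) => // -[i j];
  exact: mg.
Qed.

End measurable_mx.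

Section sigma_finite_pushforward.
Context d1 d2 (T1 : measurableType d1) (T2 : measurableType d2) (R : realType).
Variables (mu : {sigma_finite_measure set T1 -> \bar R}).
Variables (f : T1 -> T2) (g : T2 -> T1).
Hypotheses (mf : measurable_fun setT f) (mg : measurable_fun setT g).
Hypothesis fK : cancel f g.

Definition sf_pushforward_fun : set T2 -> \bar R := pushforward mu f.

HB.instance Definition _ := Measure.copy sf_pushforward_fun
  (measure_function_pushforward__canonical__measure_function_Measure mu mf).

Let pushforward_sigma_finite : sigma_finite setT sf_pushforward_fun.
Proof.
have [F FT Foo] := sigma_finiteT mu.
exists (fun k => g @^-1` F k); first by rewrite -preimage_bigcup -FT preimage_setT.
move=> k; have [mFk Fkoo] := Foo k; split; first by rewrite -[_ @^-1` _]setTI; exact: mg.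
by rewrite /sf_pushforward_fun /pushforward -comp_preimage (_ : g \o f = id)//; apply/funext.
Qed.

HB.instance Definition _ :=
  Measure_isSigmaFinite.Build _ _ _ sf_pushforward_fun (pushforward_sigma_finite).

Definition sf_pushforward : {sigma_finite_measure set T2 -> \bar R} :=
  sf_pushforward_fun.

Lemma sf_pushforwardE A : sf_pushforward A = mu (f @^-1` A).
Proof. by []. Qed.

End sigma_finite_pushforward.

Section sigma_finite_product.
Context d1 d2 (T1 : measurableType d1) (T2 : measurableType d2) (R : realType).
Variables (m1 : {sigma_finite_measure set T1 -> \bar R}).
Variables (m2 : {sigma_finite_measure set T2 -> \bar R}).

Definition sf_product_fun : set (T1 * T2) -> \bar R := (m1 \x m2)%E.

HB.instance Definition _ := Measure.copy sf_product_fun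
  (lebesgue_integral_fubini_product_measure1__canonical__measure_function_Measure m1 m2).

Let product_sigma_finite : sigma_finite setT sf_product_fun.
Proof.
have /sigma_finiteP[F [TF ndF Foo]] := sigma_finiteT m1.
have /sigma_finiteP[G [TG ndG Goo]] := sigma_finiteT m2.
exists (fun n => F n `*` G n).
  rewrite -setXTT TF TG predeqE => -[x y]; split.
    move=> [/= [n _ Fnx] [k _ Gky]]; exists (maxn n k) => //; split.
    - by move: x Fnx; exact/subsetPset/ndF/leq_maxl.
    - by move: y Gky; exact/subsetPset/ndG/leq_maxr.
  by move=> [n _ []/= ? ?]; split; exists n.
move=> k; have [? ?] := Foo k; have [? ?] := Goo k.
split; first exact: measurableX.
by rewrite /sf_product_fun product_measure1E// lte_mul_pinfty// ge0_fin_numE.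
Qed.

HB.instance Definition _ :=
  Measure_isSigmaFinite.Build _ _ _ sf_product_fun (product_sigma_finite).

(* m1 \x m2, with its sigma-finiteness attached *)
Definition sf_product : {sigma_finite_measure set (T1 * T2)%type -> \bar R} :=
  sf_product_fun.

Lemma sf_productE A : sf_product A = (m1 \x m2)%E A.
Proof. by []. Qed.

End sigma_finite_product.

Section lebesgue.
Context {R : realType}.

Definition cons_of n (p : R * n.-tuple R) : n.+1.-tuple R := [tuple of p.1 :: p.2].
Definition uncons_of n (t : n.+1.-tuple R) : R * n.-tuple R :=
  (thead t, [tuple of behead t]).

Lemma measurable_cons_of n : measurable_fun setT (@cons_of n).
Proof. exact: measurable_cons. Qed.

Lemma measurable_uncons_of n : measurable_fun setT (@uncons_of n).
Proof.
by apply: measurable_fun_pair; [exact: measurable_tnth|exact: measurable_behead].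
Qed.

Lemma cons_ofK n : cancel (@cons_of n) (@uncons_of n).
Proof. by move=> [x t]; congr pair; exact/val_inj. Qed.

Lemma measurable_toR : measurable_fun setT (id : measurableTypeR R -> R).
Proof. by move=> _ A mA; rewrite setTI. Qed.

Lemma measurable_ofR : measurable_fun setT (id : R -> measurableTypeR R).
Proof. by move=> _ A mA; rewrite setTI. Qed.

(* lebesgue_measure, retyped from measurableTypeR R to R *)
Definition lebesgueR : {sigma_finite_measure set R -> \bar R} :=
  sf_pushforward (@lebesgue_measure R) measurable_toR measurable_ofR (frefl id).

Fixpoint lebesgue_tuple n : {sigma_finite_measure set (n.-tuple R) -> \bar R} :=
  if n is n'.+1 then
    sf_pushforward
      (sf_product lebesgueR (lebesgue_tuple n'))
      (@measurable_cons_of n') (@measurable_uncons_of n') (@cons_ofK n')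
  else \d_[tuple].

Section ffun.
Context {I : finType}.

Definition ffun_of (t : #|I|.-tuple R) : {ffun I -> R} :=
  [ffun i => tnth t (enum_rank i)].
Definition tuple_of_ffun (f : {ffun I -> R}) : #|I|.-tuple R :=
  [tuple f (enum_val k) | k < #|I|].

Lemma measurable_ffun_of : measurable_fun setT ffun_of.
Proof.
apply: measurable_ffunP => i; under eq_fun do rewrite ffunE.
exact: measurable_tnth.
Qed.

Lemma measurable_tuple_of_ffun : measurable_fun setT tuple_of_ffun.
Proof.
apply/measurable_fun_tnthP => k.
rewrite (_ : _ \o _ = fun f : {ffun I -> R} => f (enum_val k)).
  exact: measurable_ffun_app.
by apply/funext => f /=; rewrite tnth_mktuple.
Qed.

Lemma ffun_ofK : cancel ffun_of tuple_of_ffun.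
Proof.
by move=> t; apply: eq_from_tnth => k; rewrite tnth_mktuple ffunE enum_valK.
Qed.

Definition lebesgue_ffun : {sigma_finite_measure set {ffun I -> R} -> \bar R} :=
  sf_pushforward (lebesgue_tuple #|I|)
    measurable_ffun_of measurable_tuple_of_ffun ffun_ofK.
End ffun.

Section mx.
Context {m n : nat}.

Definition mx_of (f : {ffun 'I_m * 'I_n -> R}) : 'M[R]_(m, n) :=
  \matrix_(i, j) f (i, j).
Definition ffun_of_mx (A : 'M[R]_(m, n)) := [ffun ij : 'I_m * 'I_n => A ij.1 ij.2].

Lemma measurable_mx_of : measurable_fun setT mx_of.
Proof.
apply: measurable_mxP => i j; under eq_fun do rewrite mxE.
exact: measurable_ffun_app.
Qed.

Lemma measurable_ffun_of_mx : measurable_fun setT ffun_of_mx.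
Proof.
apply: measurable_ffunP => ij; under eq_fun do rewrite ffunE.
exact: measurable_mx_coef.
Qed.

Lemma mx_ofK : cancel mx_of ffun_of_mx.
Proof. by move=> f; apply/ffunP => -[i j]; rewrite ffunE mxE. Qed.

Definition lebesgue_mx : {sigma_finite_measure set 'M[R]_(m, n) -> \bar R} :=
  sf_pushforward lebesgue_ffun measurable_mx_of measurable_ffun_of_mx mx_ofK.
End mx.

End lebesgue.

(* index set of the entries (i, j) of a p x p matrix with r i j; below r is
   leq (i <= j) or ltn (i < j) *)
Definition tri (r : rel nat) p := {ij : 'I_p * 'I_p | r ij.1 ij.2}.

(* symmetric matrix whose (i, j) and (j, i) entries are f (i, j) when r i j,
   the entries with neither r i j nor r j i being 0 *)
Definition symfill (R : realType) (r : rel nat) p (f : {ffun tri r p -> R}) :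
    'M[R]_p :=
  \matrix_(i, j)
    if insub (i, j) is Some e then f e
    else if insub (j, i) is Some e then f e else 0.

Section lebesgue_sym.
Context {R : realType} {p : nat}.

Definition sym_of (f : {ffun tri leq p -> R}) : 'M[R]_p := symfill f.
Definition ffun_of_sym (A : 'M[R]_p) : {ffun tri leq p -> R} :=
  [ffun e => A (val e).1 (val e).2].

Lemma measurable_sym_of : measurable_fun setT sym_of.
Proof.
apply: measurable_mxP => i j.
have mo (o o' : option (tri leq p)) : measurable_fun setT
    (fun f : {ffun tri leq p -> R} => oapp f (oapp f 0 o') o).
  case: o => [e|] /=; first exact: measurable_ffun_app.
  by case: o' => [e|] /=; [exact: measurable_ffun_app|exact: measurable_cst].
apply: eq_measurable_fun (mo (insub (i, j)) (insub (j, i))) => f _.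
by rewrite mxE.
Qed.

Lemma measurable_ffun_of_sym : measurable_fun setT ffun_of_sym.
Proof.
apply: measurable_ffunP => e; under eq_fun do rewrite ffunE.
exact: measurable_mx_coef.
Qed.

Lemma sym_ofK : cancel sym_of ffun_of_sym.
Proof. by move=> f; apply/ffunP => -[[i j] ij]; rewrite ffunE mxE insubT. Qed.

(* Lebesgue measure on the entries (a_ij)_{i <= j}, carried to the symmetric
   matrices inside 'M[R]_p *)
Definition lebesgue_sym : {sigma_finite_measure set 'M[R]_p -> \bar R} :=
  sf_pushforward lebesgue_ffun
    measurable_sym_of measurable_ffun_of_sym sym_ofK.

End lebesgue_sym.

Section distributions.
Context {R : realType}.

Definition posdef {k} : set 'M[R]_k :=
  [set A | A^T = A /\
    forall x : 'cV[R]_k, x != 0 -> 0 < (x^T *m A *m x) ord0 ord0].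

(* meaningful for C positive definite *)
Definition mvn_pdf {k} (mu : 'cV[R]_k) (C : 'M[R]_k) (x : 'cV[R]_k) : R :=
  (Num.sqrt ((2 * pi) ^+ k * \det C))^-1 *
  expR (- ((x - mu)^T *m invmx C *m (x - mu)) ord0 ord0 / 2).

Definition mvn {k} (mu : 'cV[R]_k) (C : 'M[R]_k) (A : set 'cV[R]_k) : \bar R :=
  (\int[lebesgue_mx]_(x in A) (mvn_pdf mu C x)%:E)%E.

Definition cosh (t : R) : R := (expR t + expR (- t)) / 2.

(* modified Bessel function of the second kind, for x > 0:
   K_q(x) = int_0^oo exp(- x cosh t) cosh(q t) dt *)
Definition besselK (q x : R) : R :=
  \int[lebesgue_measure]_(t in `[0, +oo[) (expR (- x * cosh t) * cosh (q * t)).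

(* meaningful for a, b > 0 *)
Definition gig_pdf (q a b x : R) : R :=
  if 0 < x then
    (a / b) `^ (q / 2) / (2 * besselK q (Num.sqrt (a * b))) *
    x `^ (q - 1) * expR (- (a * x + b / x) / 2)
  else 0.

Definition gig (q a b : R) (A : set R) : \bar R :=
  (\int[lebesgue_measure]_(x in A) (gig_pdf q a b x)%:E)%E.

End distributions.

Section spike_and_slab.
Context {R : realType} {p : nat} (v0 v1 lambda pi0 : R).

(* (z_ij)_{i < j} *)
Local Notation latent := {ffun tri ltn p -> bool}.

Definition sd_of (b : bool) : R := if b then v1 else v0.

(* normal_pdf is parameterized by the standard deviation *)
Definition ss_unnormalized (z : latent) (A : 'M[R]_p) : R :=
  (\prod_(e : tri ltn p) normal_pdf 0 (sd_of (z e)) (A (val e).1 (val e).2)) *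
  (\prod_(i < p) exponential_pdf (lambda / 2) (A i i)) *
  \1_posdef A.

Definition ss_const (z : latent) : R :=
  \int[lebesgue_sym]_A ss_unnormalized z A.

(* p(A | Z) *)
Definition ss_law (z : latent) (E : set 'M[R]_p) : \bar R :=
  (\int[lebesgue_sym]_(A in E) ((ss_const z)^-1 * ss_unnormalized z A)%R%:E)%E.

Definition latent_unnormalized (z : latent) : R :=
  ss_const z *
  \prod_(e : tri ltn p) (pi0 ^+ (z e) * (1 - pi0) ^+ (1 - z e)).

(* p(Z) *)
Definition latent_pmf (z : latent) : R :=
  (\sum_z' latent_unnormalized z')^-1 * latent_unnormalized z.

Definition slab_variances (z : latent) : 'M[R]_p :=
  symfill [ffun e : tri ltn p => sd_of (z e) ^+ 2].

End spike_and_slab.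

Section conditional_laws.
Context {R : realType} d (Omega : measurableType d) (P : probability Omega R).

(* K is a regular conditional distribution of X given W: measurable in the
   conditioning value, almost surely a probability measure, and
   P(X in A, W in B) = E[1_B(W) K(W, A)] *)
Definition cond_law d1 d2 (T1 : measurableType d1) (T2 : measurableType d2)
    (X : Omega -> T1) (W : Omega -> T2) (K : T2 -> set T1 -> \bar R) : Prop :=
  [/\ forall A, measurable A -> measurable_fun [set: T2] (K ^~ A),
      \forall w \ae P, exists mu : probability T1 R,
        forall A, measurable A -> K (W w) A = mu A
    & forall A B, measurable A -> measurable B ->
        P (X @^-1` A `&` W @^-1` B) = (\int[P]_(w in W @^-1` B) K (W w) A)%E].

(* given W, the rows of Y (written as column vectors) are independent with
   common conditional distribution K *)
Definition cond_iid_rows n p d2 (T2 : measurableType d2)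
    (Y : Omega -> 'M[R]_(n, p)) (W : Omega -> T2)
    (K : T2 -> set 'cV[R]_p -> \bar R) : Prop :=
  forall (A : 'I_n -> set 'cV[R]_p) (B : set T2),
    (forall i, measurable (A i)) -> measurable B ->
    P ([set w | forall i, A i (row i (Y w))^T] `&` W @^-1` B) =
    (\int[P]_(w in W @^-1` B) \prod_(i < n) K (W w) (A i))%E.

End conditional_laws.

(* Main.v *)
(* Conditionally on Z, the pair (Y, Sigma) has a density with respect to the
   product of Lebesgue measures on the rows of Y and on the entries of Sigma on
   or above the diagonal.  The map (Sigma11, u, sigma22) |-> (Sigma11, u, v) is
   a shear, so it preserves Lebesgue measure, and positive definiteness of Sigma
   becomes positive definiteness of Sigma11 together with v > 0.  By the Schur
   decompositions
     det Sigma = v * det Sigma11,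
     x' Sigma^-1 x = x1' Sigma11^-1 x1 + (x2 - u' Sigma11^-1 x1)^2 / v,
   the joint density of (Y, Z, Sigma11, u, v) is
     g(Y, Z, Sigma11) * v^(-n/2) *
       exp (- (rss / v + lambda (v + u' Sigma11^-1 u) + u' diag(v12^-1) u) / 2)
   with rss = |Y2 - Y1 Sigma11^-1 u|^2.  It is Gaussian in u (complete the
   square) and generalized inverse Gaussian in v; the latter needs rss > 0, which
   holds almost surely because a row of Y lies on a given hyperplane with
   probability zero. *)
Require Import Defs.
From HB Require Import structures.
From mathcomp Require Import all_boot all_order all_algebra.
From mathcomp Require Import all_classical all_reals all_analysis.
From mathcomp Require Import measurable_realfun.
From mathcomp Require Import ring lra.
Set Implicit Arguments.
Unset Strict Implicit.
Unset Printing Implicit Defensive.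
Import Order.TTheory GRing.Theory Num.Theory.
Import numFieldNormedType.Exports.
Local Open Scope classical_set_scope.
Local Open Scope ring_scope.

(** * Measures with a density and conditional laws *)

(** The kernels of the statement are defined at every conditioning value, also where [Sigma11] is
    singular or [v <= 0], and there they need not be probability measures. The criterion
    [cond_law_density] therefore asks, at each fixed conditioning value, only that the joint density
    vanish identically or be a multiple of a density of integral one. The multiplier is whatever
    remains of the joint density once the normal or GIG factor is taken out; integration identifies
    it with the marginal density. Both conditionals thus rest on one factorization, whose constant
    depends on neither [u] nor [v], and on the normalization of two families of densities, one by
    induction on the dimension and one by reduction to the Bessel integral. For [v] this dichotomy
    may fail where rss is 0, since the factor left in [v] is then not a GIG density. The joint
    density is reset to 0 there; this is harmless because that event is null as soon as there is one
    row of data. Reference measures are compared only through their values on rectangles, so the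
    enumerations of indices hidden in [lebesgue_ffun] never have to be matched. *)

Section density.
Local Open Scope ereal_scope.
Context d (T : measurableType d) (R : realType).
Variables (mu : {measure set T -> \bar R}) (f : T -> R).
Hypotheses (f_ge0 : forall x, (0 <= f x)%R) (mf : measurable_fun setT f).

Definition with_density (A : set T) : \bar R := \int[mu]_(x in A) (f x)%:E.
Local Notation nu := with_density.

Let nu0 : nu set0 = 0. Proof. by rewrite /with_density integral_set0. Qed.
Let nu_ge0 A : 0 <= nu A.
Proof. by apply: integral_ge0 => x _; rewrite lee_fin. Qed.
Let nu_sigma_additive : semi_sigma_additive nu.
Proof.
by apply: semi_sigma_additive_nng_induced => //; exact/measurable_EFinP.
Qed.

HB.instance Definition _ := isMeasure.Build _ _ _ nu nu0 nu_ge0 nu_sigma_additive.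

Definition density_measure : {measure set T -> \bar R} := nu.

Import HBNNSimple.

Lemma density_measureE A : density_measure A = \int[mu]_(x in A) (f x)%:E.
Proof. by []. Qed.

Let integralT_density (h : T -> \bar R) :
  measurable_fun setT h -> (forall x, 0 <= h x) ->
  \int[density_measure]_x h x = \int[mu]_x (h x * (f x)%:E).
Proof.
move=> mh h0; pose g := nnsfun_approx measurableT mh.
have mg n : measurable_fun setT (fun x => (g n x)%:E) by exact/measurable_EFinP.
have gf n : measurable_fun setT (fun x => (g n x)%:E * (f x)%:E).
  by apply: emeasurable_funM => //; exact/measurable_EFinP.
transitivity (limn (fun n => \int[density_measure]_x (g n x)%:E)).
  rewrite -monotone_convergence//.
  - by apply: eq_integral => y _; apply/esym/cvg_lim => //; exact: cvg_nnsfun_approx.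
  - by move=> n y _; rewrite lee_fin.
  - by move=> y _ m n mn; rewrite lee_fin; exact/lefP/nd_nnsfun_approx.
transitivity (limn (fun n => \int[mu]_x ((g n x)%:E * (f x)%:E))).
  congr (limn _); apply/funext => n.
  transitivity (\sum_(k \in range (g n))
      \int[density_measure]_x (k * \1_(g n @^-1` [set k]) x)%:E).
    under eq_integral do rewrite fimfunE -fsumEFin//.
    rewrite ge0_integral_fsum//.
    - by move=> y; exact/measurable_EFinP/measurable_funM.
    - by move=> y x _; rewrite nnfun_muleindic_ge0.
  transitivity (\sum_(k \in range (g n))
      \int[mu]_x ((k * \1_(g n @^-1` [set k]) x)%:E * (f x)%:E)); last first.
    rewrite -ge0_integral_fsum//.
    - apply: eq_integral => x _.
      rewrite [in RHS]fimfunE -fsumEFin// ge0_mule_fsuml// => r.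
      by rewrite nnfun_muleindic_ge0.
    - move=> r; apply: emeasurable_funM; last exact/measurable_EFinP.
      exact/measurable_EFinP/measurable_funM.
    - by move=> r x _; rewrite mule_ge0// ?nnfun_muleindic_ge0// lee_fin.
  apply: eq_fsbigr => r /[!inE] -[x _ grx].
  rewrite integralZl_indic_nnsfun// integral_indic// setIT.
  have r0 : (0 <= r)%R by rewrite -grx.
  under [RHS]eq_integral do rewrite EFinM -muleA.
  rewrite ge0_integralZl//.
  - congr (_ * _); rewrite density_measureE integral_mkcond; apply: eq_integral => y _.
    by rewrite patchE indicE; case: ifPn => _; rewrite ?mul1e ?mul0e.
  - by apply: emeasurable_funM; exact/measurable_EFinP.
  - by move=> y _; rewrite mule_ge0// lee_fin.
rewrite -monotone_convergence//.
- apply: eq_integral => x _; apply/cvg_lim => //.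
  by apply: cvgeZr => //; exact: cvg_nnsfun_approx.
- by move=> n x _; rewrite mule_ge0// lee_fin.
- move=> x _ m n mn; rewrite lee_wpmul2r ?lee_fin//.
  exact/lefP/nd_nnsfun_approx.
Qed.

Lemma integral_density D (h : T -> \bar R) : measurable D ->
  measurable_fun setT h -> (forall x, 0 <= h x) ->
  \int[density_measure]_(x in D) h x = \int[mu]_(x in D) (h x * (f x)%:E).
Proof.
move=> mD mh h0; rewrite integral_mkcond integralT_density.
- rewrite [RHS]integral_mkcond; apply: eq_integral => x _.
  by rewrite !patchE; case: ifP => // _; rewrite mul0e.
- exact/(measurable_restrictT _ mD)/measurable_funTS.
- by move=> x; exact: erestrict_ge0.
Qed.

End density.

Section cond_law_density.
Local Open Scope ereal_scope.
Context {R : realType} d (Omega : measurableType d) (P : probability Omega R).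
Context d1 d2 (T1 : measurableType d1) (T2 : measurableType d2).
Variables (X : Omega -> T1) (W : Omega -> T2).
Hypotheses (mW : measurable_fun setT W).
Variables (mu : {sigma_finite_measure set T1 -> \bar R}).
Variables (nu : {sigma_finite_measure set T2 -> \bar R}).
Variables (F k : T2 * T1 -> R).
Hypotheses (F_ge0 : forall t, (0 <= F t)%R) (mF : measurable_fun setT F).
Hypotheses (k_ge0 : forall t, (0 <= k t)%R) (mk : measurable_fun setT k).

(* no positivity of c is needed: c is forced to be the marginal density *)
Hypothesis FE : forall w, (forall x, F (w, x) = 0%R) \/
  (exists2 c, (forall x, F (w, x) = (c * k (w, x))%R) &
     \int[mu]_x (k (w, x))%:E = 1).
Hypothesis lawE : forall A B, measurable A -> measurable B ->
  P (X @^-1` A `&` W @^-1` B) =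
  \int[nu]_(w in B) \int[mu]_(x in A) (F (w, x))%:E.

(** Agreement on measurable sets is the right notion here: the criterion below produces integrals
    against [lebesgueR], which are exchanged for integrals against [lebesgue_measure] over
    measurable sets only. *)
Lemma cond_law_ext (K K' : T2 -> set T1 -> \bar R) :
  (forall w A, measurable A -> K w A = K' w A) ->
  cond_law P X W K -> cond_law P X W K'.
Proof.
move=> KK' [mK [N [mN N0 subN]] KE]; split.
- move=> A mA; rewrite (_ : K' ^~ A = K ^~ A); first exact: mK.
  by apply/funext => w; rewrite KK'.
- exists N; split=> // w /= nK'; apply: subN => /= -[p pE]; apply: nK'.
  by exists p => A mA; rewrite -KK'// pE.
- by move=> A B mA mB; rewrite KE//; apply: eq_integral => w _; rewrite KK'.
Qed.

(** Restricting each section to [A] is the same as restricting [G] to the strip [setT * A]; this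
    joint measurability is what Tonelli asks for. *)
Let mrestr (G : T2 * T1 -> R) A : measurable A -> measurable_fun setT G ->
  measurable_fun setT (fun t : T2 * T1 => ((EFin \o (fun x => G (t.1, x))) \_ A) t.2).
Proof.
move=> mA mG.
rewrite (_ : (fun _ => _) = (EFin \o G) \_ (setT `*` A)).
  have mTA : measurable ([set: T2] `*` A) by exact: measurableX.
  by apply/(measurable_restrictT _ mTA)/measurable_funTS/measurable_EFinP.
by apply/funext => -[w x]; rewrite !patchE/= in_setX/= in_setT.
Qed.

Let mint (G : T2 * T1 -> R) A : (forall t, 0 <= G t)%R ->
  measurable A -> measurable_fun setT G ->
  measurable_fun setT (fun w => \int[mu]_(x in A) (G (w, x))%:E).
Proof.
move=> G0 mA mG; under eq_fun do rewrite integral_mkcond.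
have := mrestr mA mG.
move=> /(measurable_fun_fubini_tonelli_F (m2 := mu)); apply => t.
by rewrite patchE; case: ifP => //= _; rewrite lee_fin.
Qed.

(** Integrating [F] over the conditioned variable gives the marginal density [g] of [W], and the
    alternative [FE] turns [F] into [k] times [g]. The defining identity of [cond_law] is then a
    change from [nu] to the law of [W]. *)
Lemma cond_law_density :
  cond_law P X W (fun w A => \int[mu]_(x in A) (k (w, x))%:E).
Proof.
(* By [FE] this integral is either 0 or the real number [c], so [fine] loses nothing. *)
pose g w := fine (\int[mu]_x (F (w, x))%:E).
have mk1 w : measurable_fun setT (fun x => k (w, x)).
  exact: measurable_fun_pair2.
have F0E w A : (forall x, F (w, x) = 0%R) -> \int[mu]_(x in A) (F (w, x))%:E = 0.
  by move=> F0; under eq_integral do rewrite F0; rewrite integral0.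
have gE w A : measurable A -> \int[mu]_(x in A) (F (w, x))%:E =
    \int[mu]_(x in A) (k (w, x))%:E * (g w)%:E.
  move=> mA; rewrite /g; have [F0|[c Fc k1]] := FE w.
    by rewrite !F0E// mule0.
  have [c0|c0] := leP 0%R c.
    have E B : measurable B -> \int[mu]_(x in B) (F (w, x))%:E =
        c%:E * \int[mu]_(x in B) (k (w, x))%:E.
      move=> mB; under eq_integral do rewrite Fc EFinM.
      rewrite ge0_integralZl//.
      - by apply: measurable_funTS; exact/measurable_EFinP.
      - by move=> x _; rewrite lee_fin.
    by rewrite !E// k1 mule1/= muleC.
  (* A negative [c] would force [k] to vanish, since [F] and [k] are nonnegative, against the
     integral of [k] being 1. *)
  have k0 x : k (w, x) = 0%R.
    by apply/eqP; rewrite eq_le k_ge0 andbT -(nmulr_rge0 _ c0) -Fc.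
  move: k1; under eq_integral do rewrite k0.
  by rewrite integral0 => /esym/eqP; rewrite onee_eq0.
have g0 w : (0 <= g w)%R.
  by apply: fine_ge0; apply: integral_ge0 => x _; rewrite lee_fin.
have mg : measurable_fun setT g.
  by apply: measurableT_comp; [exact: fine_measurable|exact: mint].
have lawWE B : measurable B -> P (W @^-1` B) = density_measure nu g0 mg B.
  move=> mB; rewrite -[W @^-1` B]setTI -[X in X `&` _](preimage_setT X) lawE//.
  rewrite density_measureE; apply: eq_integral => w _; rewrite gE// /g.
  have [F0|[c Fc k1]] := FE w; last by rewrite k1 mul1e.
  by rewrite F0E// mule0.
split.
- by move=> A mA; exact: mint.
- have mg0 : measurable (g @^-1` [set 0%R]).
    by rewrite -[X in measurable X]setTI; exact: (mg).
  (* The kernel may fail to be a probability only where [FE] gives its first alternative; there [g]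
     is 0, and the law of [W], having density [g], does not charge that set. *)
  exists (W @^-1` (g @^-1` [set 0%R])); split.
  + by rewrite -[X in measurable X]setTI; exact: mW.
  + rewrite lawWE// density_measureE; apply: integral0_eq => w /= gw.
    by rewrite gw.
  + move=> w /= notprob; apply: contrapT => /eqP gw; apply: notprob.
    have [F0|[c Fc k1]] := FE (W w).
      by move/eqP: gw; rewrite /g F0E.
    have kw0 x : (0 <= k (W w, x))%R by [].
    pose m := density_measure mu kw0 (mk1 (W w)).
    have m1 : m setT = 1 by rewrite /m density_measureE.
    pose pmix := @Measure_isProbability.Build _ _ R m m1.
    pose p : probability T1 R := HB.pack (Measure.sort m) pmix.
    by exists p.
- move=> A B mA mB; rewrite lawE//.
  transitivity (\int[pushforward P W]_(w in B) \int[mu]_(x in A) (k (w, x))%:E).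
    transitivity (\int[density_measure nu g0 mg]_(w in B)
        \int[mu]_(x in A) (k (w, x))%:E).
      rewrite integral_density//.
      + by apply: eq_integral => w _; rewrite gE.
      + exact: mint.
      + by move=> w; apply: integral_ge0 => x _; rewrite lee_fin.
    by apply: eq_measure_integral => C mC _; rewrite -(lawWE C mC).
  rewrite (ge0_integral_pushforward mW)//.
  + by apply: measurable_funTS; exact: mint.
  + by move=> w _; apply: integral_ge0 => x _; rewrite lee_fin.
Qed.

End cond_law_density.

(** * Schur complements *)

Section posdef_block.
Context {R : realType}.

Definition qform n (A : 'M[R]_n) (x : 'cV[R]_n) : R := (x^T *m A *m x) ord0 ord0.

Lemma trmx11 (A : 'M[R]_1) : A^T = A.
Proof. by apply/matrixP => i j; rewrite mxE !ord1. Qed.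

Lemma scalar11 (A : 'M[R]_1) : (A ord0 ord0)%:M = A.
Proof. by apply/matrixP => i j; rewrite mxE !ord1. Qed.

Lemma posdef_unitmx n (A : 'M[R]_n) : posdef A -> A \in unitmx.
Proof.
move=> [AT A0]; rewrite -row_free_unit -kermx_eq0.
apply/rowV0P => x; rewrite sub_kermx => /eqP xA.
apply/eqP; apply: contraT => x0.
have /A0 : x^T != 0 by rewrite -trmx0 (inj_eq trmx_inj).
by rewrite trmxK xA mul0mx mxE ltxx.
Qed.

Lemma trmx_invmx n (A : 'M[R]_n) : A^T = A -> (invmx A)^T = invmx A.
Proof. by rewrite trmx_inv => ->. Qed.

Lemma posdef_invmx n (A : 'M[R]_n) : posdef A -> posdef (invmx A).
Proof.
move=> pA; have [AT A0] := pA; have uA := posdef_unitmx pA.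
split=> [|x x0]; first exact: trmx_invmx.
have := A0 (invmx A *m x); rewrite trmx_mul trmx_invmx// mulmxKV//.
rewrite mulmxA; apply.
by apply: contra x0 => /eqP x0; rewrite -(mulKVmx uA x) x0 mulmx0.
Qed.

Definition block_sym n (T : 'M[R]_n) (u : 'cV[R]_n) (s : R) : 'M[R]_(n + 1) :=
  block_mx T u u^T s%:M.

Definition schur n (T : 'M[R]_n) (u : 'cV[R]_n) (s : R) : R :=
  s - qform (invmx T) u.

Section schur_complement.
Variables (n : nat) (T : 'M[R]_n) (u : 'cV[R]_n) (s : R).
Hypotheses (TT : T^T = T) (uT : T \in unitmx).

(** Completing the square in [x]: the minimum over [x] at fixed [t] is carried by the Schur
    complement. *)
Lemma qform_block_sym (x : 'cV[R]_n) (t : R) :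
  qform (block_sym T u s) (col_mx x t%:M) =
  qform T (x + t *: (invmx T *m u)) + t ^+ 2 * schur T u s.
Proof.
have iT := trmx_invmx TT.
rewrite /schur /qform /block_sym tr_col_mx mul_row_block mul_row_col.
rewrite tr_scalar_mx !mul_mx_scalar !mul_scalar_mx.
rewrite !linearD/= !linearZ/= trmx_mul iT !mulmxDl -!scalemxAl -?scalemxAr.
by rewrite mulmxKV// !mulmxA mulmxK// !mxE/= mulr1n; ring.
Qed.

Lemma det_block_sym : \det (block_sym T u s) = \det T * schur T u s.
Proof.
have iT := trmx_invmx TT.
have -> : block_sym T u s = block_mx 1%:M 0 (u^T *m invmx T) 1%:M *m
    block_mx T u 0 (schur T u s)%:M.
  rewrite mulmx_block !mul1mx !mul0mx ?mulmx0 !addr0 mulmxKV//.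
  by rewrite /block_sym /schur raddfB/= /qform scalar11 addrC subrK.
by rewrite det_mulmx det_lblock det_ublock !det1 !mul1r det_scalar1.
Qed.

(** No block inverse is written down: with [z] solving [B z = (x, t)], the form of [B^-1] at
    [(x, t)] is the form of [B] at [z], where [qform_block_sym] applies. *)
Lemma qform_invmx_block_sym (x : 'cV[R]_n) (t : R) : schur T u s != 0 ->
  qform (invmx (block_sym T u s)) (col_mx x t%:M) =
  qform (invmx T) x + (t - (u^T *m invmx T *m x) ord0 ord0) ^+ 2 / schur T u s.
Proof.
move=> v0; have iT := trmx_invmx TT.
have uB : block_sym T u s \in unitmx.
  by rewrite unitmxE det_block_sym unitrM -unitmxE uT unitfE.
set v := schur T u s in v0 *.
(* Block elimination in [B (y, r) = (x, t)]: the last row gives [r], back substitution gives [y]. *)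
pose r := (t - (u^T *m invmx T *m x) ord0 ord0) / v.
pose y := invmx T *m x - r *: (invmx T *m u).
have By : block_sym T u s *m col_mx y r%:M = col_mx x t%:M.
  rewrite mul_block_col !mul_mx_scalar; congr col_mx.
    by rewrite /y mulmxBr -scalemxAr !mulKVmx// subrK.
  have rE : r * (s - (u^T *m invmx T *m u) ord0 ord0) = t - (u^T *m invmx T *m x) ord0 ord0.
    exact: divfK.
  rewrite /y mulmxBr -scalemxAr !mulmxA; move: rE.
  move: (u^T *m invmx T *m u) (u^T *m invmx T *m x) => a c rE.
  apply/matrixP => i j; rewrite !ord1 !mxE/= !mulr1n.
  by rewrite mulrBr in rE; lra.
have BT : (block_sym T u s)^T = block_sym T u s.
  by rewrite /block_sym tr_block_mx TT trmxK tr_scalar_mx.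
rewrite -By {1}/qform trmx_mul BT mulmxK// mulmxA -/(qform _ _) qform_block_sym.
rewrite /y subrK /qform trmx_mul iT mulmxKV// mulmxA; congr (_ + _).
by rewrite /r -/v expr_div_n expr2; field.
Qed.

End schur_complement.

Lemma col_mx_scalarE n (x : 'cV[R]_(n + 1)) :
  x = col_mx (usubmx x) (dsubmx x ord0 ord0)%:M.
Proof. by rewrite scalar11 vsubmxK. Qed.

Lemma posdef_block_sym n (T : 'M[R]_n) (u : 'cV[R]_n) (s : R) :
  posdef (block_sym T u s) <-> posdef T /\ 0 < schur T u s.
Proof.
split=> [[BT B0]|[pT v0]].
  have pT : posdef T.
    split=> [|x x0].
      by have := BT; rewrite /block_sym tr_block_mx => /eq_block_mx[].
    have := B0 (col_mx x 0); rewrite col_mx_eq0 negb_and x0 => /(_ isT).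
    by rewrite /block_sym tr_col_mx mul_row_block mul_row_col trmx0 !mul0mx mulmx0 !addr0.
  split=> //; have [TT _] := pT; have uT := posdef_unitmx pT.
  (* At this vector the completed square vanishes and the form equals the Schur complement. *)
  have := B0 (col_mx (- (invmx T *m u)) 1%:M).
  rewrite col_mx_eq0 negb_and oner_eq0 orbT => /(_ isT).
  rewrite -/(qform _ _) qform_block_sym// scale1r addNr /qform trmx0 !mul0mx mxE.
  by rewrite add0r expr1n mul1r.
have [TT T0] := pT; have uT := posdef_unitmx pT; split.
  by rewrite /block_sym tr_block_mx TT trmxK tr_scalar_mx.
move=> x; rewrite (col_mx_scalarE x) => x0.
rewrite -/(qform _ _) qform_block_sym//; set t := _ ord0 ord0 in x0 *.
have [t0|t0] := eqVneq t 0.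
  rewrite t0 scale0r addr0 expr0n mul0r addr0; apply: T0.
  by apply: contra x0 => /eqP ->; rewrite t0 raddf0 col_mx0.
apply: ltr_wpDl; last by rewrite pmulr_lgt0 ?exprn_even_gt0.
have [->|y0] := eqVneq (usubmx x + t *: (invmx T *m u)) 0.
  by rewrite /qform trmx0 !mul0mx mxE.
exact/ltW/T0.
Qed.

Lemma posdef_blockE n (A : 'M[R]_(n + 1)) : posdef A ->
  A = block_sym (ulsubmx A) (ursubmx A) (drsubmx A ord0 ord0).
Proof.
move=> [AT _]; rewrite /block_sym scalar11 -[LHS]submxK; congr block_mx.
by rewrite trmx_ursub AT.
Qed.

(** Induction on the size: the determinant is that of the leading block times a positive Schur
    complement. *)
Lemma det_posdef n (A : 'M[R]_n) : posdef A -> 0 < \det A.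
Proof.
elim: n A => [A _|n]; first by rewrite det_mx00.
rewrite -addn1 => IHn A pA; rewrite (posdef_blockE pA).
have := pA; rewrite {1}(posdef_blockE pA) => /posdef_block_sym[pT v0].
rewrite det_block_sym ?mulr_gt0 ?IHn//; first by case: pT.
exact: posdef_unitmx.
Qed.

End posdef_block.

(** * Measurability of matrix operations *)

Section measurable_real_ops.
Context {R : realType} d (T : measurableType d).

Lemma measurable_invr (f : T -> R) :
  measurable_fun setT f -> measurable_fun setT (fun x => (f x)^-1).
Proof.
(* The power with exponent -1 inverts nonnegative numbers, so it is applied to the square; the
   factor [f x] restores the sign, and at a zero of [f] both sides are 0. *)
move=> mf; rewrite (_ : (fun _ => _) = fun x => f x * (f x ^+ 2) `^ (-1)).
  apply: measurable_funM => //.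
  apply: (@measurableT_comp _ _ _ _ _ _ (fun y : R => y `^ (-1))).
    exact: measurable_powR.
  exact: measurable_funX.
apply/funext => x; rewrite powR_inv1 ?sqr_ge0//.
have [->|fx0] := eqVneq (f x) 0; first by rewrite mul0r invr0.
by rewrite expr2 invfM mulrA divff// mul1r.
Qed.

Lemma measurable_sqrtr (f : T -> R) :
  measurable_fun setT f -> measurable_fun setT (fun x => Num.sqrt (f x)).
Proof.
apply: (@measurableT_comp _ _ _ _ _ _ (@Num.sqrt R)).
by apply: continuous_measurable_fun => x; exact: sqrt_continuous.
Qed.

Lemma measurable_expRT (f : T -> R) :
  measurable_fun setT f -> measurable_fun setT (fun x => expR (f x)).
Proof. by apply: measurableT_comp; exact: measurable_expR. Qed.

Lemma measurable_powRT (f : T -> R) a :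
  measurable_fun setT f -> measurable_fun setT (fun x => f x `^ a).
Proof.
by apply: (@measurableT_comp _ _ _ _ _ _ (@powR R ^~ a)); exact: measurable_powR.
Qed.

End measurable_real_ops.

Section measurable_mx_ops.
Context {R : realType} d (T : measurableType d).

Lemma measurable_coef m n (f : T -> 'M[R]_(m, n)) i j :
  measurable_fun setT f -> measurable_fun setT (fun x => f x i j).
Proof.
apply: (@measurableT_comp _ _ _ _ _ _ (fun A : 'M[R]_(m, n) => A i j)).
exact: measurable_mx_coef.
Qed.

Lemma measurable_addmx m n (f g : T -> 'M[R]_(m, n)) :
  measurable_fun setT f -> measurable_fun setT g ->
  measurable_fun setT (fun x => f x + g x).
Proof.
move=> mf mg; apply: measurable_mxP => i j; under eq_fun do rewrite mxE.
by apply: measurable_funD; exact: measurable_coef.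
Qed.

Lemma measurable_oppmx m n (f : T -> 'M[R]_(m, n)) :
  measurable_fun setT f -> measurable_fun setT (fun x => - f x).
Proof.
move=> mf; apply: measurable_mxP => i j; under eq_fun do rewrite mxE.
by apply: measurable_funN; exact: measurable_coef.
Qed.

Lemma measurable_scalemx m n (a : T -> R) (f : T -> 'M[R]_(m, n)) :
  measurable_fun setT a -> measurable_fun setT f ->
  measurable_fun setT (fun x => a x *: f x).
Proof.
move=> ma mf; apply: measurable_mxP => i j; under eq_fun do rewrite mxE.
by apply: measurable_funM => //; exact: measurable_coef.
Qed.

Lemma measurable_mulmx m n p (f : T -> 'M[R]_(m, n)) (g : T -> 'M[R]_(n, p)) :
  measurable_fun setT f -> measurable_fun setT g ->
  measurable_fun setT (fun x => f x *m g x).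
Proof.
move=> mf mg; apply: measurable_mxP => i j; under eq_fun do rewrite mxE.
by apply: measurable_sum => k; apply: measurable_funM; exact: measurable_coef.
Qed.

Lemma measurable_trmx m n (f : T -> 'M[R]_(m, n)) :
  measurable_fun setT f -> measurable_fun setT (fun x => (f x)^T).
Proof.
move=> mf; apply: measurable_mxP => i j; under eq_fun do rewrite mxE.
exact: measurable_coef.
Qed.

Lemma measurable_row m n (f : T -> 'M[R]_(m, n)) i :
  measurable_fun setT f -> measurable_fun setT (fun x => row i (f x)).
Proof.
move=> mf; apply: measurable_mxP => k j; under eq_fun do rewrite mxE.
exact: measurable_coef.
Qed.

Lemma measurable_row_mx m n1 n2 (f : T -> 'M[R]_(m, n1)) (g : T -> 'M[R]_(m, n2)) :
  measurable_fun setT f -> measurable_fun setT g ->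
  measurable_fun setT (fun x => row_mx (f x) (g x)).
Proof.
move=> mf mg; apply: measurable_mxP => i j; under eq_fun do rewrite mxE.
by case: (fintype.split j) => k; exact: measurable_coef.
Qed.

Lemma measurable_col_mx m1 m2 n (f : T -> 'M[R]_(m1, n)) (g : T -> 'M[R]_(m2, n)) :
  measurable_fun setT f -> measurable_fun setT g ->
  measurable_fun setT (fun x => col_mx (f x) (g x)).
Proof.
move=> mf mg; apply: measurable_mxP => i j; under eq_fun do rewrite mxE.
by case: (fintype.split i) => k; exact: measurable_coef.
Qed.

Lemma measurable_block_mx m1 m2 n1 n2 (f : T -> 'M[R]_(m1, n1))
    (g : T -> 'M[R]_(m1, n2)) (h : T -> 'M[R]_(m2, n1)) (k : T -> 'M[R]_(m2, n2)) :
  measurable_fun setT f -> measurable_fun setT g ->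
  measurable_fun setT h -> measurable_fun setT k ->
  measurable_fun setT (fun x => block_mx (f x) (g x) (h x) (k x)).
Proof.
by move=> mf mg mh mk; apply: measurable_col_mx; exact: measurable_row_mx.
Qed.

Lemma measurable_ulsubmx m1 m2 n1 n2 (f : T -> 'M[R]_(m1 + m2, n1 + n2)) :
  measurable_fun setT f -> measurable_fun setT (fun x => ulsubmx (f x)).
Proof.
move=> mf; apply: measurable_mxP => i j; under eq_fun do rewrite !mxE.
exact: measurable_coef.
Qed.

Lemma measurable_ursubmx m1 m2 n1 n2 (f : T -> 'M[R]_(m1 + m2, n1 + n2)) :
  measurable_fun setT f -> measurable_fun setT (fun x => ursubmx (f x)).
Proof.
move=> mf; apply: measurable_mxP => i j; under eq_fun do rewrite !mxE.
exact: measurable_coef.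
Qed.

Lemma measurable_dlsubmx m1 m2 n1 n2 (f : T -> 'M[R]_(m1 + m2, n1 + n2)) :
  measurable_fun setT f -> measurable_fun setT (fun x => dlsubmx (f x)).
Proof.
move=> mf; apply: measurable_mxP => i j; under eq_fun do rewrite !mxE.
exact: measurable_coef.
Qed.

Lemma measurable_drsubmx m1 m2 n1 n2 (f : T -> 'M[R]_(m1 + m2, n1 + n2)) :
  measurable_fun setT f -> measurable_fun setT (fun x => drsubmx (f x)).
Proof.
move=> mf; apply: measurable_mxP => i j; under eq_fun do rewrite !mxE.
exact: measurable_coef.
Qed.

Lemma measurable_scalar_mx n (f : T -> R) :
  measurable_fun setT f -> measurable_fun setT (fun x => (f x)%:M : 'M[R]_n).
Proof.
move=> mf; apply: measurable_mxP => i j; under eq_fun do rewrite mxE.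
by case: (i == j); [exact: mf|exact: measurable_cst].
Qed.

Lemma measurable_det n (f : T -> 'M[R]_n) :
  measurable_fun setT f -> measurable_fun setT (fun x => \det (f x)).
Proof.
move=> mf; rewrite /determinant; apply: measurable_sum => s.
apply: measurable_funM; first exact: measurable_cst.
by apply: measurable_prod => i _; exact: measurable_coef.
Qed.

(** [invmx] returns a singular matrix unchanged, so it is a branch on the vanishing of the
    determinant between the identity and the cofactor formula. *)
Lemma measurable_invmx n (f : T -> 'M[R]_n) :
  measurable_fun setT f -> measurable_fun setT (fun x => invmx (f x)).
Proof.
move=> mf; rewrite /invmx; apply: measurable_fun_ifT => //.
- under eq_fun do rewrite unitmxE unitfE.
  apply: measurable_neg; apply: measurable_fun_eqr; first exact: measurable_det.
  exact: measurable_cst.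
- apply: measurable_scalemx; first exact/measurable_invr/measurable_det.
  apply: measurable_mxP => i j; under eq_fun do rewrite mxE /cofactor.
  apply: measurable_funM; first exact: measurable_cst.
  apply: measurable_det; apply: measurable_mxP => k l.
  under eq_fun do rewrite !mxE.
  exact: measurable_coef.
Qed.

Lemma measurable_qform n (A : T -> 'M[R]_n) (x : T -> 'cV[R]_n) :
  measurable_fun setT A -> measurable_fun setT x ->
  measurable_fun setT (fun t => ((x t)^T *m A t *m x t) ord0 ord0).
Proof.
move=> mA mx; apply: measurable_coef; do 2 apply: measurable_mulmx => //.
exact: measurable_trmx.
Qed.

Lemma measurable_mvn_pdf n (mu : T -> 'cV[R]_n) (C : T -> 'M[R]_n) (x : T -> 'cV[R]_n) :
  measurable_fun setT mu -> measurable_fun setT C -> measurable_fun setT x ->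
  measurable_fun setT (fun t => mvn_pdf (mu t) (C t) (x t)).
Proof.
move=> mmu mC mx; rewrite /mvn_pdf; apply: measurable_funM.
  apply/measurable_invr/measurable_sqrtr/measurable_funM; first exact: measurable_cst.
  exact: measurable_det.
apply/measurable_expRT/measurable_funM; last exact: measurable_cst.
apply: measurable_funN; apply: measurable_qform.
  exact: measurable_invmx.
by apply: measurable_addmx => //; exact: measurable_oppmx.
Qed.

End measurable_mx_ops.

(** * Lebesgue measure on coordinates *)

Section lebesgue_rectangles.
Local Open Scope ereal_scope.
Context {R : realType}.

Lemma lebesgueRE (A : set R) : lebesgueR A = lebesgue_measure A.
Proof. by []. Qed.

Lemma lebesgue_tuple_rect n (A : 'I_n -> set R) :
  (forall i, measurable (A i)) ->
  lebesgue_tuple n [set t | forall i, A i (tnth t i)] =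
  \prod_(i < n) lebesgueR (A i).
Proof.
elim: n A => [|n IHn] A mA.
  by rewrite big_ord0 /= diracE mem_set// => -[].
rewrite big_ord_recl -IHn// [LHS]sf_pushforwardE sf_productE.
rewrite -product_measure1E//; last first.
  rewrite (_ : mkset _ = \bigcap_(i in [set: 'I_n])
      ((fun t : n.-tuple R => tnth t i) @^-1` A (lift ord0 i))); last first.
    by apply/seteqP; split=> [t h i _|t h i]; exact: h.
  apply: fin_bigcap_measurable => // i _.
  by rewrite -[X in measurable X]setTI; exact: measurable_tnth.
congr (_ _); apply/seteqP; split=> [[x t] h|[x t] [/= h0 h] i].
  split=> [|i] /=; first exact: (h ord0).
  by have := h (lift ord0 i); rewrite tnthS.
by have [j ->|->] := unliftP ord0 i; rewrite ?tnthS.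
Qed.

Section ffun.
Context {I : finType}.

Definition ffun_rect (A : I -> set R) : set {ffun I -> R} :=
  [set f | forall i, A i (f i)].

Lemma measurable_ffun_rect A : (forall i, measurable (A i)) ->
  measurable (ffun_rect A).
Proof.
move=> mA; rewrite (_ : ffun_rect A = \bigcap_(i in [set: I])
    ((fun f : {ffun I -> R} => f i) @^-1` A i)); last first.
  by apply/seteqP; split=> [t h i _|t h i]; exact: h.
apply: fin_bigcap_measurable => // i _.
by rewrite -[X in measurable X]setTI; exact: measurable_ffun_app.
Qed.

Lemma lebesgue_ffun_rect (A : I -> set R) : (forall i, measurable (A i)) ->
  lebesgue_ffun (ffun_rect A) = \prod_i lebesgueR (A i).
Proof.
move=> mA; rewrite [LHS]sf_pushforwardE.
rewrite -[RHS]/(\prod_(i in I) lebesgueR (A i)) big_enum_val.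
rewrite -lebesgue_tuple_rect//; congr (lebesgue_tuple _ _).
apply/seteqP; split=> t h i.
  by have := h (enum_val i); rewrite ffunE enum_valK.
by rewrite ffunE; have := h (enum_rank i); rewrite enum_rankK.
Qed.

Lemma lebesgue_ffun_unique (mu : {measure set {ffun I -> R} -> \bar R}) :
  (forall A, (forall i, measurable (A i)) ->
    mu (ffun_rect A) = \prod_i lebesgueR (A i)) ->
  forall X, measurable X -> lebesgue_ffun X = mu X.
Proof.
move=> muE.
pose G := [set X | exists2 A, forall i, measurable (A i) & X = ffun_rect A].
(* Cubes of finite measure that exhaust the space, as uniqueness of sigma-finite measures on a
   pi-system requires. *)
pose g k := ffun_rect (fun=> `[(- k%:R)%R, k%:R%R]%classic).
apply: (measure_unique G g).
- apply/seteqP; split; apply: smallest_sub; try exact: smallest_sigma_algebra.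
    move=> X [i _ [B mB <-]]; apply: sub_sigma_algebra.
    exists (fun j => if j == i then B else setT).
      by move=> j; case: ifP.
    apply/seteqP; split=> [f [_ Bf] j|f h]; first by case: ifP => // /eqP ->.
    by split=> //; have := h i; rewrite eqxx.
  by move=> X [A mA ->]; exact: measurable_ffun_rect.
- move=> _ _ [A mA ->] [B mB ->]; exists (fun i => A i `&` B i).
    by move=> i; exact: measurableI.
  apply/seteqP; split=> [f [Af Bf] i|f h]; first by split.
  by split=> i; have [] := h i.
- by move=> k; exists (fun=> `[(- k%:R)%R, k%:R%R]%classic).
- apply/seteqP; split=> // f _.
  exists (\max_i (Num.truncn `|f i|).+1)%N => // i /=.
  rewrite in_itv/= -ler_norml (le_trans (ltW (truncnS_gt _)))// ler_nat.
  exact: (leq_bigmax (F := fun i => (Num.truncn `|f i|).+1)).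
- by move=> _ [A mA ->]; exact: (etrans (lebesgue_ffun_rect mA) (esym (muE A mA))).
- move=> k; rewrite [ltLHS](lebesgue_ffun_rect (A := fun=> _))//.
  rewrite (_ : \prod_i _ = (\prod_(i : I) (k%:R - - k%:R))%R%:E) ?ltry//.
  rewrite -prodEFin; apply: eq_bigr => i _.
  rewrite lebesgueRE lebesgue_measure_itv/=; case: ifP => //.
  rewrite lte_fin => /negbT; rewrite -leNgt => k0.
  (* The length formula degenerates only for [k = 0], where both sides are 0. *)
  have : (k%:R = 0 :> R)%R by have : (0 <= k%:R :> R)%R by []; lra.
  by move=> ->; rewrite oppr0 subr0.
Qed.

End ffun.

End lebesgue_rectangles.

Section big_tri.
Context {S : Type} {idx : S} {op : Monoid.com_law idx}.

Lemma big_pair (I J : finType) (F : I * J -> S) :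
  \big[op/idx]_p F p = \big[op/idx]_i \big[op/idx]_j F (i, j).
Proof. by rewrite pair_bigA/=; apply: eq_bigr => -[]. Qed.

Lemma big_tri (r : rel nat) p (F : 'I_p * 'I_p -> S) :
  \big[op/idx]_(e : tri r p) F (val e) =
  \big[op/idx]_(i < p) \big[op/idx]_(j < p | r i j) F (i, j).
Proof.
rewrite pair_big_dep/=.
rewrite (eq_bigr (fun ij => F ij)); last by case.
by apply/esym; exact: big_sub.
Qed.

(* for r = leq or ltn: pairs inside the leading m x m block, the last column, and
   the last diagonal entry *)
Lemma big_tri_addn1 (r : rel nat) m (F : 'I_(m + 1) * 'I_(m + 1) -> S) :
  (forall i, (i < m)%N -> r i m) -> (forall i, (i < m)%N -> ~~ r m i) ->
  \big[op/idx]_(e : tri r (m + 1)) F (val e) =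
  op (\big[op/idx]_(e : tri r m) F (lshift 1 (val e).1, lshift 1 (val e).2))
     (op (\big[op/idx]_(i < m) F (lshift 1 i, rshift m ord0))
         (if r m m then F (rshift m ord0, rshift m ord0) else idx)).
Proof.
move=> rm mr; rewrite big_tri (big_tri r (fun e => F (lshift 1 e.1, lshift 1 e.2))).
rewrite big_split_ord/= big_ord1; rewrite Monoid.mulmA; congr (op _ _); last first.
  rewrite big_split_ord/= big_pred0 ?Monoid.mul1m; last first.
    by move=> i; rewrite addn0; exact/negbTE/mr.
  by rewrite big_mkcond big_ord1/= addn0.
rewrite -[RHS]/(op _ _) -big_split/=; apply: eq_bigr => i _.
by rewrite big_split_ord/=; congr (op _ _); rewrite big_mkcond big_ord1/= addn0 rm.
Qed.

End big_tri.

Section lebesgue_split.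
Local Open Scope ereal_scope.
Context {R : realType}.

Lemma integral_sf_pushforward d1 d2 (T1 : measurableType d1) (T2 : measurableType d2)
    (mu : {sigma_finite_measure set T1 -> \bar R}) (f : T1 -> T2) (g : T2 -> T1)
    (mf : measurable_fun setT f) (mg : measurable_fun setT g) (fK : cancel f g)
    (h : T2 -> \bar R) : measurable_fun setT h -> (forall x, 0 <= h x) ->
  \int[sf_pushforward mu mf mg fK]_x h x = \int[mu]_x h (f x).
Proof.
by move=> mh h0; rewrite -[RHS](ge0_integral_pushforward mf mu measurableT).
Qed.

Lemma integral_lebesgueR A (f : R -> \bar R) : measurable A ->
  measurable_fun A f -> (forall x, 0 <= f x) ->
  \int[lebesgueR]_(x in A) f x = \int[lebesgue_measure]_(x in A) f x.
Proof.
move=> mA mf f0.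
exact: (ge0_integral_pushforward measurable_toR lebesgue_measure mA).
Qed.

Lemma integral_sf_product d1 d2 (T1 : measurableType d1) (T2 : measurableType d2)
    (m1 : {sigma_finite_measure set T1 -> \bar R})
    (m2 : {sigma_finite_measure set T2 -> \bar R}) (f : T1 * T2 -> \bar R) :
  measurable_fun setT f -> (forall x, 0 <= f x) ->
  \int[sf_product m1 m2]_z f z = \int[m1]_x \int[m2]_y f (x, y).
Proof. by move=> mf f0; rewrite -[RHS]fubini_tonelli1. Qed.

(* a measure rho that gives every rectangle the right product measure through the
   coordinates theta is Lebesgue measure in these coordinates *)
Section rearrange.
Context (I : finType) d (T : measurableType d) (rho : {measure set T -> \bar R}).
Variable theta : T -> {ffun I -> R}.
Hypothesis mtheta : measurable_fun setT theta.
Hypothesis rhoE : forall A, (forall i, measurable (A i)) ->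
  rho (theta @^-1` ffun_rect A) = \prod_i lebesgueR (A i).

Lemma integral_lebesgue_ffun (h : {ffun I -> R} -> \bar R) :
  measurable_fun setT h -> (forall x, 0 <= h x) ->
  \int[lebesgue_ffun]_x h x = \int[rho]_x h (theta x).
Proof.
move=> mh h0; rewrite -[RHS](ge0_integral_pushforward mtheta rho measurableT)//.
apply: eq_measure_integral => A mA _.
pose nu : {measure set {ffun I -> R} -> \bar R} :=
  measure_function_pushforward__canonical__measure_function_Measure rho mtheta.
exact: (lebesgue_ffun_unique (mu := nu)).
Qed.

End rearrange.

Lemma integral_lebesgue_mx m n (h : 'M[R]_(m, n) -> \bar R) :
  measurable_fun setT h -> (forall x, 0 <= h x) ->
  \int[lebesgue_mx]_x h x = \int[lebesgue_ffun]_x h (mx_of x).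
Proof. exact: integral_sf_pushforward. Qed.

Lemma lebesgue_mx_rect m n (A : 'I_m * 'I_n -> set R) :
  (forall i, measurable (A i)) ->
  lebesgue_mx [set x : 'M[R]_(m, n) | forall i j, A (i, j) (x i j)] =
  \prod_i lebesgueR (A i).
Proof.
move=> mA; rewrite -lebesgue_ffun_rect// [LHS]sf_pushforwardE; congr (lebesgue_ffun _).
apply/seteqP; split=> [f h [i j]|f h i j]; first by have := h i j; rewrite mxE.
by rewrite mxE; exact: h.
Qed.

Lemma measurable_mx_rect m n (A : 'I_m * 'I_n -> set R) :
  (forall i, measurable (A i)) ->
  measurable [set x : 'M[R]_(m, n) | forall i j, A (i, j) (x i j)].
Proof.
move=> mA; rewrite (_ : mkset _ = ffun_of_mx @^-1` ffun_rect A).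
  rewrite -[X in measurable X]setTI; apply: measurable_ffun_of_mx => //.
  exact: measurable_ffun_rect.
apply/seteqP; split=> [f h [i j]|f h i j]; first by rewrite ffunE; exact: h.
by have := h (i, j); rewrite ffunE.
Qed.

(** Both sides are measures on the same coordinates, so equal values on rectangles suffice: the
    product over [m + 1] indices splits off its last factor. *)
Lemma integral_lebesgue_cV_addn1 m (h : 'cV[R]_(m + 1) -> \bar R) :
  measurable_fun setT h -> (forall x, 0 <= h x) ->
  \int[lebesgue_mx]_x h x =
  \int[lebesgue_mx]_x \int[lebesgueR]_t h (col_mx x t%:M).
Proof.
move=> mh h0; pose c (p : 'cV[R]_m * R) : 'cV[R]_(m + 1) := col_mx p.1 p.2%:M.
have mc : measurable_fun setT c.
  by apply: measurable_col_mx => //; exact: measurable_scalar_mx.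
rewrite -(integral_sf_product _ _ (f := h \o c)); last 2 first.
- exact: measurableT_comp mh mc.
- by move=> p; exact: h0.
rewrite integral_lebesgue_mx//.
have mtheta : measurable_fun setT (ffun_of_mx \o c).
  by apply: measurableT_comp => //; exact: measurable_ffun_of_mx.
rewrite (integral_lebesgue_ffun (rho := sf_product lebesgue_mx lebesgueR) mtheta).
- apply: eq_integral => p _; congr h; apply/matrixP => i j.
  by rewrite mxE ffunE.
- move=> A mA.
  pose A1 (ij : 'I_m * 'I_1) := A (lshift 1 ij.1, ij.2).
  have mA1 ij : measurable (A1 ij) by exact: mA.
  rewrite (_ : _ @^-1` _ =
    [set x : 'cV[R]_m | forall i j, A1 (i, j) (x i j)] `*` A (rshift m ord0, ord0)).
    rewrite [LHS]sf_productE product_measure1E//; last exact: measurable_mx_rect.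
    rewrite [X in X * _](lebesgue_mx_rect mA1).
    rewrite [RHS]big_pair [X in X * _]big_pair.
    by rewrite big_split_ord/= big_ord1 [X in _ = _ * X]big_ord1.
  apply/seteqP; split=> [[x t] /= h1|[x t] [/= h1 h2] [k j]].
    split=> [i j|]; first by have := h1 (lshift 1 i, j); rewrite ffunE col_mxEu.
    by have := h1 (rshift m ord0, ord0); rewrite ffunE col_mxEd mxE mulr1n.
  rewrite ffunE/= ord1; have [i ->|i ->] := split_ordP k.
    by rewrite col_mxEu; exact: h1.
  by rewrite col_mxEd !ord1 mxE mulr1n.
- apply: measurableT_comp => //; exact: measurable_mx_of.
- by [].
Qed.

End lebesgue_split.
Arguments integral_sf_pushforward {R d1 d2 T1 T2 mu f g mf mg fK h}.

Section lebesgue_sym_split.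
Local Open Scope ereal_scope.
Context {R : realType}.

Lemma ffun_of_symK p (A : 'M[R]_p) : A^T = A -> sym_of (ffun_of_sym A) = A.
Proof.
move=> AT; apply/matrixP => i j; rewrite mxE.
case: insubP => [e _ ve|ij]; first by rewrite ffunE ve.
case: insubP => [e _ ve|ji]; first by rewrite ffunE ve/= -{1}AT mxE.
by move: ij ji; rewrite /= -!ltnNge => ij /ltnW; rewrite leqNgt ij.
Qed.

Lemma sym_of_sym p (f : {ffun tri leq p -> R}) : (sym_of f)^T = sym_of f.
Proof.
apply/matrixP => i j; rewrite !mxE.
case: insubP => [e ji ve|ij]; case: insubP => [e' ij' ve'|ji'] //.
have ijE : i = j by apply/val_inj/eqP; rewrite /= eqn_leq ji ij'.
by congr (f _); apply/val_inj; rewrite ve ve' ijE.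
Qed.

Lemma block_sym_sym n (T : 'M[R]_n) u s : T^T = T ->
  (block_sym T u s)^T = block_sym T u s.
Proof. by move=> TT; rewrite /block_sym tr_block_mx TT trmxK tr_scalar_mx. Qed.

Lemma measurable_block_sym d (X : measurableType d) n (T : X -> 'M[R]_n) u s :
  measurable_fun setT T -> measurable_fun setT u -> measurable_fun setT s ->
  measurable_fun setT (fun x => block_sym (T x) (u x) (s x)).
Proof.
move=> mT mu ms; apply: measurable_block_mx => //.
  exact: measurable_trmx.
exact: measurable_scalar_mx.
Qed.

(** The pairs [i <= j] below [m + 1] are those below [m], the last column, and the last diagonal
    entry; on rectangles this is [big_tri_addn1]. *)
Lemma integral_lebesgue_sym_addn1 m (h : 'M[R]_(m + 1) -> \bar R) :
  measurable_fun setT h -> (forall x, 0 <= h x) ->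
  \int[lebesgue_sym]_S h S =
  \int[lebesgue_sym]_T \int[lebesgue_mx]_u \int[lebesgueR]_s h (block_sym T u s).
Proof.
move=> mh h0.
pose c (q : 'M[R]_m * 'cV[R]_m * R) := block_sym q.1.1 q.1.2 q.2.
(* Unlike [c], this map only feeds symmetric matrices to [block_sym], so that [ffun_of_symK]
   recovers the block matrix from its upper entries. *)
pose b (q : {ffun tri leq m -> R} * 'cV[R]_m * R) := block_sym (sym_of q.1.1) q.1.2 q.2.
have mc : measurable_fun setT c.
  by apply: measurable_block_sym => //; exact: measurableT_comp.
have mb : measurable_fun setT b.
  apply: measurable_block_sym => //; last exact: measurableT_comp.
  by apply: measurableT_comp; [exact: measurable_sym_of|exact: measurableT_comp].
pose H1 (q : 'M[R]_m * 'cV[R]_m) := \int[lebesgueR]_s h (c (q, s)).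
have mH1 : measurable_fun setT H1.
  apply: (measurable_fun_fubini_tonelli_F (m2 := lebesgueR) (h \o c)).
    exact: measurableT_comp mh mc.
  by move=> q; exact: h0.
have H10 q : 0 <= H1 q by apply: integral_ge0.
pose H2 (T : 'M[R]_m) := \int[lebesgue_mx]_u H1 (T, u).
have mH2 : measurable_fun setT H2.
  exact: (measurable_fun_fubini_tonelli_F (m2 := lebesgue_mx) H1).
have H20 q : 0 <= H2 q by apply: integral_ge0.
rewrite [RHS](integral_sf_pushforward mH2 H20).
have mH1s : measurable_fun setT
    (fun q : {ffun tri leq m -> R} * 'cV[R]_m => H1 (sym_of q.1, q.2)).
  apply: measurableT_comp => //; apply: measurable_fun_pair => //.
  by apply: measurableT_comp; [exact: measurable_sym_of|].
rewrite -[RHS](integral_sf_product lebesgue_ffun lebesgue_mx mH1s)//.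
rewrite -[RHS](integral_sf_product _ lebesgueR (f := h \o b)); last 2 first.
- exact: measurableT_comp mh mb.
- by move=> p; exact: h0.
rewrite [LHS](integral_sf_pushforward mh h0).
have mtheta : measurable_fun setT (ffun_of_sym \o b).
  by apply: measurableT_comp => //; exact: measurable_ffun_of_sym.
rewrite (integral_lebesgue_ffun
  (rho := sf_product (sf_product lebesgue_ffun lebesgue_mx) lebesgueR) mtheta).
- apply: eq_integral => p _; congr h => /=.
  by apply: ffun_of_symK; apply: block_sym_sym; exact: sym_of_sym.
- move=> A mA.
  (* Extended by [setT] below the diagonal, the sides of the rectangle can be indexed by arbitrary
     pairs. *)
  pose Ax ij := if insub ij is Some e then A e else setT.
  have mAx ij : measurable (Ax ij) by rewrite /Ax; case: insubP => //= *.
  have AxE e : A e = Ax (val e) by rewrite /Ax valK.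
  pose A1 (e : tri leq m) := Ax (lshift 1 (val e).1, lshift 1 (val e).2).
  pose A2 (ij : 'I_m * 'I_1) := Ax (lshift 1 ij.1, rshift m ij.2).
  have mA1 e : measurable (A1 e) by exact: mAx.
  have mA2 e : measurable (A2 e) by exact: mAx.
  rewrite (_ : _ @^-1` _ =
    ffun_rect A1 `*` [set u : 'cV[R]_m | forall i j, A2 (i, j) (u i j)] `*`
    Ax (rshift m ord0, rshift m ord0)).
    rewrite [LHS]sf_productE product_measure1E//; last first.
      apply: measurableX; [exact: measurable_ffun_rect|exact: measurable_mx_rect].
    rewrite [X in X * _]sf_productE [X in X * _]product_measure1E//; last 2 first.
    + exact: measurable_ffun_rect.
    + exact: measurable_mx_rect.
    rewrite [X in X * _ * _](lebesgue_ffun_rect mA1).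
    rewrite [X in _ * X * _](lebesgue_mx_rect mA2).
    under [RHS]eq_bigr do rewrite AxE.
    rewrite [RHS](big_tri_addn1 (fun ij => lebesgueR (Ax ij))) ?leqnn.
    + rewrite -muleA big_pair; congr (_ * (_ * _)).
      by apply: eq_bigr => i _; rewrite big_ord1.
    + by move=> i /ltnW.
    + by move=> i im; rewrite -ltnNge.
  apply/seteqP; split=> [[[t u] s] /= h1|[[t u] s] [[/= h1 h2] h3] e].
    split; first split.
    + move=> [[i j] ij].
      have := h1 (Sub (lshift 1 i, lshift 1 j) ij : tri leq (m + 1)).
      by rewrite ffunE /= block_mxEul AxE /A1/= mxE insubT.
    + move=> i j.
      have ij : (lshift 1 i <= rshift m j)%N.
        by rewrite /= (leq_trans (ltnW (ltn_ord i)))// leq_addr.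
      have := h1 (Sub (lshift 1 i, rshift m j) ij : tri leq (m + 1)).
      by rewrite ffunE /= block_mxEur AxE.
    + have := h1 (Sub (rshift m ord0, rshift m ord0) (leqnn _) : tri leq (m + 1)).
      by rewrite ffunE /= block_mxEdr AxE mxE.
  rewrite AxE ffunE; case: e => -[k l] /=.
  have [i ->|i ->] := split_ordP k; have [j ->|j ->] := split_ordP l => /= ij.
  + have := h1 (Sub (i, j) ij).
    by rewrite block_mxEul /A1/= mxE insubT.
  + by rewrite block_mxEur; exact: h2.
  + have := leq_trans (leq_addr _ _) ij.
    by rewrite leqNgt ltn_ord.
  + by rewrite block_mxEdr !ord1 mxE.
- exact: measurableT_comp mh measurable_sym_of.
- by move=> x; exact: h0.
Qed.

(** At fixed [Sigma11] and [u] the passage from [sigma22] to [v] is a translation. Its invariance is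
    checked on half-open intervals, which determine Lebesgue measure. *)
Lemma integral_lebesgueR_shift (c : R) (g : R -> \bar R) :
  measurable_fun setT g -> (forall x, 0 <= g x) ->
  \int[lebesgueR]_s g s = \int[lebesgueR]_v g (v + c)%R.
Proof.
move=> mg g0; rewrite !integral_lebesgueR//; last first.
  by apply: measurableT_comp => //; exact: measurable_funD.
have mc : measurable_fun setT (fun v : measurableTypeR R => v + c : measurableTypeR R)%R.
  exact: measurable_funD.
rewrite -[RHS](ge0_integral_pushforward mc lebesgue_measure measurableT)//.
apply: eq_measure_integral => A mA _.
pose nu : {measure set (measurableTypeR R) -> \bar R} :=
  measure_function_pushforward__canonical__measure_function_Measure lebesgue_measure mc.
apply: (lebesgue_measure_unique (mu := nu)) => // _ [[a b]] _ <-.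
rewrite /nu /= /pushforward lebesgue_measure_itv/=.
rewrite (_ : _ @^-1` _ = `](a - c)%R, (b - c)%R]%classic); last first.
  by apply/seteqP; split=> x /=; rewrite !in_itv/= ltrBlDr lerBrDr.
rewrite lebesgue_measure_itv/= !lte_fin ltrD2r; case: ifP => // _.
by rewrite -!EFinB; congr EFin; ring.
Qed.

End lebesgue_sym_split.

(** * Multivariate normal densities *)

Section mvn_block.
Context {R : realType}.

Lemma normal_pdf_sqrt (m v x : R) : 0 < v ->
  normal_pdf m (Num.sqrt v) x =
  (Num.sqrt (2 * pi * v))^-1 * expR (- ((x - m) ^+ 2 / v) / 2).
Proof.
move=> v0; rewrite normal_pdfE ?gt_eqF ?sqrtr_gt0// /normal_peak /normal_fun.
rewrite sqr_sqrtr ?ltW//; congr ((Num.sqrt _)^-1 * expR _).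
  by rewrite -mulr_natl; ring.
by rewrite -mulr_natl; field; rewrite gt_eqF.
Qed.

(** Marginal density of the leading coordinates times the conditional density of the last one. The
    determinant and the quadratic form of the inverse both split along the Schur complement, which
    is the conditional variance. *)
Lemma mvn_pdf_block_sym n (T : 'M[R]_n) (u m x : 'cV[R]_n) (s r t : R) :
  posdef T -> 0 < schur T u s ->
  mvn_pdf (col_mx m r%:M) (block_sym T u s) (col_mx x t%:M) =
  mvn_pdf m T x *
  normal_pdf (r + (u^T *m invmx T *m (x - m)) ord0 ord0) (Num.sqrt (schur T u s)) t.
Proof.
move=> pT v0; have [TT _] := pT; have uT := posdef_unitmx pT.
rewrite normal_pdf_sqrt// /mvn_pdf mulrACA -expRD -invfM; congr (_^-1 * expR _).
  rewrite det_block_sym// addn1 exprSr -sqrtrM; last first.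
    by rewrite mulr_ge0 ?exprn_ge0 ?mulr_ge0 ?pi_ge0// ltW// det_posdef.
  by congr Num.sqrt; ring.
rewrite -/(qform _ _) opp_col_mx add_col_mx -raddfN -raddfD/=.
rewrite qform_invmx_block_sym ?gt_eqF// opprD mulrDl -/(qform _ _).
by congr (_ + _); congr (- (_ ^+ 2 / _) / 2); ring.
Qed.

End mvn_block.

Section measurable_posdef.
Context {R : realType}.

(** The definition quantifies over uncountably many vectors. The Schur criterion, with symmetry of
    the last row and column, replaces this by finitely many measurable conditions, by induction on
    the size. *)
Lemma measurable_posdef n : measurable (@posdef R n).
Proof.
elim: n => [|n].
  rewrite (_ : posdef = setT)//; apply/seteqP; split=> // A _; split.
    by apply/matrixP => -[].
  by move=> x; rewrite [x]flatmx0 eqxx.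
rewrite -addn1 => IHn.
rewrite (_ : posdef = (fun A : 'M[R]_(n + 1) => ulsubmx A) @^-1` posdef `&`
  [set A | (fun A : 'M[R]_(n + 1) => 0 < schur (ulsubmx A) (ursubmx A) (drsubmx A ord0 ord0)) A]
  `&` \bigcap_(i in [set: 'I_n]) [set A : 'M[R]_(n + 1) | dlsubmx A ord0 i == ursubmx A i ord0]).
  apply: measurableI; first apply: measurableI.
  - rewrite -[X in measurable X]setTI.
    exact: (measurable_ulsubmx (@measurable_id _ _ _)).
  - rewrite -[X in measurable X]setTI.
    apply: (measurable_fun_ltr (measurable_cst _) _ measurableT (Y := [set true])) => //.
    apply: measurable_funB.
      exact/measurable_coef/measurable_drsubmx.
    apply: measurable_qform; last exact: measurable_ursubmx.
    exact/measurable_invmx/measurable_ulsubmx.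
  - apply: fin_bigcap_measurable => // i _.
    rewrite -[X in measurable X]setTI.
    apply: (measurable_fun_eqr _ _ measurableT (Y := [set true])) => //.
      exact/measurable_coef/measurable_dlsubmx.
    exact/measurable_coef/measurable_ursubmx.
apply/seteqP; split=> [A pA|A [[p1 v0] /= sA]].
  have := pA; rewrite {1}(posdef_blockE pA) => /posdef_block_sym[pT v0]; split=> // i _ /=.
  by have [AT _] := pA; rewrite -{1}AT -trmx_ursub mxE.
suff -> : A = block_sym (ulsubmx A) (ursubmx A) (drsubmx A ord0 ord0).
  exact/posdef_block_sym.
rewrite /block_sym scalar11 -[LHS]submxK; congr block_mx.
apply/matrixP => i j; rewrite !ord1 [RHS]mxE; exact/eqP/(sA j).
Qed.

End measurable_posdef.

Section mvn_integral.
Local Open Scope ereal_scope.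
Context {R : realType}.

Lemma mvn_pdf_ge0 n (mu : 'cV[R]_n) C x : (0 <= mvn_pdf mu C x)%R.
Proof. by rewrite mulr_ge0 ?expR_ge0// invr_ge0 sqrtr_ge0. Qed.

Lemma lebesgue_cV0 : lebesgue_mx [set: 'cV[R]_0] = 1.
Proof.
rewrite (_ : setT = [set x : 'cV[R]_0 | forall i j, [set: R] (x i j)]).
  by rewrite (@lebesgue_mx_rect R 0 1 (fun=> setT))// big_pred0// => -[[]].
by apply/seteqP.
Qed.

(** Induction on the dimension: integrating out the last coordinate removes a one-dimensional normal
    density and leaves the normal density of the leading block. *)
Lemma integral_mvn_pdf n (mu : 'cV[R]_n) C : posdef C ->
  \int[lebesgue_mx]_x (mvn_pdf mu C x)%:E = 1.
Proof.
elim: n mu C => [mu C _|n].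
  under eq_integral => x _.
    rewrite /mvn_pdf expr0 mul1r det_mx00 sqrtr1 invr1 mul1r.
    rewrite (flatmx0 (x - mu)%R) mulmx0 mxE oppr0 mul0r expR0.
    over.
  by rewrite integral_cst// [X in _ * X]lebesgue_cV0 mule1.
rewrite -(addn1 n) => IHn mu C pC; rewrite (posdef_blockE pC).
have := pC; rewrite {1}(posdef_blockE pC) => /posdef_block_sym[].
move: (ulsubmx C) (ursubmx C) (drsubmx C ord0 ord0) => T u s pT v0.
rewrite (col_mx_scalarE mu); move: (usubmx mu) (dsubmx mu ord0 ord0) => m r.
rewrite integral_lebesgue_cV_addn1.
- rewrite -[RHS](IHn m T pT); apply: eq_integral => x _.
  under eq_integral do rewrite mvn_pdf_block_sym// EFinM.
  rewrite integral_lebesgueR//.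
  + rewrite ge0_integralZl//.
    * by rewrite integral_normal_pdf mule1.
    * by apply/measurable_EFinP; exact: measurable_normal_pdf.
    * by move=> t _; rewrite lee_fin normal_pdf_ge0.
    * by rewrite lee_fin mvn_pdf_ge0.
  + apply: emeasurable_funM; first exact: measurable_cst.
    by apply/measurable_EFinP; exact: measurable_normal_pdf.
  + by move=> t; rewrite -EFinM lee_fin mulr_ge0 ?mvn_pdf_ge0 ?normal_pdf_ge0.
- by apply/measurable_EFinP; apply: measurable_mvn_pdf.
- by move=> x; rewrite lee_fin mvn_pdf_ge0.
Qed.

(** A graph over the first [m] coordinates; with [a = T^-1 u] it collects the rows whose regression
    residual is zero. *)
Definition hyperplane m (a : 'cV[R]_m) : set 'cV[R]_(m + 1) :=
  [set x | dsubmx x ord0 ord0 = (a^T *m usubmx x) ord0 ord0].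

Lemma measurable_hyperplane m (a : 'cV[R]_m) : measurable (hyperplane a).
Proof.
have mf : measurable_fun setT (fun x : 'cV[R]_(m + 1) =>
    dsubmx x ord0 ord0 == (a^T *m usubmx x) ord0 ord0).
  have mc (i : 'I_(m + 1)) := @measurable_mx_coef R _ 1 i ord0.
  apply: measurable_fun_eqr.
    by under eq_fun do rewrite mxE; exact: mc.
  apply: measurable_coef; apply: measurable_mulmx => //.
  apply: measurable_mxP => i j; rewrite (ord1 j); under eq_fun do rewrite mxE.
  exact: mc.
rewrite (_ : hyperplane a = setT `&` (fun x : 'cV[R]_(m + 1) =>
  dsubmx x ord0 ord0 == (a^T *m usubmx x) ord0 ord0) @^-1` [set true]).
  exact: mf.
by rewrite setTI; apply/seteqP; split=> x /eqP.
Qed.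

(** Above each point the fibre in the last coordinate is a singleton. *)
Lemma lebesgue_hyperplane m (a : 'cV[R]_m) : lebesgue_mx (hyperplane a) = 0.
Proof.
have mH := measurable_hyperplane a; set H := hyperplane a in mH *.
rewrite -(setIT H) -integral_indic// integral_lebesgue_cV_addn1//.
- apply: integral0_eq => x _.
  rewrite (_ : (fun _ => _) = (fun t => (\1_[set (a^T *m x) ord0 ord0] t)%:E)).
    rewrite integral_lebesgueR//.
    + rewrite integral_indic// setIT; exact: lebesgue_measure_set1.
    + by apply/measurable_EFinP/measurable_indic.
  apply/funext => t; congr EFin; rewrite !indicE; congr (_%:R : R); congr nat_of_bool.
  apply/idP/idP; by rewrite !inE /H /hyperplane /= col_mxKd col_mxKu [t%:M _ _]mxE mulr1n.
exact/measurable_EFinP/measurable_indic.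
Qed.

End mvn_integral.

(** * Bessel functions and the generalized inverse Gaussian density *)

Section log_substitution.
Context {R : realType}.
Local Notation mu := (@lebesgue_measure R).
Variables (l : R) (G : R -> R).
Hypotheses (cG : continuous G) (G0 : forall x, 0 <= G x).

Let F (x : R) := ln x - l.

Let dF (x : R) : 0 < x -> is_derive x (1 : R) F x^-1.
Proof.
move=> x0; have := is_derive1_ln x0 => dln.
by apply: is_derive_eq; rewrite subr0.
Qed.

Let F'E (x : R) : 0 < x -> F^`()%classic x = x^-1.
Proof. by move=> /dF dFx; rewrite derive1E derive_val. Qed.

Let F'near (x : R) : 0 < x -> {near x, F^`()%classic =1 GRing.inv}.
Proof.
by move=> x0; near=> y; apply: F'E; near: y; exact: lt_nbhsr.
Unshelve. all: by end_near.
Qed.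

Let F'cvg (x : R) : 0 < x -> F^`()%classic y @[y --> x] --> x^-1.
Proof.
move=> x0; apply: cvg_trans (inv_continuous (lt0r_neq0 x0)).
by apply: near_eq_cvg; have := F'near x0; apply: filterS => y ->.
Qed.

(** Substitution [t = ln x - l], [dt = dx / x]. Starting at [a > 0] keeps the derivative convergent
    at both ends, to [a^-1] and to 0; the whole half-line is then reached by exhaustion. *)
Lemma ge0_integral_ln_cy (a : R) : 0 < a ->
  (\int[mu]_(t in `[(ln a - l)%R, +oo[) (G t)%:E =
   \int[mu]_(x in `[a, +oo[) (G (ln x - l) / x)%:E)%E.
Proof.
move=> a0.
have F'a x : x \in `]a, +oo[ -> 0 < x by rewrite in_itv/= andbT; exact: lt_trans.
rewrite (increasing_ge0_integration_by_substitutiony (F := F)).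
- apply: eq_integral => x; rewrite inE/= in_itv/= andbT => ax.
  by congr EFin; rewrite fctE F'E// (lt_le_trans a0).
- move=> x y; rewrite !in_itv/= !andbT => ax ay xy.
  by rewrite ltrD2r ltr_ln// posrE (lt_le_trans a0).
- move=> x /F'a x0; rewrite /continuous_at F'E//; exact: F'cvg.
- apply/cvg_ex; exists a^-1; apply: cvg_at_right_filter; exact: F'cvg.
- apply/cvg_ex; exists 0.
  apply: (@cvg_trans _ (x^-1 @[x --> +oo])).
    apply: near_eq_cvg; near=> x; apply/esym/F'E.
    by near: x; exact: nbhs_pinfty_gt.
  apply/gtr0_cvgV0; first by near=> x; near: x; exact: nbhs_pinfty_gt.
  exact: cvg_id.
- split; first by move=> x /F'a x0; apply: ex_derive; exact: dF x0.
  apply: cvg_at_right_filter; apply: cvgB; last exact: cvg_cst.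
  exact: continuous_ln.
- apply/cvgryPge => A; near=> x; rewrite lerBrDr.
  rewrite -ler_expR lnK; last by rewrite posrE; near: x; exact: nbhs_pinfty_gt.
  by near: x; exact: nbhs_pinfty_ge.
- exact: continuous_subspaceT.
- by [].
Unshelve. all: by end_near.
Qed.

Lemma ge0_integral_ln :
  (\int[mu]_t (G t)%:E =
   \int[mu]_(x in `]0%R, +oo[) (G (ln x - l) / x)%:E)%E.
Proof.
(* [A n] is the image of [B n] under [ln x - l], and the left ends run to minus infinity and to
   0. *)
pose A n := `[- n%:R - l, +oo[%classic : set R.
pose B n := `[expR (- n%:R), +oo[%classic : set R.
have AT : \bigcup_n A n = setT.
  apply/seteqP; split=> // x _; exists (Num.truncn `|x + l|).+1 => //=.
  rewrite /A/= in_itv/= andbT lerBlDr lerNl (le_trans _ (ltW (truncnS_gt _)))//.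
  by rewrite -normrN ler_norm.
have BT : \bigcup_n B n = `]0, +oo[%classic.
  apply/seteqP; split=> [x [n _]|x]; rewrite /B/= !in_itv/= !andbT.
    by apply: lt_le_trans; exact: expR_gt0.
  move=> x0; exists (Num.truncn `|ln x|).+1 => //=.
  rewrite /B/= in_itv/= andbT -[leRHS]lnK ?posrE// ler_expR lerNl.
  by rewrite (le_trans _ (ltW (truncnS_gt _)))// -normrN ler_norm.
have mG : measurable_fun setT G by exact: continuous_measurable_fun.
have cA := @ge0_nondecreasing_set_cvg_integral _ (measurableTypeR R) R A (EFin \o G) mu.
have cB := @ge0_nondecreasing_set_cvg_integral _ (measurableTypeR R) R B
  (fun x => (G (ln x - l) / x)%:E) mu.
rewrite -AT -BT; apply: (@cvg_unique _ _ (\int[mu]_(x in A i) (G x)%:E @[i --> \oo])%E) => //.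
- apply: cA => //.
  + apply/nondecreasing_seqP => n; rewrite subsetEset => x.
    rewrite /A/= !in_itv/= !andbT; apply: le_trans.
    by rewrite lerD2r lerN2 ler_nat.
  + by move=> n; exact: measurable_itv.
  + by move=> n; apply: measurable_funTS; exact/measurable_EFinP.
  + by move=> n x _; rewrite lee_fin.
- rewrite (_ : (fun i => _) = (fun i => \int[mu]_(x in B i) (G (ln x - l) / x)%:E))%E.
    apply: cB => //.
    + apply/nondecreasing_seqP => n; rewrite subsetEset => x.
      rewrite /B/= !in_itv/= !andbT; apply: le_trans.
      by rewrite ler_expR lerN2 ler_nat.
    + by move=> n; exact: measurable_itv.
    + move=> n; apply: measurable_funTS; apply/measurable_EFinP.
      apply: measurable_funM; last exact: measurable_invr.
      by apply: (measurableT_comp mG); exact: measurable_funB.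
    + move=> n x; rewrite /B/= in_itv/= andbT => nx; rewrite lee_fin divr_ge0//.
      exact: le_trans (expR_ge0 _) nx.
  apply/funext => n; rewrite /A /B -ge0_integral_ln_cy ?expR_gt0//.
  by rewrite expRK.
Qed.

End log_substitution.

Section bessel.
Context {R : realType}.
Local Notation mu := (@lebesgue_measure R).

Lemma cosh_ge1 (t : R) : 1 <= cosh t.
Proof.
rewrite /cosh ler_pdivlMr// mul1r.
by have := expR_ge1Dx t; have := expR_ge1Dx (- t); lra.
Qed.

Lemma coshN (t : R) : cosh (- t) = cosh t.
Proof. by rewrite /cosh opprK addrC. Qed.

Lemma cosh_le_expR (t : R) : cosh t <= expR `|t|.
Proof.
have h1 : expR t <= expR `|t| by rewrite ler_expR ler_norm.
have h2 : expR (- t) <= expR `|t| by rewrite ler_expR -normrN ler_norm.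
by rewrite /cosh ler_pdivrMr//; lra.
Qed.

Lemma continuous_cosh : continuous (@cosh R).
Proof.
move=> x; apply: cvgM; last exact: cvg_cst.
apply: cvgD; first exact: continuous_expR.
by apply: continuous_comp; [exact: continuousN|exact: continuous_expR].
Qed.

Variables (q w : R).
Hypothesis w0 : 0 < w.

Let f (t : R) := expR (- w * cosh t) * cosh (q * t).

Let f0 t : 0 < f t.
Proof. by rewrite mulr_gt0 ?expR_gt0// (lt_le_trans _ (cosh_ge1 _)). Qed.

Let cf : continuous f.
Proof.
move=> x; apply: cvgM.
  apply: continuous_comp; last exact: continuous_expR.
  by apply: cvgM; [exact: cvg_cst|exact: continuous_cosh].
apply: continuous_comp; last exact: continuous_cosh.
by apply: cvgM; [exact: cvg_cst|exact: cvg_id].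
Qed.

Let mf : measurable_fun setT f.
Proof. exact: continuous_measurable_fun. Qed.

(* tangent-line bound for exp at the point where w * expR s / 2 = `|q| + 1 *)
Let f_le : exists2 C, 0 <= C & forall t, 0 <= t -> f t <= C * expR (- t).
Proof.
pose k := `|q| + 1.
have k0 : 0 < k by rewrite ltr_wpDl.
pose s := ln (2 * k / w).
have es : w * expR s = 2 * k.
  by rewrite lnK ?posrE ?divr_gt0 ?mulr_gt0// mulrC divfK// gt_eqF.
exists (expR (- (k * (1 - s)))); first exact: expR_ge0.
move=> t t0; rewrite -expRD.
have -> : - (k * (1 - s)) - t = - (k * (1 + t - s)) + `|q| * t.
  by rewrite /k; ring.
rewrite expRD ler_pM// ?expR_ge0//.
- by rewrite (le_trans _ (cosh_ge1 _)).
- rewrite ler_expR mulNr lerN2.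
  have h : expR t / 2 <= cosh t.
    by rewrite /cosh ler_pM2r ?invr_gt0//; have := expR_ge0 (- t); lra.
  apply: le_trans (_ : w * (expR t / 2) <= _); last by rewrite ler_pM2l.
  have -> : expR t = expR s * expR (t - s) by rewrite -expRD addrC subrK.
  have -> : w * (expR s * expR (t - s) / 2) = k * expR (t - s).
    by rewrite mulrA mulrA es; field.
  by rewrite ler_pM2l// -addrA expR_ge1Dx.
- by rewrite (le_trans (cosh_le_expR _))// ler_expR normrM (ger0_norm t0).
Qed.

Let f_lty : (\int[mu]_(t in `[0%R, +oo[) (f t)%:E < +oo)%E.
Proof.
have [C C0 fC] := f_le.
apply: (@le_lt_trans _ _ (\int[mu]_(t in `[0%R, +oo[)
    (C%:E * (exponential_pdf 1 t)%:E))%E).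
  apply: ge0_le_integral => //.
  - by move=> t _; rewrite lee_fin ltW.
  - by apply: measurable_funTS; exact/measurable_EFinP.
  - apply: measurable_funTS; apply: emeasurable_funM; first exact: measurable_cst.
    by apply/measurable_EFinP; exact: measurable_exponential_pdf.
  - move=> t; rewrite /= in_itv/= andbT => t0.
    by rewrite exponential_pdfE// mul1r mulN1r lee_fin fC.
rewrite ge0_integralZl//.
- apply: (@le_lt_trans _ _ (C%:E * 1)%E); last by rewrite mule1 ltry.
  apply: lee_wpmul2l; first by rewrite lee_fin.
  rewrite -(@integral_exponential_pdf R 1)//.
  apply: ge0_subset_integral => //.
    by apply/measurable_EFinP; exact: measurable_exponential_pdf.
  by move=> t _; rewrite lee_fin exponential_pdf_ge0.
- apply: measurable_funTS; apply/measurable_EFinP; exact: measurable_exponential_pdf.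
- by move=> t _; rewrite lee_fin exponential_pdf_ge0.
Qed.

Let f_ge0 : (0 <= \int[mu]_(t in `[0%R, +oo[) (f t)%:E)%E.
Proof. by apply: integral_ge0 => t _; rewrite lee_fin ltW. Qed.

(** The real-valued integral in [besselK] is a [fine], so the identity rests on the finiteness
    [f_lty]. *)
Lemma besselKE : (besselK q w)%:E = (\int[mu]_(t in `[0%R, +oo[) (f t)%:E)%E.
Proof. by rewrite /besselK /Rintegral fineK// ge0_fin_numE. Qed.

Lemma besselK_gt0 : 0 < besselK q w.
Proof.
rewrite -lte_fin besselKE.
(* A lower bound of the integrand on the unit interval, because [cosh t <= e^t <= e] and
   [cosh (q t) >= 1] there. *)
pose c := expR (- w * expR 1).
have c0 : 0 < c by exact: expR_gt0.
apply: (@lt_le_trans _ _ (\int[mu]_(t in `[0%R, 1%R]) c%:E)%E).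
  rewrite integral_cst// [X in (_ * X)%E]lebesgue_measure_itv/= lte_fin ltr01.
  by rewrite sube0 mule1 lte_fin.
apply: (@le_trans _ _ (\int[mu]_(t in `[0%R, 1%R]) (f t)%:E)%E).
  apply: ge0_le_integral => //.
  - by move=> t _; rewrite lee_fin ltW.
  - by apply: measurable_funTS; exact/measurable_EFinP.
  - move=> t; rewrite /= in_itv/= => /andP[t0 t1].
    rewrite lee_fin -[leLHS]mulr1 ler_pM ?expR_ge0 ?cosh_ge1//.
    rewrite ler_expR !mulNr lerN2 ler_pM2l// (le_trans (cosh_le_expR _))//.
    by rewrite ler_expR ger0_norm.
apply: ge0_subset_integral => //.
- by apply: measurable_funTS; exact/measurable_EFinP.
- by move=> t _; rewrite lee_fin ltW.
- by apply: subset_itvl; rewrite bnd_simp.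
Qed.

(** Fold the line at 0: [cosh] is even, and [e^(q t) + e^(- q t)] is [2 cosh (q t)]. *)
Lemma integral_expR_cosh :
  (\int[mu]_t (expR (q * t) * expR (- w * cosh t))%:E = (2 * besselK q w)%:E)%E.
Proof.
pose g (t : R) := expR (q * t) * expR (- w * cosh t).
have g0 t : 0 <= g t by rewrite mulr_ge0 ?expR_ge0.
have cg : continuous g.
  move=> x; apply: cvgM.
    apply: continuous_comp; last exact: continuous_expR.
    by apply: cvgM; [exact: cvg_cst|exact: cvg_id].
  apply: continuous_comp; last exact: continuous_expR.
  by apply: cvgM; [exact: cvg_cst|exact: continuous_cosh].
have mg : measurable_fun setT g by exact: continuous_measurable_fun.
have mgN : measurable_fun setT (fun t : R => g (- t)) by exact: measurableT_comp.
rewrite -[LHS]/(\int[mu]_t (g t)%:E)%E.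
have mE (h : R -> R) : measurable_fun setT h -> forall D, measurable_fun D (EFin \o h).
  by move=> mh D; apply: measurable_funTS; exact/measurable_EFinP.
have mgE := mE _ mg; have mfE := mE _ mf; have mgNE := mE _ mgN.
rewrite -(setUv `]-oo, 0%R]%classic) ge0_integral_setU//=; last 4 first.
- by apply: measurableC.
- exact: mgE.
- by move=> x _; rewrite lee_fin.
- exact/disj_setPCl.
rewrite setCitvl integral_itv_obnd_cbnd; last exact: mgE.
have -> : (\int[mu]_(x in `]-oo, 0%R]) (g x)%:E =
    \int[mu]_(x in `[0%R, +oo[) (g (- x))%:E)%E.
  have h0 (x : R) : (0 <= (g (- x))%:E)%E by rewrite lee_fin.
  rewrite [RHS](ge0_integration_by_substitution0 (mgNE _) h0).
  by apply: eq_integral => x _; rewrite /= opprK.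
rewrite -ge0_integralD//.
transitivity (\int[mu]_(t in `[0%R, +oo[) (2%:E * (f t)%:E))%E.
  apply: eq_integral => t _; rewrite -EFinD -EFinM; congr EFin.
  by rewrite /g /f coshN mulrN /cosh; field.
rewrite ge0_integralZl//.
- by rewrite EFinM besselKE.
- exact: mfE.
- by move=> t _; rewrite lee_fin ltW.
- by move=> t _; rewrite lee_fin.
- exact: mgNE.
- by move=> t _; rewrite lee_fin.
- exact: mgE.
Qed.

End bessel.

Section gig_integral.
Context {R : realType}.
Local Notation mu := (@lebesgue_measure R).
Variables (q a b : R).
Hypotheses (a0 : 0 < a) (b0 : 0 < b).

Let w := Num.sqrt (a * b).
Let w0 : 0 < w. Proof. by rewrite sqrtr_gt0 mulr_gt0. Qed.

(* substitution x = sqrt (b / a) * expR t *)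
Lemma gig_pdf_ln (x : R) : 0 < x ->
  let t := ln x - ln (Num.sqrt (b / a)) in
  gig_pdf q a b x =
  (2 * besselK q w)^-1 * (expR (q * t) * expR (- w * cosh t) / x).
Proof.
move=> x0 t; rewrite /gig_pdf x0 -/w.
have r0 : 0 < Num.sqrt (b / a) by rewrite sqrtr_gt0 divr_gt0.
set r := Num.sqrt (b / a) in t r0 *.
have et : expR t = x / r by rewrite /t expRB !lnK.
(* With [w / r = a] this turns [a x + b / x] at [x = r e^t] into [w (e^t + e^(- t))]. *)
have wr : w * r = b.
  rewrite -sqrtrM ?mulr_ge0 ?ltW//.
  have -> : a * b * (b / a) = b ^+ 2 by field; rewrite gt_eqF.
  by rewrite sqrtr_sqr gtr0_norm.
have wr' : w / r = a.
  apply: (mulIf (lt0r_neq0 b0)); transitivity (w / r * (w * r)).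
    by rewrite wr.
  transitivity (w ^+ 2); first by field; rewrite gt_eqF.
  by rewrite sqr_sqrtr// mulr_ge0 ?ltW.
have -> : - (a * x + b / x) / 2 = - w * cosh t.
  have abE : a * x + b / x = w * (x / r + (x / r)^-1).
    by rewrite -[X in X * x]wr' -[X in X / x]wr; field; rewrite !gt_eqF.
  by rewrite /cosh expRN et abE; field; rewrite !gt_eqF.
have -> : expR (q * t) = x `^ q * (a / b) `^ (q / 2).
  rewrite /t mulrBr expRB; congr (_ * _); first by rewrite /powR gt_eqF.
  rewrite /powR gt_eqF ?divr_gt0// -expRN; congr expR.
  rewrite /r.
  have -> : ln (a / b) = - (ln (b / a)) by rewrite -lnV ?posrE ?divr_gt0// invf_div.
  have -> : ln (b / a) = ln (Num.sqrt (b / a)) *+ 2.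
    rewrite -{1}(@sqr_sqrtr _ (b / a)) ?divr_ge0 ?ltW//.
    by rewrite expr2 lnM ?posrE// mulr2n.
  by rewrite -mulr_natl; field.
have -> : x `^ (q - 1) = x `^ q / x.
  by rewrite /powR gt_eqF// mulrBl mul1r expRB lnK.
by field; rewrite !gt_eqF ?besselK_gt0.
Qed.

(** [c] ranges over all reals because the conditional law criterion asks for a nonnegative kernel at
    every conditioning value, including those where rss is not positive. *)
Lemma gig_pdf_ge0 (c x : R) : 0 <= gig_pdf q a c x.
Proof.
rewrite /gig_pdf; case: ifP => // x0.
rewrite !mulr_ge0 ?powR_ge0 ?expR_ge0// invr_ge0 mulr_ge0//.
apply: fine_ge0; apply: integral_ge0 => t _; rewrite lee_fin mulr_ge0 ?expR_ge0//.
exact: le_trans (cosh_ge1 _).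
Qed.

Lemma integral_gig_pdf : (\int[mu]_x (gig_pdf q a b x)%:E = 1)%E.
Proof.
pose l := ln (Num.sqrt (b / a)).
pose G (t : R) := (2 * besselK q w)^-1 * (expR (q * t) * expR (- w * cosh t)).
have K0 : 0 < 2 * besselK q w by rewrite mulr_gt0// besselK_gt0.
have G0 t : 0 <= G t by rewrite mulr_ge0 ?mulr_ge0 ?expR_ge0// invr_ge0 ltW.
have cg : continuous (fun t : R => expR (q * t) * expR (- w * cosh t)).
  move=> x; apply: cvgM.
    apply: continuous_comp; last exact: continuous_expR.
    by apply: cvgM; [exact: cvg_cst|exact: cvg_id].
  apply: continuous_comp; last exact: continuous_expR.
  by apply: cvgM; [exact: cvg_cst|exact: continuous_cosh].
have cG : continuous G by move=> x; apply: cvgM; [exact: cvg_cst|exact: cg].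
transitivity (\int[mu]_t (G t)%:E)%E.
  rewrite (ge0_integral_ln l cG G0) [RHS]integral_mkcond.
  apply: eq_integral => x _; rewrite patchE; case: ifPn.
    rewrite inE/= in_itv/= andbT => x0; rewrite gig_pdf_ln// -/l /G !mulrA//.
  move/negP; rewrite inE/= in_itv/= andbT => /negP/negbTE x0.
  by rewrite /gig_pdf x0.
under eq_integral do rewrite EFinM.
rewrite ge0_integralZl//.
- by rewrite integral_expR_cosh// -EFinM mulVf// gt_eqF.
- by apply/measurable_EFinP; exact: continuous_measurable_fun.
- by rewrite lee_fin invr_ge0 ltW.
Qed.

End gig_integral.

(** * The joint law of the data, the latent variables and the covariance *)

Section product_measures.
Local Open Scope ereal_scope.
Context {R : realType}.

Lemma integral_prod_rect d1 d2 (T1 : measurableType d1) (T2 : measurableType d2)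
    (m1 : {sigma_finite_measure set T1 -> \bar R})
    (m2 : {sigma_finite_measure set T2 -> \bar R}) (f : T1 * T2 -> \bar R) A B :
  measurable_fun setT f -> (forall x, 0 <= f x) -> measurable A -> measurable B ->
  \int[sf_product m1 m2]_(z in A `*` B) f z =
  \int[m1]_(x in A) \int[m2]_(y in B) f (x, y).
Proof.
move=> mf f0 mA mB; rewrite integral_mkcond.
have mAB : measurable (A `*` B) by exact: measurableX.
rewrite integral_sf_product; last 2 first.
- by apply/(measurable_restrictT _ mAB)/measurable_funTS.
- by move=> x; exact: erestrict_ge0.
rewrite [RHS]integral_mkcond; apply: eq_integral => x _.
rewrite patchE; case: ifPn => xA.
  rewrite [RHS]integral_mkcond; apply: eq_integral => y _.
  by rewrite !patchE in_setX/= xA.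
by apply: integral0_eq => y _; rewrite patchE in_setX/= (negbTE xA).
Qed.

Lemma measurable_integral d1 d2 (T1 : measurableType d1) (T2 : measurableType d2)
    (m2 : {sigma_finite_measure set T2 -> \bar R}) (f : T1 * T2 -> \bar R) :
  measurable_fun setT f -> (forall x, 0 <= f x) ->
  measurable_fun setT (fun x => \int[m2]_y f (x, y)).
Proof. exact: measurable_fun_fubini_tonelli_F. Qed.

Lemma integral_sf_product3 d1 d2 d3 (T1 : measurableType d1)
    (T2 : measurableType d2) (T3 : measurableType d3)
    (m1 : {sigma_finite_measure set T1 -> \bar R})
    (m2 : {sigma_finite_measure set T2 -> \bar R})
    (m3 : {sigma_finite_measure set T3 -> \bar R}) (f : T1 * T2 * T3 -> \bar R) :
  measurable_fun setT f -> (forall x, 0 <= f x) ->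
  \int[sf_product (sf_product m1 m2) m3]_t f t =
  \int[m1]_x \int[m2]_y \int[m3]_z f (x, y, z).
Proof.
move=> mf f0; rewrite integral_sf_product//.
rewrite (integral_sf_product _ _ (measurable_integral _ mf f0))// => x.
exact: integral_ge0.
Qed.

Lemma integral_sf_product_swap d1 d2 d3 (T1 : measurableType d1)
    (T2 : measurableType d2) (T3 : measurableType d3)
    (m1 : {sigma_finite_measure set T1 -> \bar R})
    (m2 : {sigma_finite_measure set T2 -> \bar R})
    (m3 : {sigma_finite_measure set T3 -> \bar R}) (f : T1 * T2 * T3 -> \bar R) :
  measurable_fun setT f -> (forall x, 0 <= f x) ->
  \int[sf_product (sf_product m1 m2) m3]_t f t =
  \int[sf_product (sf_product m1 m3) m2]_t f (t.1.1, t.2, t.1.2).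
Proof.
move=> mf f0.
have mg : measurable_fun setT (fun t : T1 * T3 * T2 => f (t.1.1, t.2, t.1.2)).
  have m11 : measurable_fun setT (fun t : T1 * T3 * T2 => t.1.1) by exact: measurableT_comp.
  have m12 : measurable_fun setT (fun t : T1 * T3 * T2 => t.1.2) by exact: measurableT_comp.
  by apply: measurableT_comp => //; do 2 apply: measurable_fun_pair => //.
rewrite !integral_sf_product3//.
apply: eq_integral => x _; rewrite (fubini_tonelli (fun yz => f (x, yz.1, yz.2)))//.
apply: measurableT_comp => //; apply: measurable_fun_pair => //=.
exact: measurable_fun_pair.
Qed.

(** Only a generating pi-system is asked of the first factor: conditional independence of the rows
    of [Y] describes the law on products of row events. *)
Lemma finite_measure_prod_unique d1 d2 (T1 : measurableType d1) (T2 : measurableType d2)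
    (G1 : set (set T1)) (m1 m2 : {measure set (T1 * T2) -> \bar R}) :
  measurable = <<s G1 >> -> setI_closed G1 -> G1 setT -> m1 setT < +oo ->
  (forall A B, G1 A -> measurable B -> m1 (A `*` B) = m2 (A `*` B)) ->
  forall E, measurable E -> m1 E = m2 E.
Proof.
move=> mG1 IG1 G1T m1T m12.
pose G := [set A `*` B | A in G1 & B in @measurable _ T2].
apply: (measure_unique G (fun=> setT)).
- apply/seteqP; split; last first.
    apply: smallest_sub; first exact: sigma_algebra_measurable.
    move=> _ [A GA [B mB <-]]; apply: measurableX => //.
    by rewrite mG1; exact: sub_sigma_algebra.
  apply: smallest_sub; first exact: smallest_sigma_algebra.
  rewrite subUset; split; last first.
    move=> _ [B mB <-]; apply: sub_sigma_algebra.
    by exists setT => //; exists B => //; rewrite setTI setTX.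
  move=> _ [A mA <-]; rewrite setTI; move: A mA; rewrite mG1.
  (* The sets whose cylinder is generated by the rectangles form a sigma-algebra, hence contain
     everything that [G1] generates. *)
  pose fstG : set_system T1 := [set A | <<s G >> (fst @^-1` A : set (T1 * T2))].
  apply: (smallest_sub (X := fstG)).
    split=> [|A|A hA].
    + exact: sigma_algebra0.
    + by rewrite /fstG/= setTD preimage_setC; exact: sigma_algebraC.
    + by rewrite /fstG/= preimage_bigcup; exact: sigma_algebra_bigcup.
  move=> A GA; apply: sub_sigma_algebra.
  by exists A => //; exists setT => //; rewrite setXT.
- move=> _ _ [A GA [B mB <-]] [A' GA' [B' mB' <-]].
  exists (A `&` A'); first exact: IG1.
  by exists (B `&` B'); [exact: measurableI|rewrite setXI].
- by move=> _; exists setT => //; exists setT => //; rewrite setXTT.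
- by apply/seteqP; split=> // x _; exists 0%N.
- by move=> _ [A GA [B mB <-]]; exact: m12.
- by [].
Qed.

Lemma emeasurable_prod d (T : measurableType d) I (s : seq I) (h : I -> T -> \bar R) :
  (forall i, measurable_fun setT (h i)) ->
  measurable_fun setT (fun x => \prod_(i <- s) h i x).
Proof.
move=> mh; elim: s => [|i s IHs].
  by under eq_fun do rewrite big_nil; exact: measurable_cst.
by under eq_fun do rewrite big_cons; exact: emeasurable_funM.
Qed.

End product_measures.

(** * Product measures over the rows of a data matrix *)

Section rows.
Local Open Scope ereal_scope.
Context {R : realType} {p : nat}.
Variable mu : {sigma_finite_measure set 'cV[R]_p -> \bar R}.

Definition cons_row n (q : 'cV[R]_p * 'M[R]_(n, p)) : 'M[R]_(n.+1, p) :=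
  col_mx q.1^T q.2.
Definition uncons_row n (A : 'M[R]_(n.+1, p)) : 'cV[R]_p * 'M[R]_(n, p) :=
  ((usubmx (A : 'M[R]_(1 + n, p)))^T, dsubmx (A : 'M[R]_(1 + n, p))).

Lemma cons_rowK n : cancel (@cons_row n) (@uncons_row n).
Proof. by move=> [x A]; rewrite /uncons_row col_mxKu col_mxKd trmxK. Qed.

Lemma measurable_cons_row n : measurable_fun setT (@cons_row n).
Proof. by apply: (@measurable_col_mx _ _ _ 1 n) => //; exact: measurable_trmx. Qed.

Lemma measurable_uncons_row n : measurable_fun setT (@uncons_row n).
Proof.
apply: measurable_fun_pair; apply: measurable_mxP => i j.
  by under eq_fun do rewrite !mxE; exact: measurable_mx_coef.
by under eq_fun do rewrite !mxE; exact: measurable_mx_coef.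
Qed.

(** Built row by row so that a product over rows integrates to a product, which is the shape of
    [cond_iid_rows]. The choice of reference measure for [Y] is free, as [Y] is always conditioned
    on. *)
Fixpoint rows_measure n : {sigma_finite_measure set 'M[R]_(n, p) -> \bar R} :=
  if n is n'.+1 then
    sf_pushforward (sf_product mu (rows_measure n'))
      (@measurable_cons_row n') (@measurable_uncons_row n') (@cons_rowK n')
  else \d_(0%R : 'M[R]_(0, p)).

Lemma row_cons_row0 n q : (row ord0 (@cons_row n q))^T = q.1.
Proof.
apply/colP => i; rewrite !mxE; case: splitP => // j _.
by rewrite !ord1 mxE.
Qed.

Lemma row_cons_rowS n q i : row (lift ord0 i) (@cons_row n q) = row i q.2.
Proof.
apply/rowP => j; rewrite !mxE; case: splitP => [k|k].
  by rewrite !ord1 lift0.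
by rewrite lift0 => -[/val_inj ->].
Qed.

Lemma integral_rows_prod n (f : 'I_n -> 'cV[R]_p -> \bar R) :
  (forall i, measurable_fun setT (f i)) -> (forall i x, 0 <= f i x) ->
  \int[rows_measure n]_y \prod_(i < n) f i (row i y)^T =
  \prod_(i < n) \int[mu]_x f i x.
Proof.
elim: n f => [|n IHn] f mf f0.
  rewrite big_ord0 (eq_integral (cst 1)); last by move=> y _; rewrite big_ord0.
  by rewrite integral_cst// mul1e [LHS]diracE in_setT.
have mrow k (g : 'I_k -> 'cV[R]_p -> \bar R) : (forall i, measurable_fun setT (g i)) ->
    measurable_fun setT (fun y : 'M[R]_(k, p) => \prod_(i < k) g i (row i y)^T).
  move=> mg; apply: emeasurable_prod => i; apply: measurableT_comp => //.
  by apply: measurable_trmx; exact: measurable_row.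
have p0 k (g : 'I_k -> 'cV[R]_p -> \bar R) y : (forall i x, 0 <= g i x) ->
    0 <= \prod_(i < k) g i (row i y)^T.
  by move=> g0; exact: prode_ge0.
rewrite [LHS]integral_sf_pushforward; [|exact: mrow|by move=> y; exact: p0].
rewrite integral_sf_product; last 2 first.
- by apply: measurableT_comp (mrow _ _ mf) _; exact: measurable_cons_row.
- by move=> x; exact: p0.
pose g i := f (lift ord0 i).
have mg i : measurable_fun setT (g i) by exact: mf.
have g0 i x : 0 <= g i x by exact: f0.
rewrite big_ord_recl -(IHn g)// -ge0_integralZr//; last first.
  by apply: integral_ge0 => y _; exact: (p0 _ g).
apply: eq_integral => x _; rewrite -ge0_integralZl//.
- apply: eq_integral => y _; rewrite big_ord_recl row_cons_row0; congr (_ * _).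
  by apply: eq_bigr => i _; rewrite row_cons_rowS.
- exact: mrow.
- by move=> y _; exact: (p0 _ g).
Qed.

Definition row_rect n (A : 'I_n -> set 'cV[R]_p) : set 'M[R]_(n, p) :=
  [set y | forall i, A i (row i y)^T].

Lemma measurable_row_rects n : measurable =
  <<s [set E | exists2 A : 'I_n -> set 'cV[R]_p,
    forall i, measurable (A i) & E = row_rect A] >>.
Proof.
apply/seteqP; split; apply: smallest_sub; try exact: smallest_sigma_algebra.
- move=> _ [[i j] _ [C mC <-]]; apply: sub_sigma_algebra.
  exists (fun k => if k == i then [set x : 'cV[R]_p | C (x j ord0)] else setT).
    move=> k; case: ifP => // _; rewrite -[X in measurable X]setTI.
    exact: (@measurable_mx_coef R p 1 j ord0).
  apply/seteqP; split=> [y [_ Cy] k|y /(_ i)]; rewrite /mx_coor/=.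
    by case: ifP => // /eqP ->; rewrite /= !mxE.
  by rewrite eqxx /= !mxE.
- move=> _ [A mA ->]; rewrite (_ : row_rect A = \bigcap_(i in [set: 'I_n])
    ((fun y : 'M[R]_(n, p) => (row i y)^T) @^-1` A i)); last first.
    by apply/seteqP; split=> [t h i _|t h i]; exact: h.
  apply: fin_bigcap_measurable => // i _.
  rewrite -[X in measurable X]setTI.
  by apply: measurable_trmx => //; exact: measurable_row.
Qed.

Lemma row_rects_setI_closed n : setI_closed
  [set E | exists2 A : 'I_n -> set 'cV[R]_p,
    forall i, measurable (A i) & E = row_rect A].
Proof.
move=> _ _ [A mA ->] [B mB ->]; exists (fun i => A i `&` B i).
  by move=> i; exact: measurableI.
apply/seteqP; split=> [y [hA hB] i|y h]; first by split.
by split=> i; have [] := h i.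
Qed.

Lemma rows_measure_row0 n (H : set 'cV[R]_p) : measurable H -> mu H = 0 ->
  rows_measure n.+1 [set y | H (row ord0 y)^T] = 0.
Proof.
move=> mH H0; rewrite [LHS]sf_pushforwardE.
rewrite (_ : _ @^-1` _ = H `*` setT).
  rewrite sf_productE product_measure1E// -[X in _ = X](mul0e (rows_measure n setT)).
  by congr (_ * _).
by apply/seteqP; split=> [q|q []] /=; rewrite row_cons_row0.
Qed.

End rows.

(** * Measurability and sign of the prior, likelihood and GIG densities *)

Section measurable_densities.
Context {R : realType}.

(** The latent space is finite and its points are finite intersections of coordinate events, so its
    sigma-algebra is discrete. This settles every dependence on [z], normalizing constants
    included. *)
Lemma measurable_fun_ffun_bool (I : finType) d (T : measurableType d)
    (g : {ffun I -> bool} -> T) : measurable_fun setT g.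
Proof.
move=> _ A _; rewrite setTI.
rewrite (_ : g @^-1` A = \bigcup_(z in g @^-1` A) [set z]); last first.
  by apply/seteqP; split=> [z Az|z [z' Az' ->]]//; exists z.
apply: fin_bigcup_measurable; first exact: finite_finset.
move=> z _; rewrite (_ : [set z] = \bigcap_(i in [set: I])
    ((fun f : {ffun I -> bool} => f i) @^-1` [set z i])); last first.
  apply/seteqP; split=> [_ -> //|z' h]; apply/ffunP => i; exact: h.
apply: fin_bigcap_measurable; first exact: finite_finset.
move=> i _; rewrite -[X in measurable X]setTI.
exact: measurable_ffun_app.
Qed.

Lemma measurable_besselK (q : R) : measurable_fun setT (besselK q).
Proof.
rewrite /besselK /Rintegral; apply: measurableT_comp => //.
under eq_fun do rewrite integral_mkcond.
pose f (p : R * measurableTypeR R) :=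
  ((fun t => (expR (- p.1 * cosh t) * cosh (q * t))%:E) \_ `[0%R, +oo[) p.2.
apply: (measurable_fun_fubini_tonelli_F (m2 := lebesgue_measure) f); last first.
  move=> p; apply: erestrict_ge0 => t _; rewrite lee_fin mulr_ge0 ?expR_ge0//.
  exact: le_trans (cosh_ge1 _).
have mcosh : measurable_fun setT (@cosh R).
  by apply: continuous_measurable_fun; exact: continuous_cosh.
have mcosh2 : measurable_fun setT (fun p : R * measurableTypeR R => cosh p.2).
  exact: measurableT_comp.
rewrite (_ : f = (fun p => (expR (- p.1 * cosh p.2) * cosh (q * p.2))%:E)
    \_ (setT `*` `[0%R, +oo[)); last first.
  by apply/funext => p; rewrite /f !patchE in_setX in_setT.
have mA : measurable ([set: R] `*` (`[0%R, +oo[%classic : set (measurableTypeR R))).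
  by apply: measurableX => //; exact: measurable_itv.
apply/(measurable_restrictT _ mA)/measurable_funTS/measurable_EFinP.
apply: measurable_funM.
  apply: measurable_expRT; apply: measurable_funM => //.
  exact: measurable_funN.
apply: (measurableT_comp mcosh); apply: measurable_funM => //.
Qed.

Lemma measurable_gig_pdf d (T : measurableType d) (q a : R) (b x : T -> R) :
  measurable_fun setT b -> measurable_fun setT x ->
  measurable_fun setT (fun t => gig_pdf q a (b t) (x t)).
Proof.
move=> mb mx; rewrite /gig_pdf; apply: measurable_fun_ifT => //.
  by apply: measurable_fun_ltr.
apply: measurable_funM; last first.
  apply: measurable_expRT; apply: measurable_funM => //.
  apply: measurable_funN; apply: measurable_funD.
    exact: measurable_funM.
  by apply: measurable_funM => //; exact: measurable_invr.
apply: measurable_funM; last exact: measurable_powRT.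
apply: measurable_funM.
  by apply: measurable_powRT; apply: measurable_funM => //; exact: measurable_invr.
apply: measurable_invr; apply: measurable_funM => //.
apply: (measurableT_comp (measurable_besselK q)).
by apply: measurable_sqrtr; exact: measurable_funM.
Qed.

Variables (v0 v1 lambda : R) (p : nat).
Local Notation latent := {ffun tri ltn p -> bool}.

Hypothesis lambda_gt0 : 0 < lambda.

Lemma ss_unnormalized_ge0 (z : latent) S : 0 <= ss_unnormalized v0 v1 lambda z S.
Proof.
rewrite !mulr_ge0 ?prodr_ge0// => i _.
  exact: normal_pdf_ge0.
by apply: exponential_pdf_ge0; rewrite divr_ge0// ltW.
Qed.

Lemma ss_const_ge0 (z : latent) : 0 <= ss_const v0 v1 lambda z.
Proof.
by apply: fine_ge0; apply: integral_ge0 => S _; rewrite lee_fin ss_unnormalized_ge0.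
Qed.

Lemma measurable_ss_unnormalized d (T : measurableType d) (z : T -> latent)
    (S : T -> 'M[R]_p) : measurable_fun setT z -> measurable_fun setT S ->
  measurable_fun setT (fun t => ss_unnormalized v0 v1 lambda (z t) (S t)).
Proof.
move=> mz mS; rewrite /ss_unnormalized; apply: measurable_funM.
  apply: measurable_funM.
    apply: measurable_prod => e _.
    rewrite (_ : (fun _ => _) = (fun t => if z t e
        then normal_pdf 0 v1 (S t (val e).1 (val e).2)
        else normal_pdf 0 v0 (S t (val e).1 (val e).2))).
      apply: measurable_fun_ifT.
      - apply: (@measurableT_comp _ _ _ _ _ _ (fun f : latent => f e)) => //.
        exact: measurable_ffun_app.
      - apply: (measurableT_comp (measurable_normal_pdf 0 v1)).
        exact: measurable_coef.
      - apply: (measurableT_comp (measurable_normal_pdf 0 v0)).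
        exact: measurable_coef.
    by apply/funext => t; rewrite /sd_of; case: (z t e).
  apply: measurable_prod => i _.
  apply: (measurableT_comp (measurable_exponential_pdf (lambda / 2))).
  exact: measurable_coef.
apply: (@measurableT_comp _ _ _ _ _ _ (\1_posdef : 'M[R]_p -> R)) => //.
by apply: measurable_indic; exact: measurable_posdef.
Qed.

Definition ss_pdf (z : latent) (S : 'M[R]_p) : R :=
  (ss_const v0 v1 lambda z)^-1 * ss_unnormalized v0 v1 lambda z S.

Lemma ss_pdf_ge0 z S : 0 <= ss_pdf z S.
Proof. by rewrite mulr_ge0 ?invr_ge0 ?ss_const_ge0 ?ss_unnormalized_ge0. Qed.

Lemma measurable_ss_pdf : measurable_fun setT (fun zS : latent * 'M[R]_p => ss_pdf zS.1 zS.2).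
Proof.
apply: measurable_funM; last exact: measurable_ss_unnormalized.
apply: (@measurableT_comp _ _ _ _ _ _ (fun z : latent => (ss_const v0 v1 lambda z)^-1)) => //.
exact: measurable_fun_ffun_bool.
Qed.

Definition gauss_likelihood n (y : 'M[R]_(n, p)) (S : 'M[R]_p) : R :=
  \prod_(i < n) mvn_pdf 0 S (row i y)^T.

Lemma gauss_likelihood_ge0 n (y : 'M[R]_(n, p)) S : 0 <= gauss_likelihood y S.
Proof. by apply: prodr_ge0 => i _; exact: mvn_pdf_ge0. Qed.

Lemma measurable_gauss_likelihood d (T : measurableType d) n (y : T -> 'M[R]_(n, p))
    (S : T -> 'M[R]_p) : measurable_fun setT y -> measurable_fun setT S ->
  measurable_fun setT (fun t => gauss_likelihood (y t) (S t)).
Proof.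
move=> my mS; apply: measurable_prod => i _; apply: measurable_mvn_pdf => //.
by apply: measurable_trmx; exact: measurable_row.
Qed.

Definition joint_pdf n (q : 'M[R]_(n, p) * (latent * 'M[R]_p)) : R :=
  gauss_likelihood q.1 q.2.2 * ss_pdf q.2.1 q.2.2.

Lemma joint_pdf_ge0 n q : 0 <= @joint_pdf n q.
Proof. by rewrite mulr_ge0 ?gauss_likelihood_ge0 ?ss_pdf_ge0. Qed.

Lemma measurable_joint_pdf n : measurable_fun setT (@joint_pdf n).
Proof.
apply: measurable_funM.
  apply: measurable_gauss_likelihood => //.
  exact: measurableT_comp.
exact: (measurableT_comp measurable_ss_pdf).
Qed.

End measurable_densities.

Section joint_law.
Local Open Scope ereal_scope.
Context {R : realType} (n p : nat) (v0 v1 lambda : R) (lambda_gt0 : (0 < lambda)%R).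
Context d (Omega : measurableType d) (P : probability Omega R).
Local Notation latent := {ffun tri ltn p -> bool}.
Variables (Y : {RV P >-> 'M[R]_(n, p)}) (Sigma : {RV P >-> 'M[R]_p}) (Z : {RV P >-> latent}).
Hypothesis Sigma_prior : cond_law P Sigma Z (ss_law v0 v1 lambda).
Hypothesis Y_sample : cond_iid_rows P Y (fun w => (Sigma w, Z w)) (fun sz => mvn 0%R sz.1).

Local Notation pdf := (ss_pdf v0 v1 lambda).

(* Z is given its own law as reference measure, which spares a counting measure
   and makes the prior on Z irrelevant *)
Definition latent_law : {sigma_finite_measure set latent -> \bar R} := distribution P Z.

Let nu := sf_product latent_law (@lebesgue_sym R p).

Let pdf_ge0 (q : latent * 'M[R]_p) : (0 <= pdf q.1 q.2)%R.
Proof. exact: ss_pdf_ge0. Qed.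

Let mpdf : measurable_fun setT (fun q : latent * 'M[R]_p => pdf q.1 q.2).
Proof. exact: measurable_ss_pdf. Qed.

Let ZS w := (Z w, Sigma w).
Let mZS : measurable_fun setT ZS. Proof. exact: measurable_fun_pair. Qed.

Let law_ZS : {measure set (latent * 'M[R]_p) -> \bar R} :=
  measure_function_pushforward__canonical__measure_function_Measure P mZS.

(** On rectangles this is the defining identity of [Sigma_prior], transported to the law of [Z]. *)
Lemma prior_law E : measurable E ->
  P (ZS @^-1` E) = density_measure nu pdf_ge0 mpdf E.
Proof.
apply: (finite_measure_prod_unique (G1 := measurable) (m1 := law_ZS)).
- by rewrite sigma_algebra_id//; exact: sigma_algebra_measurable.
- exact: measurableI.
- exact: measurableT.
- rewrite /law_ZS/= /pushforward preimage_setT; apply: le_lt_trans (ltry 1%R).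
  exact: probability_le1.
move=> B A mB mA; have [mK _ KE] := Sigma_prior.
have := KE A B mA mB; rewrite setIC => lawE.
rewrite /law_ZS/= /pushforward (_ : _ @^-1` _ = Z @^-1` B `&` Sigma @^-1` A)// lawE.
transitivity (\int[sf_product latent_law lebesgue_sym]_(t in B `*` A)
    (pdf t.1 t.2)%:E); last by [].
rewrite integral_prod_rect//.
- rewrite -(ge0_integral_pushforward (measurable_funPT Z) P mB
    (f := fun z => ss_law v0 v1 lambda z A))//.
  + apply: measurable_funTS; exact: mK.
  + by move=> z _; apply: integral_ge0 => S _; rewrite lee_fin ss_pdf_ge0.
- exact/measurable_EFinP.
Qed.

Let q_ge0 := @joint_pdf_ge0 R v0 v1 lambda p lambda_gt0 n.
Let mq := @measurable_joint_pdf R v0 v1 lambda p n.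

Let rows := rows_measure (@lebesgue_mx R p 1) n.
Let YZS w := (Y w, (Z w, Sigma w)).
Let mYZS : measurable_fun setT YZS.
Proof. exact: measurable_fun_pair. Qed.

Let law_YZS : {measure set ('M[R]_(n, p) * (latent * 'M[R]_p)) -> \bar R} :=
  measure_function_pushforward__canonical__measure_function_Measure P mYZS.

(** On a product of row events with an event of [(Z, Sigma)], the sampling hypothesis gives the mean
    of a product of normal probabilities. That product is the integral of the likelihood over the
    row events, and [prior_law] supplies the density of [(Z, Sigma)]. *)
Lemma joint_law E : measurable E ->
  P ((fun w => (Y w, (Z w, Sigma w))) @^-1` E) =
  \int[sf_product rows (sf_product latent_law lebesgue_sym)]_(t in E)
    (joint_pdf v0 v1 lambda t)%:E.
Proof.
move=> mE; rewrite -[RHS](density_measureE _ q_ge0 mq).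
apply: (finite_measure_prod_unique (m1 := law_YZS) (@measurable_row_rects R p n)) => //.
- exact: row_rects_setI_closed.
- by exists (fun=> setT) => //; apply/seteqP; split.
- rewrite /law_YZS/= /pushforward preimage_setT; apply: le_lt_trans (ltry 1%R).
  exact: probability_le1.
move=> _ B [A mA ->] mB.
have mrowsA : measurable (row_rect A).
  by rewrite measurable_row_rects; apply: sub_sigma_algebra; exists A.
rewrite density_measureE.
pose L (q : latent * 'M[R]_p) := \prod_(i < n) mvn 0%R q.2 (A i).
have mmvn : measurable_fun setT (fun t : 'M[R]_p * 'cV[R]_p => mvn_pdf 0%R t.1 t.2).
  exact: measurable_mvn_pdf.
have mmvnA i : measurable_fun setT (fun S : 'M[R]_p => mvn 0%R S (A i)).
  rewrite /mvn; under eq_fun do rewrite integral_mkcond.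
  pose h (t : 'M[R]_p * 'cV[R]_p) := ((EFin \o (mvn_pdf 0%R t.1)) \_ (A i)) t.2.
  apply: (measurable_integral (f := h) lebesgue_mx); last first.
    by move=> t; apply: erestrict_ge0 => x _; rewrite lee_fin mvn_pdf_ge0.
  rewrite (_ : h = (fun t => (mvn_pdf 0%R t.1 t.2)%:E) \_ (setT `*` A i)).
    have mTA : measurable ([set: 'M[R]_p] `*` A i) by exact: measurableX.
    by apply/(measurable_restrictT _ mTA)/measurable_funTS/measurable_EFinP.
  by apply/funext => -[S x]; rewrite /h !patchE/= in_setX in_setT.
have mL : measurable_fun setT L.
  by apply: emeasurable_prod => i; exact: (measurableT_comp (mmvnA i)).
have mvn_ge0 S i : 0 <= mvn 0%R S (A i).
  by apply: integral_ge0 => x _; rewrite lee_fin mvn_pdf_ge0.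
have L_ge0 q : 0 <= L q by exact: prode_ge0.
(* The sampling hypothesis conditions on [(Sigma, Z)], whereas the joint law lists [Z] first. *)
have swapE : (fun w => (Sigma w, Z w)) @^-1` [set sz | B (sz.2, sz.1)] = ZS @^-1` B by [].
have mB' : measurable [set sz : 'M[R]_p * latent | B (sz.2, sz.1)].
  rewrite -[X in measurable X]setTI.
  have : measurable_fun setT (fun sz : 'M[R]_p * latent => (sz.2, sz.1)).
    exact: measurable_fun_pair.
  exact.
have := Y_sample mA mB'; rewrite swapE => lawE.
rewrite /law_YZS/= /pushforward.
transitivity (P ([set w | forall i, A i (row i (Y w))^T] `&` ZS @^-1` B)); first by [].
rewrite lawE.
transitivity (\int[P]_(w in ZS @^-1` B) (L \o ZS) w); first by [].
rewrite -(ge0_integral_pushforward mZS P mB); [|exact: measurable_funTS|by []].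
transitivity (\int[density_measure nu pdf_ge0 mpdf]_(q in B) L q).
  by apply: eq_measure_integral => C mC _; rewrite -prior_law.
rewrite integral_density//.
have mjpdf : measurable_fun setT (EFin \o @joint_pdf R v0 v1 lambda p n).
  by apply/measurable_EFinP; exact: (mq).
have mrectB : measurable (row_rect A `*` B) by exact: measurableX.
rewrite [RHS]integral_mkcond -/rows.
pose g := (EFin \o @joint_pdf R v0 v1 lambda p n) \_ (row_rect A `*` B).
rewrite -[RHS]/(\int[(rows \x sf_product latent_law lebesgue_sym)%E]_t g t).
rewrite (fubini_tonelli2 g); last 2 first.
- by apply/(measurable_restrictT _ mrectB)/measurable_funTS.
- by move=> t; apply: erestrict_ge0 => x _; rewrite lee_fin q_ge0.
rewrite [LHS]integral_mkcond; apply: eq_integral => -[z S] _.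
rewrite patchE; case: ifPn => zB; last first.
  by apply/esym/integral0_eq => y _; rewrite /g patchE in_setX/= (negbTE zB) andbF.
rewrite /L /=.
(* Each row density is cut off to its own event, so the product over rows is the likelihood on
   [row_rect A] and 0 elsewhere. *)
pose f i x := ((EFin \o mvn_pdf 0%R S) \_ (A i)) x.
have mf i : measurable_fun setT (f i).
  apply/(measurable_restrictT _ (mA i))/measurable_funTS/measurable_EFinP.
  exact: measurable_mvn_pdf.
have f_ge0 i x : 0 <= f i x.
  by apply: erestrict_ge0 => {}x _; rewrite lee_fin mvn_pdf_ge0.
under eq_bigr do rewrite /mvn integral_mkcond.
rewrite -[X in X * _](integral_rows_prod lebesgue_mx mf f_ge0).
have mfp : measurable_fun setT (fun y : 'M[R]_(n, p) => \prod_(i < n) f i (row i y)^T).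
  apply: emeasurable_prod => i; apply: measurableT_comp => //.
  by apply: measurable_trmx; exact: measurable_row.
rewrite -ge0_integralZr//; last 2 first.
- by move=> y _; exact: prode_ge0.
- by rewrite lee_fin ss_pdf_ge0.
apply: eq_integral => y _; rewrite /g patchE in_setX zB andbT.
case: ifPn => [|/negP]; rewrite inE => yA.
  rewrite /joint_pdf/= [RHS]EFinM; congr (_ * _).
  by rewrite -prodEFin; apply: eq_bigr => i _; rewrite /f patchE mem_set.
have [i nAi] : exists i, ~ A i (row i y)^T by apply/existsNP.
by rewrite (bigD1 i)//= /f patchE memNset// mul0e mul0e.
Qed.

End joint_law.

(** * The joint law in the coordinates of the leading block, [u] and [v] *)

Section schur_coordinates.
Local Open Scope ereal_scope.
Context {R : realType} (n m : nat) (v0 v1 lambda : R) (lambda_gt0 : (0 < lambda)%R).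
Context d (Omega : measurableType d) (P : probability Omega R).
Local Notation latent := {ffun tri ltn (m + 1) -> bool}.
Variables (Y : {RV P >-> 'M[R]_(n, m + 1)}) (Sigma : {RV P >-> 'M[R]_(m + 1)}).
Variable (Z : {RV P >-> latent}).
Hypothesis Sigma_prior : cond_law P Sigma Z (ss_law v0 v1 lambda).
Hypothesis Y_sample : cond_iid_rows P Y (fun w => (Sigma w, Z w)) (fun sz => mvn 0%R sz.1).

Local Notation S11 := (fun w => ulsubmx (Sigma w)).
Local Notation S12 := (fun w => ursubmx (Sigma w)).
Local Notation S22 := (fun w => drsubmx (Sigma w) ord0 ord0).

Lemma schurK (T : 'M[R]_m) u v : schur T u (v + qform (invmx T) u)%R = v.
Proof. by rewrite /schur addrK. Qed.

(* t = (y, z, Sigma11, u, v) *)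
Definition schur_pdf
    (t : 'M[R]_(n, m + 1) * latent * 'M[R]_m * 'cV[R]_m * R) : R :=
  let: (y, z, T, u, v) := t in
  joint_pdf v0 v1 lambda (y, (z, block_sym T u (v + qform (invmx T) u))).

Lemma schur_pdf_ge0 t : (0 <= schur_pdf t)%R.
Proof. by case: t => -[[[y z] T] u] v; exact: joint_pdf_ge0. Qed.

Lemma measurable_schur_pdf : measurable_fun setT schur_pdf.
Proof.
rewrite (_ : schur_pdf = (fun t => joint_pdf v0 v1 lambda (t.1.1.1.1,
  (t.1.1.1.2, block_sym t.1.1.2 t.1.2 (t.2 + qform (invmx t.1.1.2) t.1.2)%R)))).
  have m1 : measurable_fun setT
      (fun t : 'M[R]_(n, m + 1) * latent * 'M[R]_m * 'cV[R]_m * R => t.1.1).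
    exact: measurableT_comp.
  have m12 : measurable_fun setT
      (fun t : 'M[R]_(n, m + 1) * latent * 'M[R]_m * 'cV[R]_m * R => t.1.2).
    exact: measurableT_comp.
  have m111 : measurable_fun setT
      (fun t : 'M[R]_(n, m + 1) * latent * 'M[R]_m * 'cV[R]_m * R => t.1.1.1).
    exact: (measurableT_comp measurable_fst m1).
  have m112 : measurable_fun setT
      (fun t : 'M[R]_(n, m + 1) * latent * 'M[R]_m * 'cV[R]_m * R => t.1.1.2).
    exact: (measurableT_comp measurable_snd m1).
  apply: (measurableT_comp (@measurable_joint_pdf R v0 v1 lambda _ n)).
  apply: measurable_fun_pair; first exact: (measurableT_comp measurable_fst m111).
  apply: measurable_fun_pair; first exact: (measurableT_comp measurable_snd m111).
  apply: measurable_block_sym => //; apply: measurable_funD => //.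
  by apply: measurable_qform => //; exact: measurable_invmx.
by apply/funext => -[[[[y z] T] u] v].
Qed.

Let rows := rows_measure (@lebesgue_mx R (m + 1) 1) n.

Definition schur_base :=
  sf_product (sf_product rows (latent_law Z)) (@lebesgue_sym R m).

Let Theta (q : 'M[R]_(n, m + 1) * (latent * 'M[R]_(m + 1))) :=
  (q.1, q.2.1, ulsubmx q.2.2, ursubmx q.2.2,
   schur (ulsubmx q.2.2) (ursubmx q.2.2) (drsubmx q.2.2 ord0 ord0)).

Let mTheta : measurable_fun setT Theta.
Proof.
have m2 : measurable_fun setT
    (fun q : 'M[R]_(n, m + 1) * (latent * 'M[R]_(m + 1)) => q.2.2).
  exact: measurableT_comp.
have m21 : measurable_fun setT
    (fun q : 'M[R]_(n, m + 1) * (latent * 'M[R]_(m + 1)) => q.2.1).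
  exact: measurableT_comp.
have mul := measurable_ulsubmx m2.
have mur := measurable_ursubmx m2.
repeat apply: measurable_fun_pair => //.
apply: measurable_funB; first exact/measurable_coef/measurable_drsubmx.
by apply: measurable_qform => //; exact: measurable_invmx.
Qed.

(** Pull [C] back along [Theta] and apply [joint_law]. Tonelli fixes all coordinates but the last,
    and there the change of variables is a translation. *)
Lemma schur_law C : measurable C ->
  P ((fun w => (Y w, Z w, S11 w, S12 w, schur (S11 w) (S12 w) (S22 w))) @^-1` C) =
  \int[sf_product (sf_product schur_base (@lebesgue_mx R m 1)) lebesgueR]_(t in C)
    (schur_pdf t)%:E.
Proof.
move=> mC.
have mE : measurable (Theta @^-1` C).
  by rewrite -[X in measurable X]setTI; exact: mTheta.
have := joint_law lambda_gt0 Sigma_prior Y_sample mE.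
rewrite -comp_preimage => lawE.
transitivity (P ((Theta \o (fun w => (Y w, (Z w, Sigma w)))) @^-1` C)); first by [].
rewrite lawE {lawE}.
have mj := @measurable_joint_pdf R v0 v1 lambda (m + 1) n.
pose h := (EFin \o @joint_pdf R v0 v1 lambda (m + 1) n) \_ (Theta @^-1` C).
have mh : measurable_fun setT h.
  by apply/(measurable_restrictT _ mE)/measurable_funTS/measurable_EFinP; exact: (mj).
have h0 q : 0 <= h q by apply: erestrict_ge0 => x _; rewrite lee_fin joint_pdf_ge0.
pose g := (EFin \o schur_pdf) \_ C.
have mg : measurable_fun setT g.
  apply/(measurable_restrictT _ mC)/measurable_funTS/measurable_EFinP.
  exact: measurable_schur_pdf.
have g0 q : 0 <= g q by apply: erestrict_ge0 => x _; rewrite lee_fin schur_pdf_ge0.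
rewrite integral_mkcond [RHS]integral_mkcond.
transitivity (\int[sf_product rows (sf_product (latent_law Z) lebesgue_sym)]_t h t).
  by [].
transitivity (\int[sf_product (sf_product schur_base (@lebesgue_mx R m 1)) lebesgueR]_t g t);
  last by [].
rewrite [LHS]integral_sf_product// [RHS]integral_sf_product3//.
pose g2 x := \int[lebesgue_mx]_u \int[lebesgueR]_v g (x, u, v).
have mg1 := measurable_integral lebesgueR mg g0.
have g10 x : 0 <= \int[lebesgueR]_v g (x, v) by exact: integral_ge0.
have mg2 : measurable_fun setT g2.
  exact: (measurable_integral lebesgue_mx mg1 g10).
have g20 x : 0 <= g2 x by exact: integral_ge0.
transitivity (\int[schur_base]_x g2 x); last by [].
rewrite [RHS]integral_sf_product3//.
apply: eq_integral => y _.
have mhy : measurable_fun setT (fun q => h (y, q)) by exact: measurable_fun_pair2.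
rewrite integral_sf_product//; apply: eq_integral => z _.
have mhyz : measurable_fun setT (fun S => h (y, (z, S))).
  exact: (measurable_fun_pair2 z mhy).
rewrite [LHS](integral_lebesgue_sym_addn1 mhyz (fun S => h0 _)).
apply: eq_integral => T _; rewrite /g2; apply: eq_integral => u _.
have mhu : measurable_fun setT (fun s : R => h (y, (z, block_sym T u s))).
  have mb : measurable_fun setT (fun s : R => block_sym T u s).
    exact: measurable_block_sym.
  exact: (measurableT_comp mhyz mb).
(* The shift [qform (invmx T) u] is constant in the last coordinate, which becomes [v]. *)
rewrite [LHS](integral_lebesgueR_shift (qform (invmx T) u) mhu (fun s => h0 _)).
apply: eq_integral => v _; rewrite /h /g !patchE /=.
(* An algebraic identity valid for singular [T] as well: the same [invmx T] is added and
   subtracted. *)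
have ThetaE : Theta (y, (z, block_sym T u (v + qform (invmx T) u)%R)) = (y, z, T, u, v).
  rewrite /Theta /= /block_sym block_mxKul block_mxKur block_mxKdr.
  by rewrite mxE mulr1n schurK.
by rewrite -ThetaE; congr (if _ then _ else _); apply/idP/idP; rewrite !inE.
Qed.

(** The disintegration wants the conditioned variable last; for the law of [u] given [v] the two
    final coordinates are exchanged by Tonelli. *)
Lemma schur_law_swap C : measurable C ->
  P ((fun w => (Y w, Z w, S11 w, schur (S11 w) (S12 w) (S22 w), S12 w)) @^-1` C) =
  \int[sf_product (sf_product schur_base lebesgueR) (@lebesgue_mx R m 1)]_(t in C)
    (schur_pdf (t.1.1, t.2, t.1.2))%:E.
Proof.
move=> mC.
pose sw (t : 'M[R]_(n, m + 1) * latent * 'M[R]_m * 'cV[R]_m * R) := (t.1.1, t.2, t.1.2).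
have msw : measurable_fun setT sw.
  have m11 : measurable_fun setT
      (fun t : 'M[R]_(n, m + 1) * latent * 'M[R]_m * 'cV[R]_m * R => t.1.1).
    exact: measurableT_comp.
  have m12 : measurable_fun setT
      (fun t : 'M[R]_(n, m + 1) * latent * 'M[R]_m * 'cV[R]_m * R => t.1.2).
    exact: measurableT_comp.
  by do 2 apply: measurable_fun_pair => //.
have mE : measurable (sw @^-1` C).
  by rewrite -[X in measurable X]setTI; exact: msw.
transitivity (P ((fun w => (Y w, Z w, S11 w, S12 w, schur (S11 w) (S12 w) (S22 w)))
  @^-1` (sw @^-1` C))); first by [].
rewrite schur_law// integral_mkcond [RHS]integral_mkcond.
rewrite [LHS]integral_sf_product_swap.
- apply: eq_integral => -[[x v] u] _; rewrite !patchE/=.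
  by congr (if _ then _ else _); apply/idP/idP; rewrite !inE.
- apply/(measurable_restrictT _ mE)/measurable_funTS/measurable_EFinP.
  exact: measurable_schur_pdf.
- by move=> t; apply: erestrict_ge0 => x _; rewrite lee_fin schur_pdf_ge0.
Qed.

End schur_coordinates.

(** * Factorization of the joint density *)

Section factorization.
Context {R : realType} (n m : nat) (v0 v1 lambda : R).
Hypotheses (v0_gt0 : 0 < v0) (v1_gt0 : 0 < v1).
Local Notation latent := {ffun tri ltn (m + 1) -> bool}.

(* equal to |y2 - y1 T^-1 u|^2 for y = (y1 y2) and T symmetric, see regression_rssE *)
Definition regression_rss (y : 'M[R]_(n, m + 1)) (T : 'M[R]_m) (u : 'cV[R]_m) : R :=
  (u^T *m invmx T *m ulsubmx (y^T *m y) *m invmx T *m u) ord0 ord0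
  - 2 * ((ursubmx (y^T *m y))^T *m invmx T *m u) ord0 ord0
  + drsubmx (y^T *m y) ord0 ord0.

Lemma regression_rssE y T u : T^T = T ->
  regression_rss y T u =
  \sum_i (rsubmx y i ord0 - (lsubmx y *m (invmx T *m u)) i ord0) ^+ 2.
Proof.
move=> TT; have iT := trmx_invmx TT.
pose e := rsubmx y - lsubmx y *m (invmx T *m u).
transitivity ((e^T *m e) ord0 ord0); last first.
  by rewrite mxE; apply: eq_bigr => i _; rewrite !mxE expr2.
have yE : y^T *m y = block_mx ((lsubmx y)^T *m lsubmx y) ((lsubmx y)^T *m rsubmx y)
    ((rsubmx y)^T *m lsubmx y) ((rsubmx y)^T *m rsubmx y).
  by rewrite -{1 2}(hsubmxK y) tr_row_mx mul_col_row.
rewrite /regression_rss yE block_mxKul block_mxKur block_mxKdr /e.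
move: (lsubmx y) (rsubmx y) => y1 y2 {yE e}.
rewrite [(_ - _)^T]linearB/= !trmx_mul iT trmxK mulmxBr !mulmxBl.
(* The two cross terms are transposes of each other and of size one, hence equal; this produces the
   factor 2. *)
have cE : ((u^T *m invmx T *m y1^T) *m y2) ord0 ord0 =
    (y2^T *m (y1 *m (invmx T *m u))) ord0 ord0.
  have -> : u^T *m invmx T *m y1^T *m y2 = (y2^T *m (y1 *m (invmx T *m u)))^T.
    by rewrite !trmx_mul trmxK iT.
  by rewrite trmx11.
move: cE; rewrite !mulmxA.
move: (u^T *m invmx T *m y1^T *m y2) (y2^T *m y2) (y2^T *m y1 *m invmx T *m u)
  (u^T *m invmx T *m y1^T *m y1 *m invmx T *m u) => a b c e cE.
by rewrite !mxE cE; ring.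
Qed.

(** Regression of the last entry of a row on the others: coefficients [T^-1 u], residual variance
    [v]. *)
Lemma mvn_pdf0_block_sym (T : 'M[R]_m) (u : 'cV[R]_m) (v : R) (y : 'M[R]_(n, m + 1)) i :
  posdef T -> 0 < v ->
  mvn_pdf 0 (block_sym T u (v + qform (invmx T) u)) (row i y)^T =
  mvn_pdf 0 T (row i (lsubmx y))^T * ((Num.sqrt (2 * pi))^-1 * (Num.sqrt v)^-1 *
  expR (- ((rsubmx y i ord0 - (lsubmx y *m (invmx T *m u)) i ord0) ^+ 2 / v) / 2)).
Proof.
move=> pT v_gt0; have [TT _] := pT; have iT := trmx_invmx TT.
have -> : (row i y)^T = col_mx (row i (lsubmx y))^T (rsubmx y i ord0)%:M.
  rewrite -{1}(hsubmxK y) row_row_mx tr_row_mx; congr col_mx.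
  by apply/matrixP => k l; rewrite !ord1 !mxE mulr1n.
have -> : 0 = col_mx 0 (0 : R)%:M :> 'cV[R]_(m + 1) by rewrite raddf0 col_mx0.
rewrite mvn_pdf_block_sym ?schurK// normal_pdf_sqrt// subr0 add0r.
rewrite sqrtrM ?mulr_ge0 ?pi_ge0// invfM.
have -> : (u^T *m invmx T *m (row i (lsubmx y))^T) ord0 ord0 =
    (lsubmx y *m (invmx T *m u)) i ord0.
  by rewrite -(trmx11 (_ *m _)) !trmx_mul !trmxK iT -row_mul mxE.
by [].
Qed.

Lemma prod_expR I (r : seq I) (f : I -> R) :
  \prod_(i <- r) expR (f i) = expR (\sum_(i <- r) f i).
Proof. by rewrite (big_morph expR (@expRD R) (@expR0 R)). Qed.

(** The order of quantifiers matters: [c] may depend on [y] and [T] but precedes [u] and [v], so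
    that one factorization serves both conditionals. *)
Lemma gauss_likelihood_block_sym (y : 'M[R]_(n, m + 1)) (T : 'M[R]_m) : posdef T ->
  exists c, forall (u : 'cV[R]_m) (v : R), 0 < v ->
  gauss_likelihood y (block_sym T u (v + qform (invmx T) u)) =
  c * ((Num.sqrt v)^-1 ^+ n * expR (- (regression_rss y T u / v) / 2)).
Proof.
move=> pT; have [TT _] := pT.
exists (\prod_(i < n) mvn_pdf 0 T (row i (lsubmx y))^T * (Num.sqrt (2 * pi))^-1 ^+ n).
move=> u v v_gt0; rewrite /gauss_likelihood.
under eq_bigr do rewrite mvn_pdf0_block_sym//.
rewrite big_split/= -mulrA; congr (_ * _).
rewrite big_split/= big_split/= !prodr_const card_ord -mulrA; congr (_ * (_ * _)).
by rewrite prod_expR regression_rssE// -mulr_suml sumrN -mulr_suml.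
Qed.

(* extends z by false so that products over i < j can be split by blocks *)
Definition latent_at (z : latent) (ij : 'I_(m + 1) * 'I_(m + 1)) : bool :=
  if insub ij is Some e then z e else false.

Lemma latent_atE (z : latent) (e : tri ltn (m + 1)) : z e = latent_at z (val e).
Proof. by rewrite /latent_at valK. Qed.

Let sd (z : latent) (i : 'I_m) := sd_of v0 v1 (latent_at z (lshift 1 i, rshift m ord0)).

Let sd_gt0 z i : 0 < sd z i.
Proof. by rewrite /sd /sd_of; case: ifP. Qed.

Lemma slab_variances_lastE (z : latent) i :
  (ursubmx (slab_variances v0 v1 z) : 'cV_m) i ord0 = sd z i ^+ 2.
Proof.
rewrite !mxE /sd /latent_at; case: insubP => [e _ _|]; first by rewrite ffunE.
by rewrite /= addn0 ltn_ord.
Qed.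

Lemma qform_diag (e : 'rV[R]_m) (x : 'cV[R]_m) :
  qform (diag_mx e) x = \sum_i e ord0 i * x i ord0 ^+ 2.
Proof.
rewrite /qform mul_mx_diag mxE; apply: eq_bigr => i _; rewrite !mxE expr2.
by rewrite mulrA [e _ _ * _]mulrC.
Qed.

Definition prior_precision (z : latent) : 'M[R]_m :=
  diag_mx (map_mx GRing.inv (ursubmx (slab_variances v0 v1 z) : 'cV_m))^T.

Lemma qform_prior_precision z x :
  qform (prior_precision z) x = \sum_i x i ord0 ^+ 2 / sd z i ^+ 2.
Proof.
rewrite qform_diag; apply: eq_bigr => i _.
by rewrite [X in X * _]mxE [X in X * _]mxE slab_variances_lastE mulrC.
Qed.

Lemma qform_invmx_ge0 (T : 'M[R]_m) u : posdef T -> 0 <= qform (invmx T) u.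
Proof.
move=> pT; have [_ h] := posdef_invmx pT.
have [->|u0] := eqVneq u 0; first by rewrite /qform mulmx0 mxE.
exact/ltW/h.
Qed.

Lemma ss_pdf_block_sym (z : latent) (T : 'M[R]_m) : posdef T ->
  exists c, forall (u : 'cV[R]_m) (v : R), 0 < v ->
  ss_pdf v0 v1 lambda z (block_sym T u (v + qform (invmx T) u)) =
  c * (expR (- (lambda * (v + qform (invmx T) u)) / 2) *
       expR (- qform (prior_precision z) u / 2)).
Proof.
move=> pT; pose F (S : 'M[R]_(m + 1)) ij :=
  normal_pdf 0 (sd_of v0 v1 (latent_at z ij)) (S ij.1 ij.2).
(* Zeros fill the blocks that these factors never read, which makes independence of [u] and [v]
   evident. The witness also gathers the normal peaks of the last column, the leading diagonal, and
   the rate in front of the exponential density of [sigma22]. *)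
pose a := \prod_(e : tri ltn m) F (block_mx T 0 0 0)
  (lshift 1 (val e).1, lshift 1 (val e).2).
pose b := \prod_(i < m) exponential_pdf (lambda / 2) (T i i).
pose g := \prod_(i < m) normal_peak (sd z i).
exists ((ss_const v0 v1 lambda z)^-1 * a * g * b * (lambda / 2)) => u v v_gt0.
set q := qform (invmx T) u; have q_ge0 : 0 <= q by exact: qform_invmx_ge0.
rewrite /ss_pdf /ss_unnormalized indicE mem_set ?mulr1; last first.
  by apply/posdef_block_sym; rewrite schurK.
have -> : \prod_(e : tri ltn (m + 1)) normal_pdf 0 (sd_of v0 v1 (z e))
    (block_sym T u (v + q) (val e).1 (val e).2) =
    a * (g * expR (- qform (prior_precision z) u / 2)).
  rewrite (eq_bigr (fun e => F (block_sym T u (v + q)) (val e))); last first.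
    by move=> e _; rewrite latent_atE.
  rewrite big_tri_addn1//; last by move=> i im; rewrite -leqNgt ltnW.
  (* For the strict order the corner pair is absent, so the last factor of the splitting is 1. *)
  rewrite /= ltnn; congr (_ * _).
    by apply: eq_bigr => e _; rewrite /F /block_sym /= !block_mxEul.
  rewrite [LHS]mulr1 qform_prior_precision mulNr mulr_suml -sumrN -prod_expR -big_split/=.
  apply: eq_bigr => i _; rewrite /F /= block_mxEur -/(sd z i).
  have s_gt0 := sd_gt0 z i; rewrite normal_pdfE ?gt_eqF//.
  rewrite /normal_fun subr0; congr (_ * expR _).
  by rewrite -mulr_natr; field; rewrite gt_eqF.
rewrite big_split_ord/= big_ord1.
have -> : \prod_(i < m) exponential_pdf (lambda / 2)
    (block_sym T u (v + q) (lshift 1 i) (lshift 1 i)) = b.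
  by apply: eq_bigr => i _; rewrite block_mxEul.
have vq_ge0 : 0 <= v + q by rewrite addr_ge0// ltW.
rewrite block_mxEdr mxE mulr1n exponential_pdfE//.
rewrite (_ : - (lambda / 2) * (v + q) = - (lambda * (v + q)) / 2); last by field.
ring.
Qed.

Lemma joint_pdf_block_sym (y : 'M[R]_(n, m + 1)) (z : latent) (T : 'M[R]_m) :
  posdef T -> exists c, forall (u : 'cV[R]_m) (v : R), 0 < v ->
  joint_pdf v0 v1 lambda (y, (z, block_sym T u (v + qform (invmx T) u))) =
  c * ((Num.sqrt v)^-1 ^+ n *
    expR (- (regression_rss y T u / v + lambda * (v + qform (invmx T) u) +
      qform (prior_precision z) u) / 2)).
Proof.
move=> pT; have [c1 h1] := gauss_likelihood_block_sym y pT.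
have [c2 h2] := ss_pdf_block_sym z pT.
exists (c1 * c2) => u v v_gt0; rewrite /joint_pdf/= h1// h2//.
by rewrite !opprD !mulrDl !expRD; ring.
Qed.

Lemma joint_pdf_notposdef (y : 'M[R]_(n, m + 1)) (z : latent) (S : 'M[R]_(m + 1)) :
  ~ posdef S -> joint_pdf v0 v1 lambda (y, (z, S)) = 0.
Proof.
by move=> nS; rewrite /joint_pdf /ss_pdf /ss_unnormalized/= indicE memNset// !mulr0.
Qed.

End factorization.

(** * Recognizing the normal and generalized inverse Gaussian factors *)

Section gaussian_conditional.
Context {R : realType} (n m : nat) (v0 v1 lambda : R).
Hypotheses (v0_gt0 : 0 < v0) (v1_gt0 : 0 < v1) (lambda_gt0 : 0 < lambda).
Local Notation latent := {ffun tri ltn (m + 1) -> bool}.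

Lemma qformD k (A B : 'M[R]_k) x : qform (A + B) x = qform A x + qform B x.
Proof. by rewrite /qform mulmxDr mulmxDl mxE. Qed.

Lemma qformZ k a (A : 'M[R]_k) x : qform (a *: A) x = a * qform A x.
Proof. by rewrite /qform -scalemxAr -scalemxAl mxE. Qed.

Lemma qform_gram_ge0 (A : 'M[R]_m) (X : 'M[R]_(n, m)) (x : 'cV[R]_m) : A^T = A ->
  0 <= qform (A *m (X^T *m X) *m A) x.
Proof.
move=> AT; rewrite /qform.
have -> : x^T *m (A *m (X^T *m X) *m A) *m x = (X *m (A *m x))^T *m (X *m (A *m x)).
  by rewrite !trmx_mul AT !mulmxA.
by rewrite mxE sumr_ge0// => i _; rewrite mxE -expr2 sqr_ge0.
Qed.

(** This is [B + diag(v12^-1)], kept convertible with the expression in the final statement. *)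
Definition posterior_precision (y : 'M[R]_(n, m + 1)) (z : latent) (T : 'M[R]_m)
    (v : R) : 'M[R]_m :=
  v^-1 *: (invmx T *m ulsubmx (y^T *m y) *m invmx T) + lambda *: invmx T +
  prior_precision v0 v1 z.

Definition posterior_shift (y : 'M[R]_(n, m + 1)) (T : 'M[R]_m) (v : R) : 'cV[R]_m :=
  v^-1 *: (invmx T *m ursubmx (y^T *m y)).

Lemma ulsubmx_gram (y : 'M[R]_(n, m + 1)) :
  ulsubmx (y^T *m y) = (lsubmx y)^T *m lsubmx y.
Proof. by rewrite -{1 2}(hsubmxK y) tr_row_mx mul_col_row block_mxKul. Qed.

(** Strict positivity comes from [lambda T^-1]; the Gram term, possibly singular, and the prior term
    are only nonnegative. *)
Lemma posdef_posterior_precision y z T v : posdef T -> 0 < v ->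
  posdef (posterior_precision y z T v).
Proof.
move=> pT v_gt0; have [TT _] := pT; have iT := trmx_invmx TT.
split.
  rewrite /posterior_precision ulsubmx_gram /prior_precision.
  by rewrite !linearD/= !linearZ/= tr_diag_mx iT !trmx_mul trmxK iT !mulmxA.
move=> x x0; rewrite -/(qform _ _) !qformD !qformZ ulsubmx_gram.
apply: ltr_wpDr.
  rewrite qform_prior_precision; apply: sumr_ge0 => i _.
  by rewrite divr_ge0 ?sqr_ge0.
apply: ltr_wpDl.
  by rewrite mulr_ge0 ?qform_gram_ge0// invr_ge0 ltW.
by rewrite mulr_gt0//; have [_] := posdef_invmx pT; exact.
Qed.

Lemma complete_square k (M : 'M[R]_k) (b x : 'cV[R]_k) : posdef M ->
  qform M x - 2 * (b^T *m x) ord0 ord0 =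
  qform M (x - invmx M *m b) - qform (invmx M) b.
Proof.
move=> pM; have [MT _] := pM; have uM := posdef_unitmx pM.
have iM := trmx_invmx MT.
rewrite /qform [(x - _)^T]linearB/= trmx_mul iM !mulmxBl mulmxBr mulmxKV//.
have -> : x^T *m M *m (invmx M *m b) = x^T *m b by rewrite mulmxA mulmxK.
have -> : b^T *m (x - invmx M *m b) = b^T *m x - b^T *m invmx M *m b.
  by rewrite mulmxBr mulmxA.
have -> : x^T *m b = b^T *m x by rewrite -(trmx11 (x^T *m b)) trmx_mul trmxK.
move: (x^T *m M *m x) (b^T *m x) (b^T *m invmx M *m b) => a c e.
by rewrite !mxE; ring.
Qed.

Lemma rss_posteriorE y z T (u : 'cV[R]_m) v : T^T = T ->
  regression_rss y T u / v + lambda * (v + qform (invmx T) u) +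
    qform (prior_precision v0 v1 z) u =
  qform (posterior_precision y z T v) u -
    2 * ((posterior_shift y T v)^T *m u) ord0 ord0 +
    (drsubmx (y^T *m y) ord0 ord0 / v + lambda * v).
Proof.
move=> TT; have iT := trmx_invmx TT.
rewrite /posterior_precision !qformD !qformZ /posterior_shift /regression_rss.
have -> : ((v^-1 *: (invmx T *m ursubmx (y^T *m y)))^T *m u) ord0 ord0 =
    v^-1 * ((ursubmx (y^T *m y))^T *m invmx T *m u) ord0 ord0.
  by rewrite linearZ/= trmx_mul iT -scalemxAl mxE.
have -> : qform (invmx T *m ulsubmx (y^T *m y) *m invmx T) u =
    (u^T *m invmx T *m ulsubmx (y^T *m y) *m invmx T *m u) ord0 ord0.
  by rewrite /qform !mulmxA.
ring.
Qed.

(** Either the block matrix lies outside the positive definite cone whatever [u] is, and the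
    indicator in the prior kills the density, or the exponent is a positive definite quadratic
    polynomial in [u]. *)
Lemma schur_pdf_mvn (y : 'M[R]_(n, m + 1)) (z : latent) (T : 'M[R]_m) (v : R) :
  let C := invmx (posterior_precision y z T v) in
  (forall u, schur_pdf v0 v1 lambda (y, z, T, u, v) = 0) \/
  (exists2 c, (forall u, schur_pdf v0 v1 lambda (y, z, T, u, v) =
      c * mvn_pdf (C *m posterior_shift y T v) C u) &
   (\int[lebesgue_mx]_u (mvn_pdf (C *m posterior_shift y T v) C u)%:E = 1)%E).
Proof.
move=> C; have [[pT v_gt0]|npT] := pselect (posdef T /\ 0 < v); last first.
  left=> u; apply: joint_pdf_notposdef.
  by rewrite posdef_block_sym schurK.
right; have [TT _] := pT.
have pM := posdef_posterior_precision y z pT v_gt0.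
pose M := posterior_precision y z T v; rewrite -/M in pM.
have pC : posdef C by exact: posdef_invmx.
set b := posterior_shift y T v.
have [c0 h] := joint_pdf_block_sym lambda v0_gt0 v1_gt0 y z pT.
pose K := Num.sqrt ((2 * pi) ^+ m * \det C).
have K_gt0 : 0 < K.
  by rewrite sqrtr_gt0 mulr_gt0 ?exprn_gt0 ?mulr_gt0 ?pi_gt0//; exact: det_posdef.
(* [K] cancels the normalizer of the normal density; the exponential holds the terms free of [u],
   including [qform C b] left over from completing the square. *)
exists (c0 * (Num.sqrt v)^-1 ^+ n * K *
  expR (- (drsubmx (y^T *m y) ord0 ord0 / v + lambda * v - qform C b) / 2)); last first.
  exact: integral_mvn_pdf.
move=> u; rewrite [LHS]h// rss_posteriorE// complete_square//.
rewrite /mvn_pdf -/K /C invmxK -/C -/M -/b -/(qform _ _).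
rewrite (_ : - (_ + _) / 2 =
  - qform M (u - C *m b) / 2 +
  (- (drsubmx (y^T *m y) ord0 ord0 / v + lambda * v - qform C b) / 2)).
  by rewrite expRD; field; rewrite gt_eqF.
by rewrite -/C; ring.
Qed.

Lemma regression_rss_ge0 y T (u : 'cV[R]_m) : T^T = T -> 0 <= @regression_rss R n m y T u.
Proof. by move=> TT; rewrite regression_rssE// sumr_ge0// => i _; exact: sqr_ge0. Qed.

(** For positive definite [T] the rss is a sum of squares, so being nonzero makes it positive, as
    the normalization of the GIG density demands. *)
Lemma schur_pdf_gig (y : 'M[R]_(n, m + 1)) (z : latent) (T : 'M[R]_m) (u : 'cV[R]_m) :
  let k v := gig_pdf (1 - n%:R / 2) lambda (regression_rss y T u) v in
  regression_rss y T u != 0 ->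
  (forall v, schur_pdf v0 v1 lambda (y, z, T, u, v) = 0) \/
  (exists2 c, (forall v, schur_pdf v0 v1 lambda (y, z, T, u, v) = c * k v) &
   (\int[lebesgue_measure]_v (k v)%:E = 1)%E).
Proof.
move=> k rss0; have [pT|npT] := pselect (posdef T); last first.
  left=> v; apply: joint_pdf_notposdef.
  by rewrite posdef_block_sym => -[].
right; have [TT _] := pT.
set r := regression_rss y T u in k rss0 *.
have r_gt0 : 0 < r by rewrite lt0r rss0 regression_rss_ge0.
have [c0 h] := joint_pdf_block_sym lambda v0_gt0 v1_gt0 y z pT.
(* The index is read off from [v^(- n / 2) = v^(q - 1)]. *)
pose q : R := 1 - n%:R / 2.
pose K := (lambda / r) `^ (q / 2) / (2 * besselK q (Num.sqrt (lambda * r))).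
have K_gt0 : 0 < K.
  rewrite divr_gt0 ?powR_gt0 ?divr_gt0// mulr_gt0// besselK_gt0//.
  by rewrite sqrtr_gt0 mulr_gt0.
exists (c0 / K *
  expR (- (lambda * qform (invmx T) u + qform (prior_precision v0 v1 z) u) / 2));
  last exact: integral_gig_pdf.
(* For [v <= 0] both sides vanish: the GIG density by its cutoff, the joint density because the
   Schur complement of the block matrix is [v]. *)
move=> v; rewrite /k /gig_pdf -/q -/K; case: ifPn => v_gt0; last first.
  rewrite mulr0; apply: joint_pdf_notposdef.
  by rewrite posdef_block_sym schurK => -[_]; exact/negP.
rewrite [LHS]h// -/r.
have -> : (Num.sqrt v)^-1 ^+ n = v `^ (q - 1).
  rewrite exprVn -powR12_sqrt ?ltW// -powR_mulrn ?powR_ge0// -powRrM -powRN.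
  by congr (_ `^ _); rewrite /q; field.
rewrite (_ : - (_ + _) / 2 = - (lambda * v + r / v) / 2 +
  (- (lambda * qform (invmx T) u + qform (prior_precision v0 v1 z) u) / 2)).
  by rewrite expRD; field; rewrite gt_eqF.
by field; rewrite gt_eqF.
Qed.

End gaussian_conditional.

(** * The residual sum of squares is almost surely nonzero *)

Section residual_null.
Local Open Scope ereal_scope.
Context {R : realType} (n m : nat) (v0 v1 lambda : R) (lambda_gt0 : (0 < lambda)%R).
Context d (Omega : measurableType d) (P : probability Omega R).
Local Notation latent := {ffun tri ltn (m + 1) -> bool}.
Variables (Y : {RV P >-> 'M[R]_(n, m + 1)}) (Sigma : {RV P >-> 'M[R]_(m + 1)}).
Variable (Z : {RV P >-> latent}).
Hypothesis Sigma_prior : cond_law P Sigma Z (ss_law v0 v1 lambda).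
Hypothesis Y_sample : cond_iid_rows P Y (fun w => (Sigma w, Z w)) (fun sz => mvn 0%R sz.1).

Lemma measurable_regression_rss e (X : measurableType e) (y : X -> 'M[R]_(n, m + 1))
    (T : X -> 'M[R]_m) (u : X -> 'cV[R]_m) :
  measurable_fun setT y -> measurable_fun setT T -> measurable_fun setT u ->
  measurable_fun setT (fun t => regression_rss (y t) (T t) (u t)).
Proof.
move=> my mT mu; have miT := measurable_invmx mT.
have mG : measurable_fun setT (fun t => (y t)^T *m y t).
  by apply: measurable_mulmx => //; exact: measurable_trmx.
apply: measurable_funD.
  apply: measurable_funB.
    apply: measurable_coef; do 2 apply: measurable_mulmx => //.
    apply: measurable_mulmx; last exact: measurable_ulsubmx.
    by apply: measurable_mulmx => //; exact: measurable_trmx.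
  apply: measurable_funM => //; apply: measurable_coef.
  do 2 apply: measurable_mulmx => //.
  by apply: measurable_trmx; exact: measurable_ursubmx.
by apply: measurable_coef; exact: measurable_drsubmx.
Qed.

Lemma regression_rss_eq0 (y : 'M[R]_(n, m + 1)) T u i : T^T = T ->
  regression_rss y T u = 0%R -> hyperplane (invmx T *m u) (row i y)^T.
Proof.
move=> TT; rewrite regression_rssE// => /eqP.
rewrite psumr_eq0; last by move=> j _; exact: sqr_ge0.
move=> /allP /(_ i); rewrite mem_index_enum => /(_ isT) /=.
rewrite sqrf_eq0 subr_eq0 => /eqP e0; rewrite /hyperplane /=.
rewrite -(trmx11 (_ *m usubmx _)) trmx_mul trmxK.
transitivity (rsubmx y i ord0); first by rewrite !mxE.
rewrite e0; have -> : usubmx (row i y)^T = (row i (lsubmx y))^T.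
  by apply/matrixP => k l; rewrite !mxE.
by rewrite trmxK -row_mul [RHS]mxE.
Qed.

(** At a fixed positive definite covariance, a zero rss puts every row, in particular the first, on
    one hyperplane determined by that covariance. *)
Lemma regression_rss_ae (n_gt0 : (0 < n)%N) :
  P ((fun w => regression_rss (Y w) (ulsubmx (Sigma w)) (ursubmx (Sigma w)))
    @^-1` [set 0%R]) = 0.
Proof.
pose E := [set q : 'M[R]_(n, m + 1) * (latent * 'M[R]_(m + 1)) |
  regression_rss q.1 (ulsubmx q.2.2) (ursubmx q.2.2) = 0%R].
have mE : measurable E.
  have m2 : measurable_fun setT
      (fun q : 'M[R]_(n, m + 1) * (latent * 'M[R]_(m + 1)) => q.2.2).
    exact: measurableT_comp.
  rewrite -[X in measurable X]setTI.
  apply: (measurable_regression_rss (y := fst) _ (measurable_ulsubmx m2)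
    (measurable_ursubmx m2) measurableT (Y := [set 0%R])) => //.
transitivity (P ((fun w => (Y w, (Z w, Sigma w))) @^-1` E)); first by [].
rewrite (joint_law lambda_gt0 Sigma_prior Y_sample mE) integral_mkcond.
have mj := @measurable_joint_pdf R v0 v1 lambda (m + 1) n.
pose h := (EFin \o @joint_pdf R v0 v1 lambda (m + 1) n) \_ E.
have mh : measurable_fun setT h.
  by apply/(measurable_restrictT _ mE)/measurable_funTS/measurable_EFinP; exact: (mj).
have h0 q : 0 <= h q by apply: erestrict_ge0 => x _; rewrite lee_fin joint_pdf_ge0.
pose rows := rows_measure (@lebesgue_mx R (m + 1) 1) n.
transitivity (\int[rows \x sf_product (latent_law Z) lebesgue_sym]_q h q); first by [].
(* The data are integrated innermost, since the hyperplane depends on [S]. *)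
rewrite (fubini_tonelli2 h)//; apply: integral0_eq => -[z S] _.
rewrite /fubini_G.
have [pS|nS] := pselect (posdef S); last first.
  apply: integral0_eq => y _; rewrite /h patchE; case: ifP => // _.
  by rewrite /= joint_pdf_notposdef.
have TT : (ulsubmx S)^T = ulsubmx S by rewrite trmx_ulsub; have [->] := pS.
(* One row is enough, and [n > 0] provides it. *)
pose i0 : 'I_n := Ordinal n_gt0.
pose a := invmx (ulsubmx S) *m ursubmx S.
pose N := [set y : 'M[R]_(n, m + 1) | hyperplane a (row i0 y)^T].
have mN : measurable N.
  rewrite -[X in measurable X]setTI.
  have mr : measurable_fun setT (fun y : 'M[R]_(n, m + 1) => (row i0 y)^T).
    by apply: measurable_trmx; exact: measurable_row.
  by apply: mr => //; exact: measurable_hyperplane.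
transitivity (\int[rows]_(y in N) h (y, (z, S))).
  rewrite [RHS]integral_mkcond; apply: eq_integral => y _; rewrite [RHS]patchE.
  case: ifPn => // /negP yN; rewrite /h patchE; case: ifPn => // yE.
  exfalso; apply: yN; rewrite inE; move: yE; rewrite inE => yE.
  exact: regression_rss_eq0.
apply: null_set_integral => //.
- by apply: measurable_funTS; exact: (measurable_fun_pair1 (z, S) mh).
(* Stated for a fresh size [k] so that it can be split as a successor. *)
- have rowsN k (k0 : (0 < k)%N) : rows_measure (@lebesgue_mx R (m + 1) 1) k
      [set y | hyperplane a (row (Ordinal k0) y)^T] = 0.
    case: k k0 => // k k0.
    rewrite (_ : Ordinal _ = ord0); last exact/val_inj.
    apply: rows_measure_row0; first exact: measurable_hyperplane.
    exact: lebesgue_hyperplane.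
  exact: rowsN.
Qed.

End residual_null.

(** * The two full conditional distributions *)

Section conditional_laws.
Local Open Scope ereal_scope.
Context {R : realType} (n m : nat) (v0 v1 lambda : R).
Hypotheses (v0_gt0 : (0 < v0)%R) (v1_gt0 : (0 < v1)%R) (lambda_gt0 : (0 < lambda)%R).
Context d (Omega : measurableType d) (P : probability Omega R).
Local Notation latent := {ffun tri ltn (m + 1) -> bool}.
Variables (Y : {RV P >-> 'M[R]_(n, m + 1)}) (Sigma : {RV P >-> 'M[R]_(m + 1)}).
Variable (Z : {RV P >-> latent}).
Hypothesis Sigma_prior : cond_law P Sigma Z (ss_law v0 v1 lambda).
Hypothesis Y_sample : cond_iid_rows P Y (fun w => (Sigma w, Z w)) (fun sz => mvn 0%R sz.1).

Let S11 w : 'M[R]_m := ulsubmx (Sigma w).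
Let S12 w : 'cV[R]_m := ursubmx (Sigma w).
Let V w := schur (S11 w) (S12 w) (drsubmx (Sigma w) ord0 ord0).

Let mS11 : measurable_fun setT S11. Proof. exact: measurable_ulsubmx. Qed.
Let mS12 : measurable_fun setT S12. Proof. exact: measurable_ursubmx. Qed.
Let mV : measurable_fun setT V.
Proof.
apply: measurable_funB; first exact/measurable_coef/measurable_drsubmx.
by apply: measurable_qform => //; exact: measurable_invmx.
Qed.

Let mYZS : measurable_fun setT (fun w => (Y w, Z w, S11 w)).
Proof. by do 2 apply: measurable_fun_pair => //. Qed.

Let F_ge0 := @schur_pdf_ge0 R n m v0 v1 lambda lambda_gt0.
Let mF := @measurable_schur_pdf R n m v0 v1 lambda.

Lemma measurable_posterior_precision d1 (T1 : measurableType d1)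
    (y : T1 -> 'M[R]_(n, m + 1)) (z : T1 -> latent) (T : T1 -> 'M[R]_m) (x : T1 -> R) :
  measurable_fun setT y -> measurable_fun setT z -> measurable_fun setT T ->
  measurable_fun setT x ->
  measurable_fun setT (fun t => posterior_precision v0 v1 lambda (y t) (z t) (T t) (x t)).
Proof.
move=> my mz mT mx; have miT := measurable_invmx mT.
have mG : measurable_fun setT (fun t => (y t)^T *m y t).
  by apply: measurable_mulmx => //; exact: measurable_trmx.
apply: measurable_addmx; last first.
  by apply: (measurableT_comp (measurable_fun_ffun_bool _) mz).
apply: measurable_addmx; apply: measurable_scalemx => //; first exact: measurable_invr.
apply: measurable_mulmx => //; apply: measurable_mulmx => //.
exact: measurable_ulsubmx.
Qed.

Lemma measurable_posterior_shift d1 (T1 : measurableType d1)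
    (y : T1 -> 'M[R]_(n, m + 1)) (T : T1 -> 'M[R]_m) (x : T1 -> R) :
  measurable_fun setT y -> measurable_fun setT T -> measurable_fun setT x ->
  measurable_fun setT (fun t => posterior_shift (y t) (T t) (x t)).
Proof.
move=> my mT mx; apply: measurable_scalemx; first exact: measurable_invr.
apply: measurable_mulmx; first exact: measurable_invmx.
apply: measurable_ursubmx; apply: measurable_mulmx => //.
exact: measurable_trmx.
Qed.

Lemma cond_law_offdiag :
  cond_law P S12 (fun w => (Y w, Z w, S11 w, V w)) (fun '(y, z, T, x) =>
    let C := invmx (posterior_precision v0 v1 lambda y z T x) in
    mvn (C *m posterior_shift y T x)%R C).
Proof.
pose W w := (Y w, Z w, S11 w, V w).
have mW : measurable_fun setT W by exact: measurable_fun_pair.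
(* [schur_pdf] takes [u] before [v]; here [u] comes last, as the conditioned variable. *)
pose F (t : 'M[R]_(n, m + 1) * latent * 'M[R]_m * R * 'cV[R]_m) :=
  schur_pdf v0 v1 lambda (t.1.1, t.2, t.1.2).
pose C (w : 'M[R]_(n, m + 1) * latent * 'M[R]_m * R) :=
  invmx (posterior_precision v0 v1 lambda w.1.1.1 w.1.1.2 w.1.2 w.2).
pose k (t : 'M[R]_(n, m + 1) * latent * 'M[R]_m * R * 'cV[R]_m) : R :=
  mvn_pdf (C t.1 *m posterior_shift t.1.1.1.1 t.1.1.2 t.1.2)%R (C t.1) t.2.
have p11 : measurable_fun setT
    (fun t : 'M[R]_(n, m + 1) * latent * 'M[R]_m * R * 'cV[R]_m => t.1.1).
  exact: measurableT_comp.
have p12 : measurable_fun setT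
    (fun t : 'M[R]_(n, m + 1) * latent * 'M[R]_m * R * 'cV[R]_m => t.1.2).
  exact: measurableT_comp.
have p111 : measurable_fun setT
    (fun t : 'M[R]_(n, m + 1) * latent * 'M[R]_m * R * 'cV[R]_m => t.1.1.1).
  exact: (measurableT_comp measurable_fst p11).
have p112 : measurable_fun setT
    (fun t : 'M[R]_(n, m + 1) * latent * 'M[R]_m * R * 'cV[R]_m => t.1.1.2).
  exact: (measurableT_comp measurable_snd p11).
have p1111 : measurable_fun setT
    (fun t : 'M[R]_(n, m + 1) * latent * 'M[R]_m * R * 'cV[R]_m => t.1.1.1.1).
  exact: (measurableT_comp measurable_fst p111).
have p1112 : measurable_fun setT
    (fun t : 'M[R]_(n, m + 1) * latent * 'M[R]_m * R * 'cV[R]_m => t.1.1.1.2).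
  exact: (measurableT_comp measurable_snd p111).
have mF' : measurable_fun setT F.
  by apply: (measurableT_comp (mF)); do 2 apply: measurable_fun_pair => //.
have mC : measurable_fun setT
    (fun t : 'M[R]_(n, m + 1) * latent * 'M[R]_m * R * 'cV[R]_m => C t.1).
  by apply: measurable_invmx; exact: measurable_posterior_precision.
have mk : measurable_fun setT k.
  apply: measurable_mvn_pdf => //; apply: measurable_mulmx => //.
  exact: measurable_posterior_shift.
apply: (cond_law_ext (K := fun w A => \int[lebesgue_mx]_(x in A) (k (w, x))%:E)).
  by move=> [[[y z] T] x] A mA.
apply: (cond_law_density mW (nu := sf_product (schur_base n Z) lebesgueR) (F := F)) => //.
- by move=> t; exact: F_ge0.
- by move=> t; exact: mvn_pdf_ge0.
- by move=> [[[y z] T] x]; exact: schur_pdf_mvn.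
move=> A D mA mD; rewrite setIC.
have mDA : measurable (D `*` A) by exact: measurableX.
transitivity (P ((fun w => (Y w, Z w, S11 w, V w, S12 w)) @^-1` (D `*` A))); first by [].
rewrite (schur_law_swap lambda_gt0 Sigma_prior Y_sample mDA).
have F0 t : 0 <= (EFin \o F) t by rewrite lee_fin F_ge0.
have mEF : measurable_fun setT (EFin \o F) by exact/measurable_EFinP.
exact: (integral_prod_rect _ _ mEF F0 mD mA).
Qed.

(** Same scheme as for [u], except that the values with zero rss must first be removed from the
    joint density, because the GIG kernel need not be a probability there. *)
Lemma cond_law_schur (n_gt0 : (0 < n)%N) :
  cond_law P V (fun w => (Y w, Z w, S11 w, S12 w)) (fun '(y, z, T, x) =>
    gig (1 - n%:R / 2) lambda (regression_rss y T x)).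
Proof.
pose W w := (Y w, Z w, S11 w, S12 w).
have mW : measurable_fun setT W by exact: measurable_fun_pair.
pose r (w : 'M[R]_(n, m + 1) * latent * 'M[R]_m * 'cV[R]_m) :=
  regression_rss w.1.1.1 w.1.2 w.2.
(* Setting the density to 0 where rss vanishes puts these values in the first alternative of [FE];
   [regression_rss_ae] shows that it still represents the law. *)
pose F (t : 'M[R]_(n, m + 1) * latent * 'M[R]_m * 'cV[R]_m * R) : R :=
  if r t.1 == 0%R then 0%R else schur_pdf v0 v1 lambda t.
pose k (t : 'M[R]_(n, m + 1) * latent * 'M[R]_m * 'cV[R]_m * R) : R :=
  gig_pdf (1 - n%:R / 2) lambda (r t.1) t.2.
have mr : measurable_fun setT r.
  have q11 : measurable_fun setT
      (fun w : 'M[R]_(n, m + 1) * latent * 'M[R]_m * 'cV[R]_m => w.1.1).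
    exact: measurableT_comp.
  have q12 : measurable_fun setT
      (fun w : 'M[R]_(n, m + 1) * latent * 'M[R]_m * 'cV[R]_m => w.1.2).
    exact: measurableT_comp.
  apply: measurable_regression_rss => //.
  exact: (measurableT_comp measurable_fst q11).
have mr1 : measurable_fun setT
    (fun t : 'M[R]_(n, m + 1) * latent * 'M[R]_m * 'cV[R]_m * R => r t.1).
  exact: measurableT_comp.
have mF' : measurable_fun setT F.
  by apply: measurable_fun_ifT => //; exact: measurable_fun_eqr.
have mk : measurable_fun setT k by exact: measurable_gig_pdf.
have F0 t : (0 <= F t)%R by rewrite /F; case: ifP => // _; exact: F_ge0.
pose K w A := \int[lebesgueR]_(x in A) (k (w, x))%:E.
apply: (cond_law_ext (K := K)).
  move=> [[[y z] T] x] A mA; rewrite /K integral_lebesgueR//.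
    apply: measurable_funTS; apply/measurable_EFinP.
    exact: (measurable_fun_pair2 (y, z, T, x) mk).
  by move=> v; rewrite lee_fin gig_pdf_ge0.
apply: (cond_law_density mW (nu := sf_product (schur_base n Z) (@lebesgue_mx R m 1))
  (F := F)) => //.
- by move=> t; exact: gig_pdf_ge0.
- move=> [[[y z] T] x]; rewrite /F /=.
  have [r0|r0] := eqVneq (r (y, z, T, x)) 0%R; first by left.
  have := schur_pdf_gig v0_gt0 v1_gt0 lambda_gt0 z r0.
  move=> [h|[c cE k1]]; [by left|right; exists c => //].
  rewrite integral_lebesgueR//.
    by apply/measurable_EFinP; exact: (measurable_fun_pair2 (y, z, T, x) mk).
  by move=> v; rewrite lee_fin gig_pdf_ge0.
move=> A D mA mD.
pose N := [set w | r w = 0%R].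
have mN : measurable N.
  by rewrite -[X in measurable X]setTI; exact: (mr measurableT [set 0%R]).
have mDN : measurable (D `\` N) by exact: measurableD.
have PWN : P (W @^-1` N) = 0.
  exact: (regression_rss_ae lambda_gt0 Sigma_prior Y_sample n_gt0).
have mX B' : measurable B' -> measurable (W @^-1` B').
  by move=> mB'; rewrite -[X in measurable X]setTI; exact: mW.
have mVA : measurable (V @^-1` A).
  by rewrite -[X in measurable X]setTI; exact: mV.
(* Discarding the null event [N] leaves the probability unchanged; outside [N] the modified density
   agrees with [schur_pdf]. *)
transitivity (P (V @^-1` A `&` W @^-1` (D `\` N))).
  apply/eqP; rewrite eq_le; apply/andP; split; last first.
    apply: le_measure; rewrite ?inE; [..|by move=> w [? []]].
    - by apply: measurableI => //; exact: mX.
    - by apply: measurableI => //; exact: mX.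
  rewrite -[leRHS]adde0 -PWN; apply: le_trans (measureU2 _ _ _).
  - apply: le_measure; rewrite ?inE.
    + by apply: measurableI => //; exact: mX.
    + by apply: measurableU; [apply: measurableI => //|]; exact: mX.
    + move=> w [Aw Dw]; have [Nw|Nw] := pselect (N (W w)); [by right|by left].
  - by apply: measurableI => //; exact: mX.
  - exact: mX.
rewrite setIC.
have mDA : measurable ((D `\` N) `*` A) by exact: measurableX.
transitivity (P ((fun w => (Y w, Z w, S11 w, S12 w, V w)) @^-1` ((D `\` N) `*` A))).
  by [].
rewrite (schur_law lambda_gt0 Sigma_prior Y_sample mDA).
transitivity (\int[sf_product (schur_base n Z) lebesgue_mx]_(w in D `\` N)
    \int[lebesgueR]_(x in A) (F (w, x))%:E).
  have S0 t : 0 <= (EFin \o @schur_pdf R n m v0 v1 lambda) t.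
    by rewrite lee_fin; exact: F_ge0.
  have mS : measurable_fun setT (EFin \o @schur_pdf R n m v0 v1 lambda).
    by apply/measurable_EFinP; exact: (mF).
  rewrite [LHS](integral_prod_rect _ _ mS S0 mDN mA).
  apply: eq_integral => w; rewrite inE => -[_ /eqP rw].
  by apply: eq_integral => x _; rewrite /F /= (negbTE rw).
(* Returning from [D] without [N] to [D] costs nothing, since [F] is 0 on [N]. *)
rewrite [LHS]integral_mkcond [RHS]integral_mkcond; apply: eq_integral => w _.
rewrite !patchE; case: ifPn => [|/negP wDN]; case: ifPn => [|/negP wD] //.
  by rewrite !inE in wD * => -[].
rewrite inE => wD; apply/esym/integral0_eq => x _; rewrite /F /=.
have [//|rw] := eqVneq (r w) 0%R.
by exfalso; apply: wDN; rewrite inE; split=> //; exact/eqP.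
Qed.

End conditional_laws.

Theorem proposition2 (R : realType) (n m : nat) (v0 v1 lambda pi0 : R)
  (n_gt0 : (0 < n)%N) (v0_gt0 : 0 < v0) (v1_gt0 : 0 < v1)
  (lambda_gt0 : 0 < lambda) (pi0_gt0 : 0 < pi0) (pi0_lt1 : pi0 < 1)
  (d : measure_display) (Omega : measurableType d) (P : probability Omega R)
  (Y : {RV P >-> 'M[R]_(n, m + 1)})
  (Sigma : {RV P >-> 'M[R]_(m + 1)})
  (Z : {RV P >-> {ffun tri ltn (m + 1) -> bool}})
  (Z_prior : forall z,
    P (Z @^-1` [set z]) = (latent_pmf v0 v1 lambda pi0 z)%:E)
  (Sigma_prior : cond_law P Sigma Z (ss_law v0 v1 lambda))
  (Y_sample : cond_iid_rows P Y (fun w => (Sigma w, Z w))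
    (fun sz => mvn 0 sz.1)) :
  let Sigma11 w : 'M[R]_m := ulsubmx (Sigma w) in
  let u w : 'cV[R]_m := ursubmx (Sigma w) in
  let sigma22 w : R := (drsubmx (Sigma w)) ord0 ord0 in
  let v w : R :=
    sigma22 w - ((u w)^T *m invmx (Sigma11 w) *m u w) ord0 ord0 in
  let S11 (y : 'M[R]_(n, m + 1)) : 'M[R]_m := ulsubmx (y^T *m y) in
  let s12 (y : 'M[R]_(n, m + 1)) : 'cV[R]_m := ursubmx (y^T *m y) in
  let s22 (y : 'M[R]_(n, m + 1)) : R := drsubmx (y^T *m y) ord0 ord0 in
  let v12 z : 'cV[R]_m := ursubmx (slab_variances v0 v1 z) in
  let B y T x : 'M[R]_m :=
    x^-1 *: (invmx T *m S11 y *m invmx T) + lambda *: invmx T in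
  let b y T x : 'cV[R]_m := x^-1 *: (invmx T *m s12 y) in
  cond_law P u (fun w => (Y w, Z w, Sigma11 w, v w))
    (fun '(y, z, T, x) =>
       let C := invmx (B y T x + diag_mx (map_mx GRing.inv (v12 z))^T) in
       mvn (C *m b y T x) C)
  /\
  cond_law P v (fun w => (Y w, Z w, Sigma11 w, u w))
    (fun '(y, z, T, x) =>
       gig (1 - n%:R / 2) lambda
         ((x^T *m invmx T *m S11 y *m invmx T *m x) ord0 ord0
          - 2 * ((s12 y)^T *m invmx T *m x) ord0 ord0 + s22 y)).
Proof.
split; first exact: (cond_law_offdiag v0_gt0 v1_gt0 lambda_gt0 Sigma_prior Y_sample).
exact: (cond_law_schur v0_gt0 v1_gt0 lambda_gt0 Sigma_prior Y_sample n_gt0).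
Qed.
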